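(* Let $0\to U\to V\to W\to0$ be an Auslander-Reiten sequence in $\mathrm{rep}_k(A_{\mathbb R})$. Then it is (up to isomorphism) one of the 16 types (1)--(16).
   Context: Fix a field $k$. A quiver of continuous type $A$ is a triple $A_{\mathbb R}=(\mathbb R,S,\preceq)$: $S\subset\mathbb R$ is a discrete (possibly empty) subset without accumulation points; $\bar S=S\cup\{\pm\infty\}$ with $-\infty<s<+\infty$ for $s\in S$; the elements of $\bar S$ are indexed in increasing order by a convex subset of $\mathbb Z\cup\{\pm\infty\}$ containing $0$, $s_n$ being the element of index $n$; $\preceq$ is the partial order on $\mathbb R$ for which two points are comparable only if they lie in a common closed interval between consecutive elements of $\bar S$, on each such interval $\preceq$ is $\le$ or its reverse, the direction reverses at each element of $S$, and $s_n$ is a sink ($\preceq$-minimal) if $n$ is even and a source ($\preceq$-maximal) if $n$ is odd. (An infinite $s_n$ with $n\in\mathbb Z$ is also called a sink or source according to the parity of $n$.) A representation $V$ assigns a $k$-vector space $V(x)$ to each $x\in\mathbb R$ and a linear map $V(x,y):V(x)\to V(y)$ to each $y\preceq x$, with $V(x,z)=V(y,z)\circ V(x,y)$ for $z\preceq y\preceq x$. For an interval $I$, $M_I$ is the representation with $M_I(x)=k$ for $x\in I$ and $0$ otherwise, and identity maps between comparable points of $I$; a bracket at an infinite endpoint is read as open. The indecomposable projectives are the interval representations with supports $\{x\preceq a\}$, $\{x\preceq a,\ x<a\}$, $\{x\preceq a,\ x>a\}$ (when nonempty; also $P_{\pm\infty}$ when $\pm\infty$ is a source with finite index, with support the interval between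 $\pm\infty$ and the adjacent sink, sink included if finite). $\mathrm{rep}_k(A_{\mathbb R})$ is the category of pointwise finite-dimensional representations that are quotients of finite direct sums of indecomposable projectives. It is abelian and Krull-Schmidt, and its indecomposables are, up to isomorphism, representations $M_I$. A short exact sequence $0\to N\xrightarrow{f}E\xrightarrow{g}M\to0$ is an Auslander-Reiten (almost split) sequence if $f$ is not a section, $g$ is not a retraction, $N$ and $M$ are indecomposable, every nontrivial morphism $N\to X$ with $X$ indecomposable, $X\not\cong N$, factors through $f$, and every nontrivial morphism $X\to M$ with $X$ indecomposable, $X\not\cong M$, factors through $g$. The 16 types. For $a\in\mathbb R\setminus S$ let $s_a$ denote the sink among the two consecutive elements of $\bar S$ surrounding $a$. In each type the monomorphism is $\begin{bmatrix}1\\1\end{bmatrix}$ and the epimorphism is $\begin{bmatrix}1&-1\end{bmatrix}$. Types (1)--(4), $a<b$, $a,b\notin\bar S$: (1) $s_a<a,\ s_b<b$: $M_{[a,b)}\hookrightarrow M_{[a,b]}\oplus M_{(a,b)}\twoheadrightarrow M_{(a,b]}$; (2) $s_a<a,\ s_b>b$: $M_{[a,b]}\hookrightarrow M_{[a,b)}\oplus M_{(a,b]}\twoheadrightarrow M_{(a,b)}$; (3) $s_a>a,\ s_b<b$: $M_{(a,b)}\hookrightarrow M_{(a,b]}\oplus M_{[a,b)}\twoheadrightarrow M_{[a,b]}$; (4) $s_a>a,\ s_b>b$: $M_{(a,b]}\hookrightarrow M_{(a,b)}\oplus M_{[a,b]}\twoheadrightarrow M_{[a,b)}$. Types (5),(6),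 $s_{2n-1}<s_{2n}<b$, $b\notin \bar S$: (5) $s_b<b$: $M_{[s_{2n-1},b)}\hookrightarrow M_{[s_{2n-1},b]}\oplus M_{(s_{2n},b)}\twoheadrightarrow M_{(s_{2n},b]}$; (6) $s_b>b$: $M_{[s_{2n-1},b]}\hookrightarrow M_{[s_{2n-1},b)}\oplus M_{(s_{2n},b]}\twoheadrightarrow M_{(s_{2n},b)}$. Types (7),(8), $s_{2n}<s_{2n+1}<b$, $b\notin\bar S$: (7) $s_b<b$: $M_{(s_{2n+1},b)}\hookrightarrow M_{(s_{2n+1},b]}\oplus M_{[s_{2n},b)}\twoheadrightarrow M_{[s_{2n},b]}$; (8) $s_b>b$: $M_{(s_{2n+1},b]}\hookrightarrow M_{(s_{2n+1},b)}\oplus M_{[s_{2n},b]}\twoheadrightarrow M_{[s_{2n},b)}$. Types (9),(10), $a<s_{2n}<s_{2n+1}$, $a\notin\bar S$: (9) $s_a<a$: $M_{[a,s_{2n+1}]}\hookrightarrow M_{[a,s_{2n})}\oplus M_{(a,s_{2n+1}]}\twoheadrightarrow M_{(a,s_{2n})}$; (10) $s_a>a$: $M_{(a,s_{2n+1}]}\hookrightarrow M_{(a,s_{2n})}\oplus M_{[a,s_{2n+1}]}\twoheadrightarrow M_{[a,s_{2n})}$. Types (11),(12), $a<s_{2n-1}<s_{2n}$, $a\notin\bar S$: (11) $s_a<a$: $M_{[a,s_{2n-1})}\hookrightarrow M_{[a,s_{2n}]}\oplus M_{(a,s_{2n-1})}\twoheadrightarrow M_{(a,s_{2n}]}$; (12)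 $s_a>a$: $M_{(a,s_{2n-1})}\hookrightarrow M_{(a,s_{2n}]}\oplus M_{[a,s_{2n-1})}\twoheadrightarrow M_{[a,s_{2n}]}$. Types (13)--(16): (13) $s_{2m}<s_{2m+1}<s_{2n}<s_{2n+1}$: $M_{(s_{2m+1},s_{2n+1}]}\hookrightarrow M_{(s_{2m+1},s_{2n})}\oplus M_{[s_{2m},s_{2n+1}]}\twoheadrightarrow M_{[s_{2m},s_{2n})}$; (14) $s_{2m-1}<s_{2m}<s_{2n}<s_{2n+1}$: $M_{[s_{2m-1},s_{2n+1}]}\hookrightarrow M_{[s_{2m-1},s_{2n})}\oplus M_{(s_{2m},s_{2n+1}]}\twoheadrightarrow M_{(s_{2m},s_{2n})}$; (15) $s_{2m}<s_{2m+1}<s_{2n-1}<s_{2n}$: $M_{(s_{2m+1},s_{2n-1})}\hookrightarrow M_{(s_{2m+1},s_{2n}]}\oplus M_{[s_{2m},s_{2n-1})}\twoheadrightarrow M_{[s_{2m},s_{2n}]}$; (16) $s_{2m-1}<s_{2m}<s_{2n-1}<s_{2n}$: $M_{[s_{2m-1},s_{2n-1})}\hookrightarrow M_{[s_{2m-1},s_{2n}]}\oplus M_{(s_{2m},s_{2n-1})}\twoheadrightarrow M_{(s_{2m},s_{2n}]}$. *)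

(* Defs.v *)
From HB Require Import structures.
From mathcomp Require Import all_boot all_order all_algebra.
From mathcomp Require Import all_classical all_reals all_analysis.

Set Implicit Arguments.
Unset Strict Implicit.
Unset Printing Implicit Defensive.

Import Order.TTheory GRing.Theory Num.Theory.
Import numFieldNormedType.Exports.

Local Open Scope classical_set_scope.
Local Open Scope ring_scope.

(** * Continuous quivers of type A *)

Definition ext_set (R : realType) (S : set R) : set (\bar R) :=
  (EFin @` S) `|` [set -oo%E; +oo%E].

(* The indexing of [S] with [-oo] and [+oo] adjoined is an increasing bijection
   [qpt] from [qidx], a convex subset of Z with two infinite elements adjoined;
   the values of [qpt] outside [qidx] are irrelevant.  The partial order is not
   a field, as it is determined by the indexing (see [qle]). *)
Record quiver (R : realType) := Quiver {
  qset : set R;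
  qidx : set (\bar int);
  qpt : \bar int -> \bar R;
  qset_no_limit : limit_point qset = set0;
  qidx_zero : qidx 0%E;
  qidx_convex : forall i j l : \bar int,
    qidx i -> qidx l -> (i <= j)%E -> (j <= l)%E -> qidx j;
  qpt_incr : forall i j : \bar int,
    qidx i -> qidx j -> (i < j)%E -> (qpt i < qpt j)%E;
  qpt_image : qpt @` qidx = ext_set qset
}.

Section Quiver.
Variables (R : realType) (Q : quiver R).

Definition has_pt (n : int) : Prop := qidx Q n%:E.
Definition pt (n : int) : \bar R := qpt Q n%:E.
Definition even_idx (n : int) : bool := ~~ odd `|n|%N.

(* [qle y x] is y ⪯ x: on the closed interval between the consecutive elements
   of index n and n+1 it is the usual order if n is even (the left end is a
   sink), and the reverse order if n is odd.  Two consecutive elements always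
   have integer indices. *)
Definition qle (y x : R) : Prop := exists n : int,
  [/\ has_pt n, has_pt (n + 1),
      (pt n <= x%:E <= pt (n + 1))%E, (pt n <= y%:E <= pt (n + 1))%E
    & if even_idx n then y <= x else x <= y].

(* [t] is the sink among the two consecutive elements surrounding [a]. *)
Definition is_near_sink (a : R) (t : \bar R) : Prop := exists n : int,
  [/\ has_pt n, has_pt (n + 1), (pt n < a%:E < pt (n + 1))%E
    & t = if even_idx n then pt n else pt (n + 1)].

Definition sink_left (a : R) : Prop :=
  exists2 t : \bar R, is_near_sink a t & (t < a%:E)%E.
Definition sink_right (a : R) : Prop :=
  exists2 t : \bar R, is_near_sink a t & (a%:E < t)%E.

Lemma pt_le (m n : int) : has_pt m -> has_pt n -> m <= n -> (pt m <= pt n)%E.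
Proof.
move=> hm hn; rewrite le_eqVlt => /orP[/eqP -> //|lt_mn].
by apply/ltW/qpt_incr => //; rewrite lte_fin.
Qed.

Lemma qle_between (x y z : R) : qle y x -> qle z y ->
  (x <= y) && (y <= z) || (z <= y) && (y <= x).
Proof.
move=> [n [n0 n1 /andP[nx xn] /andP[ny yn] en]].
move=> [m [m0 m1 /andP[my ym] /andP[mz zm] em]].
have [lt_nm|lt_mn|eq_nm] := ltgtP n m.
- have le_pt : (pt (n + 1) <= pt m)%E by apply: pt_le; rewrite ?lezD1.
  apply/orP; left; rewrite -!lee_fin.
  by rewrite (le_trans xn (le_trans le_pt my)) (le_trans yn (le_trans le_pt mz)).
- have le_pt : (pt (m + 1) <= pt n)%E by apply: pt_le; rewrite ?lezD1.
  apply/orP; right; rewrite -!lee_fin.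
  by rewrite (le_trans zm (le_trans le_pt ny)) (le_trans ym (le_trans le_pt nx)).
- subst m; move: en em; case: ifP => _ -> ->; rewrite ?orbT //.
Qed.

End Quiver.

(** * Representations *)

(* Representations are pointwise finite-dimensional by construction.  That
   [rmap] is the identity on each [V x] is not imposed: it follows for every
   quotient of a direct sum of interval representations. *)
Record rep (k : fieldType) (R : realType) (Q : quiver R) := Rep {
  robj :> R -> vectType k;
  rmap : forall x y : R, qle Q y x -> 'Hom(robj x, robj y);
  rmap_comp : forall (x y z : R)
    (yx : qle Q y x) (zy : qle Q z y) (zx : qle Q z x),
    rmap zx = (rmap zy \o rmap yx)%VF
}.

Section Rep.
Variables (k : fieldType) (R : realType) (Q : quiver R).
Implicit Types (U V W X : rep k Q).

Record rep_hom V W := RepHom {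
  happ :> forall x : R, 'Hom(V x, W x);
  happ_nat : forall (x y : R) (yx : qle Q y x),
    (happ y \o rmap V yx)%VF = (rmap W yx \o happ x)%VF
}.

Definition is_comp U V W (h : rep_hom U W) (g : rep_hom V W)
    (f : rep_hom U V) : Prop :=
  forall x, h x = (g x \o f x)%VF.
Definition left_inverse_of V W (r : rep_hom W V) (f : rep_hom V W) : Prop :=
  forall x, (r x \o f x)%VF = \1%VF.
Definition is_section V W (f : rep_hom V W) : Prop :=
  exists r : rep_hom W V, left_inverse_of r f.
Definition is_retraction V W (f : rep_hom V W) : Prop :=
  exists s : rep_hom W V, left_inverse_of f s.
Definition is_iso V W (f : rep_hom V W) : Prop :=
  exists g : rep_hom W V, left_inverse_of g f /\ left_inverse_of f g.
Definition isomorphic V W : Prop := exists f : rep_hom V W, is_iso f.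

Definition is_mono V W (f : rep_hom V W) : Prop := forall x, lker (f x) = 0%VS.
Definition is_epi V W (f : rep_hom V W) : Prop := forall x, limg (f x) = fullv.
Definition nonzero_hom V W (f : rep_hom V W) : Prop := exists x, f x != 0.
Definition is_zero V : Prop := forall x, \dim {:V x} = 0%N.

Definition short_exact U V W (f : rep_hom U V) (g : rep_hom V W) : Prop :=
  [/\ is_mono f, is_epi g & forall x, limg (f x) = lker (g x)].

(** ** Direct sums *)

Definition dsum_lfun (A B A' B' : vectType k) (f : 'Hom(A, A'))
    (g : 'Hom(B, B')) (v : A * B) : A' * B' := (f v.1, g v.2).

Lemma dsum_lfun_linear (A B A' B' : vectType k) (f : 'Hom(A, A')) (g : 'Hom(B, B')) :
  linear (dsum_lfun f g).
Proof. by move=> a u v; rewrite /dsum_lfun !linearP. Qed.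

HB.instance Definition _ (A B A' B' : vectType k) (f : 'Hom(A, A'))
    (g : 'Hom(B, B')) :=
  GRing.isLinear.Build k (A * B)%type (A' * B')%type _ (dsum_lfun f g)
    (dsum_lfun_linear f g).

Definition dsum_obj V W (x : R) : vectType k := (V x * W x)%type.

Definition dsum_map V W x y (yx : qle Q y x) :
    'Hom(dsum_obj V W x, dsum_obj V W y) :=
  linfun (dsum_lfun (rmap V yx) (rmap W yx)).

Lemma dsum_map_comp V W (x y z : R)
    (yx : qle Q y x) (zy : qle Q z y) (zx : qle Q z x) :
  dsum_map V W zx = (dsum_map V W zy \o dsum_map V W yx)%VF.
Proof.
apply/lfunP => v; rewrite comp_lfunE !lfunE /= /dsum_lfun /=.
by rewrite !(rmap_comp _ yx zy zx) !comp_lfunE.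
Qed.

Definition dsum V W : rep k Q := Rep (@dsum_map_comp V W).

(** ** Interval representations *)

(* k is realized as 'rV[k]_1 and 0 as 'rV[k]_0: this is the identity of k if
   [b] and [c] are true, and 0 otherwise. *)
Definition one_lfun (b c : bool) : 'Hom('rV[k]_b, 'rV[k]_c) :=
  linfun (mulmxr (const_mx 1 : 'M[k]_(b, c))).

Lemma one_lfun_comp (b c d : bool) : (b && d ==> c) ->
  one_lfun b d = (one_lfun c d \o one_lfun b c)%VF.
Proof.
move=> bdc; apply/lfunP => v; rewrite comp_lfunE !lfunE /= -mulmxA.
congr (_ *m _); apply/matrixP => i j; rewrite !mxE.
move: bdc; case: b i {v} => [i|[]//]; case: d j => [j|[]//] /= ->.
by rewrite big_ord1 !mxE mulr1.
Qed.

(* Intervals of R are given by intervals of the extended reals, so that a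
   closed bracket at an infinite endpoint is the same as an open one. *)
Definition itv_lfun (I J : interval (\bar R)) (x y : R) :
    'Hom('rV[k]_(x%:E \in I), 'rV[k]_(y%:E \in J)) :=
  one_lfun (x%:E \in I) (y%:E \in J).

Definition itv_obj (I : interval (\bar R)) (x : R) : vectType k :=
  'rV[k]_(x%:E \in I).

Lemma itv_mid (I : interval (\bar R)) (x y z : R) : x <= y -> y <= z ->
  x%:E \in I -> z%:E \in I -> y%:E \in I.
Proof.
rewrite -!lee_fin => xy yz; case: I => a b.
rewrite !itv_boundlr => /andP[ax _] /andP[_ zb].
apply/andP; split.
  by apply: le_trans ax _; rewrite bnd_simp.
by apply: le_trans zb; rewrite bnd_simp.
Qed.

Lemma itv_map_comp (I : interval (\bar R)) (x y z : R)
    (yx : qle Q y x) (zy : qle Q z y) (zx : qle Q z x) :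
  itv_lfun I I x z = (itv_lfun I I y z \o itv_lfun I I x y)%VF.
Proof.
apply: one_lfun_comp; apply/implyP => /andP[xI zI].
by case/orP: (qle_between yx zy) => /andP[h1 h2];
  [apply: itv_mid h1 h2 xI zI|apply: itv_mid h1 h2 zI xI].
Qed.

Definition itv_rep (I : interval (\bar R)) : rep k Q :=
  @Rep k R Q (itv_obj I) (fun x y _ => itv_lfun I I x y) (@itv_map_comp I).

(* The representation with empty support. *)
Definition zero_rep : rep k Q := itv_rep `]0%E, 0%E[.

(** ** The category of finitely generated representations *)

(* The supports of the indecomposable projectives: those of P_a and of its open
   halves at a real point a, then those of P_{-oo} and P_{+oo}, which exist when
   -oo, resp. +oo, is a source of finite index. *)
Definition proj_support (P : set R) : Prop :=
  P !=set0 /\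
  ((exists a : R, [\/ P = [set x | qle Q x a],
                      P = [set x | qle Q x a /\ x < a]
                    | P = [set x | qle Q x a /\ a < x]])
   \/ (exists n : int, [/\ has_pt Q n, ~~ even_idx n, pt Q n = -oo%E
                         & P = [set x | (x%:E <= pt Q (n + 1))%E]])
   \/ (exists n : int, [/\ has_pt Q n, ~~ even_idx n, pt Q n = +oo%E
                         & P = [set x | (pt Q (n - 1) <= x%:E)%E]])).

Definition proj_itv (I : interval (\bar R)) : Prop :=
  proj_support [set x : R | x%:E \in I].

Definition in_rep V : Prop := exists (n : nat) (I : 'I_n -> interval (\bar R)),
  (forall i, proj_itv (I i)) /\
  exists p : rep_hom (\big[dsum/zero_rep]_(i < n) itv_rep (I i)) V, is_epi p.

Definition indecomposable V : Prop :=
  ~ is_zero V /\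
  forall A B : rep k Q, in_rep A -> in_rep B ->
    isomorphic V (dsum A B) -> is_zero A \/ is_zero B.

(** ** Auslander-Reiten sequences *)

Definition AR_sequence U V W (f : rep_hom U V) (g : rep_hom V W) : Prop :=
  [/\ in_rep U, in_rep V & in_rep W] /\
  [/\ short_exact f g, ~ is_section f & ~ is_retraction g] /\
  [/\ indecomposable U, indecomposable W,
      (forall X (h : rep_hom U X), in_rep X -> indecomposable X ->
         ~ isomorphic X U -> nonzero_hom h ->
         exists h' : rep_hom V X, is_comp h h' f)
    & (forall X (h : rep_hom X W), in_rep X -> indecomposable X ->
         ~ isomorphic X W -> nonzero_hom h ->
         exists h' : rep_hom X V, is_comp h g h')].

(* U -f-> V -g-> W is isomorphic to
   M_I -[1;1]-> M_J1 (+) M_J2 -[1,-1]-> M_L. *)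
Definition iso_to_itv_seq U V W (f : rep_hom U V) (g : rep_hom V W)
    (I J1 J2 L : interval (\bar R)) : Prop :=
  exists (f' : rep_hom (itv_rep I) (dsum (itv_rep J1) (itv_rep J2)))
         (g' : rep_hom (dsum (itv_rep J1) (itv_rep J2)) (itv_rep L)),
  [/\ forall x v, f' x v = (itv_lfun I J1 x x v, itv_lfun I J2 x x v),
      forall x v, g' x v = itv_lfun J1 L x x v.1 - itv_lfun J2 L x x v.2
    & exists (u : rep_hom U (itv_rep I))
             (v : rep_hom V (dsum (itv_rep J1) (itv_rep J2)))
             (w : rep_hom W (itv_rep L)),
      [/\ is_iso u, is_iso v, is_iso w,
          forall x, (v x \o f x)%VF = (f' x \o u x)%VF
        & forall x, (w x \o g x)%VF = (g' x \o v x)%VF]].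

End Rep.

(** * The sixteen types *)

(* [ar_type Q I J1 J2 L]: M_I -> M_J1 (+) M_J2 -> M_L is of one of the types. *)
Inductive ar_type (R : realType) (Q : quiver R) :
  interval (\bar R) -> interval (\bar R) -> interval (\bar R) ->
  interval (\bar R) -> Prop :=
| ar_type1 (a b : R) of a < b
    & ~ ext_set (qset Q) a%:E & ~ ext_set (qset Q) b%:E
    & sink_left Q a & sink_left Q b :
    ar_type Q `[a%:E, b%:E[ `[a%:E, b%:E] `]a%:E, b%:E[ `]a%:E, b%:E]
| ar_type2 (a b : R) of a < b
    & ~ ext_set (qset Q) a%:E & ~ ext_set (qset Q) b%:E
    & sink_left Q a & sink_right Q b :
    ar_type Q `[a%:E, b%:E] `[a%:E, b%:E[ `]a%:E, b%:E] `]a%:E, b%:E[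
| ar_type3 (a b : R) of a < b
    & ~ ext_set (qset Q) a%:E & ~ ext_set (qset Q) b%:E
    & sink_right Q a & sink_left Q b :
    ar_type Q `]a%:E, b%:E[ `]a%:E, b%:E] `[a%:E, b%:E[ `[a%:E, b%:E]
| ar_type4 (a b : R) of a < b
    & ~ ext_set (qset Q) a%:E & ~ ext_set (qset Q) b%:E
    & sink_right Q a & sink_right Q b :
    ar_type Q `]a%:E, b%:E] `]a%:E, b%:E[ `[a%:E, b%:E] `[a%:E, b%:E[
| ar_type5 (n : int) (b : R) of has_pt Q (2 * n - 1) & has_pt Q (2 * n)
    & (pt Q (2 * n - 1) < pt Q (2 * n))%E & (pt Q (2 * n) < b%:E)%E
    & ~ ext_set (qset Q) b%:E & sink_left Q b :
    ar_type Q `[pt Q (2 * n - 1), b%:E[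
      `[pt Q (2 * n - 1), b%:E] `]pt Q (2 * n), b%:E[
      `]pt Q (2 * n), b%:E]
| ar_type6 (n : int) (b : R) of has_pt Q (2 * n - 1) & has_pt Q (2 * n)
    & (pt Q (2 * n - 1) < pt Q (2 * n))%E & (pt Q (2 * n) < b%:E)%E
    & ~ ext_set (qset Q) b%:E & sink_right Q b :
    ar_type Q `[pt Q (2 * n - 1), b%:E]
      `[pt Q (2 * n - 1), b%:E[ `]pt Q (2 * n), b%:E]
      `]pt Q (2 * n), b%:E[
| ar_type7 (n : int) (b : R) of has_pt Q (2 * n) & has_pt Q (2 * n + 1)
    & (pt Q (2 * n) < pt Q (2 * n + 1))%E & (pt Q (2 * n + 1) < b%:E)%E
    & ~ ext_set (qset Q) b%:E & sink_left Q b :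
    ar_type Q `]pt Q (2 * n + 1), b%:E[
      `]pt Q (2 * n + 1), b%:E] `[pt Q (2 * n), b%:E[
      `[pt Q (2 * n), b%:E]
| ar_type8 (n : int) (b : R) of has_pt Q (2 * n) & has_pt Q (2 * n + 1)
    & (pt Q (2 * n) < pt Q (2 * n + 1))%E & (pt Q (2 * n + 1) < b%:E)%E
    & ~ ext_set (qset Q) b%:E & sink_right Q b :
    ar_type Q `]pt Q (2 * n + 1), b%:E]
      `]pt Q (2 * n + 1), b%:E[ `[pt Q (2 * n), b%:E]
      `[pt Q (2 * n), b%:E[
| ar_type9 (n : int) (a : R) of has_pt Q (2 * n) & has_pt Q (2 * n + 1)
    & (a%:E < pt Q (2 * n))%E & (pt Q (2 * n) < pt Q (2 * n + 1))%E
    & ~ ext_set (qset Q) a%:E & sink_left Q a :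
    ar_type Q `[a%:E, pt Q (2 * n + 1)]
      `[a%:E, pt Q (2 * n)[ `]a%:E, pt Q (2 * n + 1)]
      `]a%:E, pt Q (2 * n)[
| ar_type10 (n : int) (a : R) of has_pt Q (2 * n) & has_pt Q (2 * n + 1)
    & (a%:E < pt Q (2 * n))%E & (pt Q (2 * n) < pt Q (2 * n + 1))%E
    & ~ ext_set (qset Q) a%:E & sink_right Q a :
    ar_type Q `]a%:E, pt Q (2 * n + 1)]
      `]a%:E, pt Q (2 * n)[ `[a%:E, pt Q (2 * n + 1)]
      `[a%:E, pt Q (2 * n)[
| ar_type11 (n : int) (a : R) of has_pt Q (2 * n - 1) & has_pt Q (2 * n)
    & (a%:E < pt Q (2 * n - 1))%E & (pt Q (2 * n - 1) < pt Q (2 * n))%E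
    & ~ ext_set (qset Q) a%:E & sink_left Q a :
    ar_type Q `[a%:E, pt Q (2 * n - 1)[
      `[a%:E, pt Q (2 * n)] `]a%:E, pt Q (2 * n - 1)[
      `]a%:E, pt Q (2 * n)]
| ar_type12 (n : int) (a : R) of has_pt Q (2 * n - 1) & has_pt Q (2 * n)
    & (a%:E < pt Q (2 * n - 1))%E & (pt Q (2 * n - 1) < pt Q (2 * n))%E
    & ~ ext_set (qset Q) a%:E & sink_right Q a :
    ar_type Q `]a%:E, pt Q (2 * n - 1)[
      `]a%:E, pt Q (2 * n)] `[a%:E, pt Q (2 * n - 1)[
      `[a%:E, pt Q (2 * n)]
| ar_type13 (m n : int) of has_pt Q (2 * m) & has_pt Q (2 * m + 1)
    & has_pt Q (2 * n) & has_pt Q (2 * n + 1)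
    & (pt Q (2 * m) < pt Q (2 * m + 1))%E
    & (pt Q (2 * m + 1) < pt Q (2 * n))%E
    & (pt Q (2 * n) < pt Q (2 * n + 1))%E :
    ar_type Q `]pt Q (2 * m + 1), pt Q (2 * n + 1)]
      `]pt Q (2 * m + 1), pt Q (2 * n)[ `[pt Q (2 * m), pt Q (2 * n + 1)]
      `[pt Q (2 * m), pt Q (2 * n)[
| ar_type14 (m n : int) of has_pt Q (2 * m - 1) & has_pt Q (2 * m)
    & has_pt Q (2 * n) & has_pt Q (2 * n + 1)
    & (pt Q (2 * m - 1) < pt Q (2 * m))%E
    & (pt Q (2 * m) < pt Q (2 * n))%E
    & (pt Q (2 * n) < pt Q (2 * n + 1))%E :
    ar_type Q `[pt Q (2 * m - 1), pt Q (2 * n + 1)]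
      `[pt Q (2 * m - 1), pt Q (2 * n)[ `]pt Q (2 * m), pt Q (2 * n + 1)]
      `]pt Q (2 * m), pt Q (2 * n)[
| ar_type15 (m n : int) of has_pt Q (2 * m) & has_pt Q (2 * m + 1)
    & has_pt Q (2 * n - 1) & has_pt Q (2 * n)
    & (pt Q (2 * m) < pt Q (2 * m + 1))%E
    & (pt Q (2 * m + 1) < pt Q (2 * n - 1))%E
    & (pt Q (2 * n - 1) < pt Q (2 * n))%E :
    ar_type Q `]pt Q (2 * m + 1), pt Q (2 * n - 1)[
      `]pt Q (2 * m + 1), pt Q (2 * n)] `[pt Q (2 * m), pt Q (2 * n - 1)[
      `[pt Q (2 * m), pt Q (2 * n)]
| ar_type16 (m n : int) of has_pt Q (2 * m - 1) & has_pt Q (2 * m)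
    & has_pt Q (2 * n - 1) & has_pt Q (2 * n)
    & (pt Q (2 * m - 1) < pt Q (2 * m))%E
    & (pt Q (2 * m) < pt Q (2 * n - 1))%E
    & (pt Q (2 * n - 1) < pt Q (2 * n))%E :
    ar_type Q `[pt Q (2 * m - 1), pt Q (2 * n - 1)[
      `[pt Q (2 * m - 1), pt Q (2 * n)] `]pt Q (2 * m), pt Q (2 * n - 1)[
      `]pt Q (2 * m), pt Q (2 * n)].

(* Main.v *)
(** The third term W of an Auslander-Reiten sequence is indecomposable, hence an
    interval representation M_L. To split an interval off any nonzero V in
    [rep], note that V is constant on the classes of a finite partition of R
    into intervals; starting from nested subspaces Y < X of V at its leftmost
    class, move to the right along the classes, taking images or preimages of X
    and Y, until a line in X and a form vanishing on Y can be chosen which die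
    at the next class.

    If an end of L is not one of the ends listed for third terms, then L is a
    limit, from inside or from outside, of intervals K with M_K -> M_L, and a
    lift of this map to V for K close enough to L extends to a section of V -> W,
    as V is constant near the end. If both ends are listed, then either M_L is
    projective, which is impossible, or there is a sequence
    M_I -> M_J1 (+) M_J2 -> M_L of the list. The maps M_Ji -> M_L lift to V,
    which gives a morphism from that sequence to the given one. Let
    psi : M_I -> U be its first component. As U is an interval representation,
    a map M_I -> U that is not an isomorphism extends to M_J1 (+) M_J2, because
    at each of its two ends I is changed in the smallest possible way; if psi did
    so, then the given sequence would split. Hence psi is an isomorphism. *)

Require Import Defs.
From HB Require Import structures.
From mathcomp Require Import all_boot all_order all_algebra.
From mathcomp Require Import all_classical all_reals all_analysis.
From mathcomp Require Import zify lra.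

Set Implicit Arguments.
Unset Strict Implicit.
Unset Printing Implicit Defensive.

Import Order.TTheory GRing.Theory Num.Theory.
Import numFieldNormedType.Exports.

Local Open Scope classical_set_scope.
Local Open Scope ring_scope.

(** * Linear maps *)

(** The condition for a canonical map between two intervals with a common point splits into one
    condition on the left rays and one on the right rays. So the sixteen types are four left ends
    times four right ends, and almost splitness becomes an extension property of rays alone; the
    right-hand half follows by reflecting the quiver. The requirement [l < r] keeps the pieces
    changed at the two ends disjoint, so that at each point at most one end changes; exactness is
    then a dimension count.

    The obstacle is the continuum of points. A surjection from a finite sum of projectives cuts the
    line into finitely many classes, but there the maps of [V] are at first only surjective. The
    dimension can still drop, always in one direction along a class, and a further cut by dimension
    makes [V] constant. Nested subspaces are carried along the classes, rather than a line, because
    the line can be chosen only where it dies; each move is such that any line and form found later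
    lift back. One interval summand suffices, since a nonzero retract of an indecomposable
    representation is all of it. *)

Section LinearMaps.
Variable k : fieldType.
Implicit Types A B C : vectType k.

Lemma lfun_dom0 A B (f g : 'Hom(A, B)) : \dim {:A} = 0%N -> f = g.
Proof.
move=> /eqP; rewrite dimv_eq0 => /eqP A0; apply/lfunP => v.
have : v \in ({:A})%VS by rewrite memvf.
by rewrite A0 memv0 => /eqP ->; rewrite !linear0.
Qed.

Lemma lfun_cod0 A B (f g : 'Hom(A, B)) : \dim {:B} = 0%N -> f = g.
Proof.
move=> /eqP; rewrite dimv_eq0 => /eqP B0; apply/lfunP => v.
have : f v - g v \in ({:B})%VS by rewrite memvf.
by rewrite B0 memv0 subr_eq0 => /eqP.
Qed.

(** [h^-1] is only a pseudo-inverse: [h^-1 (h a)] and [a] differ by an element of the kernel of [h],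
    which [l] kills. *)
Lemma lfun_factor A B C (h : 'Hom(A, B)) (l : 'Hom(A, C)) :
  (lker h <= lker l)%VS -> (l \o h^-1 \o h)%VF = l.
Proof.
move=> hl; apply/lfunP => a; rewrite !comp_lfunE; apply/eqP.
rewrite -subr_eq0 -linearB -memv_ker; apply: (subvP hl).
by rewrite memv_ker linearB /= subr_eq0 limg_lfunVK ?memv_img ?memvf.
Qed.

Lemma lfun_limgK A B C (h : 'Hom(A, B)) (l : 'Hom(C, B)) :
  (limg l <= limg h)%VS -> (h \o (h^-1 \o l))%VF = l.
Proof.
move=> hl; apply/lfunP => c; rewrite !comp_lfunE limg_lfunVK //.
by apply: (subvP hl); rewrite memv_img ?memvf.
Qed.

Definition lbij A B (f : 'Hom(A, B)) : Prop :=
  (f^-1 \o f)%VF = \1%VF /\ (f \o f^-1)%VF = \1%VF.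

Lemma lbijP A B (f : 'Hom(A, B)) :
  lker f = 0%VS -> limg f = fullv -> lbij f.
Proof.
move=> f0 f1; split; first by rewrite lker0_compVf ?f0.
by rewrite -[RHS](@lfun_limgK _ _ _ f \1%VF) ?f1 ?subvf // comp_lfun1r.
Qed.

Lemma lbij_lker A B (f : 'Hom(A, B)) : lbij f -> lker f = 0%VS.
Proof.
case=> fK _; apply/eqP/lker0P => u v fuv.
by have /lfunP e := fK; move: (e u) (e v); rewrite !comp_lfunE !id_lfunE fuv => -> ->.
Qed.

Lemma lbij_limg A B (f : 'Hom(A, B)) : lbij f -> limg f = fullv.
Proof.
case=> _ /lfunP fK; apply/eqP; rewrite eqEsubv subvf /=; apply/subvP => v _.
by have := fK v; rewrite comp_lfunE id_lfunE => <-; rewrite memv_img ?memvf.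
Qed.

Lemma lbij_of_inverse A B (f : 'Hom(A, B)) (g : 'Hom(B, A)) :
  (g \o f)%VF = \1%VF -> (f \o g)%VF = \1%VF -> lbij f.
Proof.
move=> /lfunP gf /lfunP fg; apply: lbijP.
  apply/eqP/lker0P => u v fuv.
  by move: (gf u) (gf v); rewrite !comp_lfunE !id_lfunE fuv => -> ->.
apply/eqP; rewrite eqEsubv subvf /=; apply/subvP => v _.
by have := fg v; rewrite comp_lfunE id_lfunE => <-; rewrite memv_img ?memvf.
Qed.

Lemma lbij_dim A B (f : 'Hom(A, B)) : lbij f -> \dim {:A} = \dim {:B}.
Proof.
move=> bf; rewrite -(limg_ker_dim f fullv) (lbij_lker bf) capv0 dimv0 add0n.
by rewrite (lbij_limg bf).
Qed.

Lemma lbij_epi_dim A B (f : 'Hom(A, B)) :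
  limg f = fullv -> \dim {:A} = \dim {:B} -> lbij f.
Proof.
move=> f1 dAB; apply: lbijP => //; apply/eqP; rewrite -dimv_eq0.
by have := limg_ker_dim f fullv; rewrite f1 dAB capfv => /(canRL (addnK _)); rewrite subnn => ->.
Qed.

Lemma lbij_inj A B C (f : 'Hom(B, C)) (g h : 'Hom(A, B)) :
  lbij f -> (f \o g)%VF = (f \o h)%VF -> g = h.
Proof.
by move=> [fK _] e; rewrite -[g]comp_lfun1l -[h]comp_lfun1l -fK -!comp_lfunA e.
Qed.

Lemma lbij_surj A B C (f : 'Hom(A, B)) (g h : 'Hom(B, C)) :
  lbij f -> (g \o f)%VF = (h \o f)%VF -> g = h.
Proof.
by move=> [_ fK] e; rewrite -[g]comp_lfun1r -[h]comp_lfun1r -fK !comp_lfunA e.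
Qed.

Lemma lbij_comp A B C (f : 'Hom(B, C)) (g : 'Hom(A, B)) :
  lbij f -> lbij g -> lbij (f \o g)%VF.
Proof.
move=> [f1 f2] [g1 g2]; apply: (@lbij_of_inverse _ _ _ (g^-1 \o f^-1)%VF).
  by rewrite comp_lfunA -[(_ \o f^-1 \o f)%VF]comp_lfunA f1 comp_lfun1r g1.
by rewrite comp_lfunA -[(_ \o g \o g^-1)%VF]comp_lfunA g2 comp_lfun1r f2.
Qed.

Lemma lbij1 A : lbij (\1%VF : 'End(A)).
Proof. by apply: (@lbij_of_inverse _ _ _ \1%VF); rewrite comp_lfun1r. Qed.

(** This makes [\1 - projv Y] a substitute for the quotient map by [Y]. *)
Lemma lker_proj_compl A (Y : {vspace A}) : lker (\1 - projv Y)%VF = Y.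
Proof.
apply/vspaceP => v; rewrite memv_ker !lfunE /= id_lfunE !lfunE /= subr_eq0.
apply/eqP/idP => [->|vY]; last by rewrite projv_id.
by rewrite memv_proj.
Qed.

Lemma lker_comp A B C (f : 'Hom(B, C)) (g : 'Hom(A, B)) :
  lker (f \o g)%VF = (g @^-1: lker f)%VS.
Proof. by apply/vspaceP => v; rewrite memv_ker comp_lfunE -memv_preim memv_ker. Qed.

Lemma limg_preim_sub A B (m : 'Hom(A, B)) (X : {vspace B}) :
  (m @: (m @^-1: X) <= X)%VS.
Proof. by apply/subvP => _ /memv_imgP[u + ->]; rewrite -memv_preim. Qed.

Definition line_fun A (v : A) (r : 'rV[k]_true) : A := r 0 0 *: v.

Lemma line_fun_linear A (v : A) : linear (line_fun v).
Proof. by move=> a r s; rewrite /line_fun !mxE scalerDl scalerA. Qed.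

HB.instance Definition _ A (v : A) :=
  GRing.isLinear.Build k 'rV[k]_true A _ (line_fun v) (line_fun_linear v).

(** A copy of k that lies in [X], survives modulo [Y], and is split off from the whole of [A]. *)
Definition line_pair A (X Y : {vspace A})
    (w : 'Hom('rV[k]_true, A)) (l : 'Hom(A, 'rV[k]_true)) : Prop :=
  [/\ (limg w <= X)%VS, (Y <= lker l)%VS & (l \o w)%VF = \1%VF].

Lemma line_pair_exists A (X Y : {vspace A}) : ~~ (X <= Y)%VS ->
  exists w l, line_pair X Y w l.
Proof.
move=> /subvPn[v vX vY].
pose w : 'Hom('rV[k]_true, A) := linfun (line_fun v).
have wE r : w r = r 0 0 *: v by rewrite lfunE.
pose q := (\1 - projv Y)%VF : 'End(A).
have kq : lker q = Y by rewrite lker_proj_compl.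
have kw0 : lker (q \o w)%VF = 0%VS.
  apply/eqP/lker0P => r s; rewrite !comp_lfunE !wE !linearZ /= => /eqP.
  rewrite -subr_eq0 -scalerBl scaler_eq0 subr_eq0 => /orP[/eqP e|].
    by apply/rowP => i; rewrite !ord1.
  by rewrite -memv_ker kq (negPf vY).
exists w, ((q \o w)^-1 \o q)%VF; split.
- by apply/subvP => _ /memv_imgP[r _ ->]; rewrite wE memvZ.
- by apply/subvP => y yY; rewrite memv_ker comp_lfunE; move: yY; rewrite -{1}kq memv_ker => /eqP->; rewrite linear0.
- by rewrite -comp_lfunA lker0_compVf ?kw0.
Qed.

(** If [X :&: lker m] is not inside [Y], a line can be chosen that [m] kills. Otherwise [m] induces
    an injection from [X/Y] to [m X / m Y], so every pair for the images comes from one for [X] and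
    [Y]. *)
Lemma line_pair_forward A B (m : 'Hom(A, B)) (X Y : {vspace A}) :
  (Y <= X)%VS -> ~~ (X <= Y)%VS ->
  (exists w l, line_pair X Y w l /\ (m \o w)%VF = 0) \/
  exists X' Y' : {vspace B}, [/\ (Y' <= X')%VS, ~~ (X' <= Y')%VS
    & forall w' l', line_pair X' Y' w' l' ->
      exists w, [/\ line_pair X Y w (l' \o m)%VF & (m \o w)%VF = w']].
Proof.
move=> YX XY; case: (boolP (X :&: lker m <= Y)%VS) => [kY|/line_pair_exists].
  right; exists (m @: X)%VS, (m @: Y)%VS; split; first exact: limgS.
    apply: contra XY => /subvP mXY; apply/subvP => x xX.
    have /memv_imgP[y yY e] := mXY _ (memv_img m xX).
    rewrite -(subrK y x) memvD // (subvP kY) // memv_cap memvB ?(subvP YX y) //=.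
    by rewrite memv_ker linearB /= e subrr.
  move=> w' l' [wX lY lw].
  (* [m \o projv X] has image [m @: X]; its pseudo-inverse followed by [projv X] lifts [w'] to a
     line inside [X]. *)
  have lim : (limg w' <= limg (m \o projv X))%VS.
    by rewrite limg_comp limg_proj.
  have e : (m \o (projv X \o ((m \o projv X)^-1 \o w')))%VF = w'.
    exact: etrans (comp_lfunA _ _ _) (lfun_limgK lim).
  exists (projv X \o ((m \o projv X)^-1 \o w'))%VF; split => //; split.
  - by rewrite limg_comp -[X in (_ <= X)%VS](limg_proj X) limgS ?subvf.
  - apply/subvP => y yY; rewrite memv_ker comp_lfunE.
    by have /(subvP lY) := memv_img m yY; rewrite memv_ker.
  - by rewrite -comp_lfunA e.
move=> [w [l [wX lY lw]]]; left; exists w, l; split; first split => //.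
  by apply: subv_trans wX _; rewrite capvSl.
apply/lfunP => r; rewrite comp_lfunE zero_lfunE.
apply/eqP; rewrite -memv_ker; apply: (subvP (capvSr X _)).
by apply: (subvP wX); rewrite memv_img ?memvf.
Qed.

(** Dual to the forward move: either some form nonzero on [X] kills both [Y] and the image of [m],
    or the preimages of [X] and [Y] have the same quotient as [X] and [Y]. In the second case [l']
    vanishes on the preimage of [Y], hence factors through [q \o m]. *)
Lemma line_pair_backward A B (m : 'Hom(B, A)) (X Y : {vspace A}) :
  (Y <= X)%VS -> ~~ (X <= Y)%VS ->
  (exists w l, line_pair X Y w l /\ (l \o m)%VF = 0) \/
  exists X' Y' : {vspace B}, [/\ (Y' <= X')%VS, ~~ (X' <= Y')%VS
    & forall w' l', line_pair X' Y' w' l' ->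
      exists l, [/\ line_pair X Y (m \o w')%VF l & (l \o m)%VF = l']].
Proof.
move=> YX XY; case: (boolP (X <= limg m + Y)%VS) => [sX|/line_pair_exists].
  right; exists (m @^-1: X)%VS, (m @^-1: Y)%VS; split; first exact: lpreimS.
    apply: contra XY => /subvP mXY; apply/subvP => x xX.
    have /memv_addP[u /memv_imgP[b _ eu] [y yY e]] := subvP sX _ xX.
    rewrite e memvD // eu memv_preim; apply: mXY.
    by rewrite -memv_preim -eu -(addrK y u) -e memvB // (subvP YX).
  move=> w' l' [wX lY lw].
  pose q := (\1 - projv Y)%VF : 'End(A).
  have kq : lker q = Y by rewrite lker_proj_compl.
  have e : (l' \o (q \o m)^-1 \o (q \o m))%VF = l'.
    by apply: lfun_factor; rewrite lker_comp kq.
  exists (l' \o (q \o m)^-1 \o q)%VF; split; last by rewrite -comp_lfunA e.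
  split.
  - by rewrite limg_comp; apply: subv_trans (limgS _ wX) (limg_preim_sub _ _).
  - apply/subvP => y yY; rewrite memv_ker comp_lfunE.
    by move: yY; rewrite -{1}kq memv_ker => /eqP->; rewrite linear0.
  - by rewrite comp_lfunA -[(_ \o q \o m)%VF]comp_lfunA e.
move=> [w [l [wX lY lw]]]; left; exists w, l; split; first split => //.
  by apply: subv_trans lY; rewrite addvSr.
apply/lfunP => r; rewrite comp_lfunE zero_lfunE; apply/eqP; rewrite -memv_ker.
by apply: (subvP lY); apply: (subvP (addvSl _ Y)); rewrite memv_img ?memvf.
Qed.

End LinearMaps.
(** * Representations *)

Section Representations.
Variables (k : fieldType) (R : realType) (Q : quiver R).
Implicit Types (U V W X : rep k Q).

Lemma rmap_irr V x y (h h' : qle Q y x) : rmap V h = rmap V h'.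
Proof. by rewrite (Prop_irrelevance h h'). Qed.

Lemma comp_hom_nat U V W (g : rep_hom V W) (f : rep_hom U V) x y (yx : qle Q y x) :
  ((g y \o f y) \o rmap U yx = rmap W yx \o (g x \o f x))%VF.
Proof. by rewrite -comp_lfunA happ_nat !comp_lfunA happ_nat. Qed.

Definition comp_hom U V W (g : rep_hom V W) (f : rep_hom U V) : rep_hom U W :=
  RepHom (comp_hom_nat g f).

Lemma sub_hom_nat V W (f g : rep_hom V W) x y (yx : qle Q y x) :
  ((f y - g y) \o rmap V yx = rmap W yx \o (f x - g x))%VF.
Proof. by rewrite comp_lfunDl comp_lfunDr comp_lfunNl comp_lfunNr !happ_nat. Qed.

Definition sub_hom V W (f g : rep_hom V W) : rep_hom V W := RepHom (sub_hom_nat f g).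

Lemma inv_hom_nat V W (f : rep_hom V W) (bf : forall x, lbij (f x)) x y (yx : qle Q y x) :
  ((f y)^-1 \o rmap W yx = rmap V yx \o (f x)^-1)%VF.
Proof.
apply: (lbij_inj (bf y)); rewrite !comp_lfunA (bf y).2 comp_lfun1l happ_nat.
by rewrite -comp_lfunA (bf x).2 comp_lfun1r.
Qed.

Definition inv_hom V W (f : rep_hom V W) (bf : forall x, lbij (f x)) : rep_hom W V :=
  RepHom (inv_hom_nat bf).

Lemma is_isoP V W (f : rep_hom V W) : is_iso f <-> forall x, lbij (f x).
Proof.
split=> [[g [gf fg]] x|bf]; first exact: lbij_of_inverse (gf x) (fg x).
by exists (inv_hom bf); split=> x; rewrite /= ?(bf x).1 ?(bf x).2.
Qed.

Lemma is_iso_inv V W (f : rep_hom V W) (bf : forall x, lbij (f x)) : is_iso (inv_hom bf).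
Proof. by exists f; split => x; rewrite /= ?(bf x).1 ?(bf x).2. Qed.

Lemma isomorphic_dim V W x : isomorphic V W -> \dim {:V x} = \dim {:W x}.
Proof. by case=> f /is_isoP bf; apply: lbij_dim (bf x). Qed.

Lemma factor_mono U V X (f : rep_hom U V) (h : rep_hom X V) :
  is_mono f -> (forall x, limg (h x) <= limg (f x))%VS ->
  exists h' : rep_hom X U, forall x, (f x \o h' x)%VF = h x.
Proof.
move=> mf hf; have e x : (f x \o ((f x)^-1 \o h x))%VF = h x by apply: lfun_limgK.
have nat x y (yx : qle Q y x) :
    (((f y)^-1 \o h y) \o rmap X yx = rmap U yx \o ((f x)^-1 \o h x))%VF.
  apply/lfunP => v; have /lker0P inj : lker (f y) == 0%VS by rewrite mf.
  apply: inj; rewrite -!comp_lfunE; apply/lfunP: v.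
  by rewrite [LHS]comp_lfunA e [RHS]comp_lfunA (happ_nat f) -[RHS]comp_lfunA e happ_nat.
by exists (RepHom nat).
Qed.

Lemma factor_epi V W X (g : rep_hom V W) (h : rep_hom V X) :
  is_epi g -> (forall x, lker (g x) <= lker (h x))%VS ->
  exists h' : rep_hom W X, forall x, (h' x \o g x)%VF = h x.
Proof.
move=> eg gh; have e x : ((h x \o (g x)^-1) \o g x)%VF = h x by apply: lfun_factor.
have nat x y (yx : qle Q y x) :
    ((h y \o (g y)^-1) \o rmap W yx = rmap X yx \o (h x \o (g x)^-1))%VF.
  apply/lfunP => w; have : w \in limg (g x) by rewrite eg memvf.
  move=> /memv_imgP[v _ ->]; rewrite -!comp_lfunE; apply/lfunP: v.
  rewrite -[LHS]comp_lfunA -happ_nat [LHS]comp_lfunA e -[RHS]comp_lfunA e.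
  by rewrite happ_nat.
by exists (RepHom nat).
Qed.

Lemma epi_cancel V W X (g : rep_hom V W) x (h h' : 'Hom(W x, X x)) :
  is_epi g -> (h \o g x)%VF = (h' \o g x)%VF -> h = h'.
Proof.
move=> eg /lfunP e; apply/lfunP => w.
have : w \in limg (g x) by rewrite eg memvf.
by move=> /memv_imgP[v _ ->]; have := e v; rewrite !comp_lfunE.
Qed.

Definition pair_fun (A B C : vectType k) (f : 'Hom(C, A)) (g : 'Hom(C, B)) (v : C) :
  (A * B)%type := (f v, g v).

Lemma pair_fun_linear (A B C : vectType k) (f : 'Hom(C, A)) (g : 'Hom(C, B)) :
  linear (pair_fun f g).
Proof. by move=> a u v; rewrite /pair_fun !linearP. Qed.

HB.instance Definition _ (A B C : vectType k) (f : 'Hom(C, A)) (g : 'Hom(C, B)) :=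
  GRing.isLinear.Build k C (A * B)%type _ (pair_fun f g) (pair_fun_linear f g).

(** The sign matches the epimorphism [1, -1] of the sixteen sequences; every map out of a sum below
    is built with it. *)
Definition copair_fun (A B C : vectType k) (f : 'Hom(A, C)) (g : 'Hom(B, C))
  (v : (A * B)%type) : C := f v.1 - g v.2.

Lemma copair_fun_linear (A B C : vectType k) (f : 'Hom(A, C)) (g : 'Hom(B, C)) :
  linear (copair_fun f g).
Proof.
move=> a u v; rewrite /copair_fun (linearP f a u.1 v.1) (linearP g a u.2 v.2).
by rewrite scalerBr opprD addrACA.
Qed.

HB.instance Definition _ (A B C : vectType k) (f : 'Hom(A, C)) (g : 'Hom(B, C)) :=
  GRing.isLinear.Build k (A * B)%type C _ (copair_fun f g) (copair_fun_linear f g).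

Lemma hom_natE V W (f : rep_hom V W) x y (yx : qle Q y x) v :
  f y (rmap V yx v) = rmap W yx (f x v).
Proof. by rewrite -!comp_lfunE happ_nat. Qed.

Definition pair_app V W X (f : rep_hom X V) (g : rep_hom X W) x :
  'Hom(X x, dsum V W x) := linfun (pair_fun (f x) (g x)).

Lemma pair_hom_nat V W X (f : rep_hom X V) (g : rep_hom X W) x y (yx : qle Q y x) :
  (pair_app f g y \o rmap X yx = rmap (dsum V W) yx \o pair_app f g x)%VF.
Proof.
by apply/lfunP => v; rewrite !comp_lfunE !lfunE /= /dsum_lfun /pair_fun /= !hom_natE.
Qed.

Definition pair_hom V W X (f : rep_hom X V) (g : rep_hom X W) : rep_hom X (dsum V W) :=
  RepHom (pair_hom_nat f g).

Lemma pair_homE V W X (f : rep_hom X V) (g : rep_hom X W) x v :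
  pair_hom f g x v = (f x v, g x v).
Proof. by rewrite /= lfunE. Qed.

Definition copair_app V W X (f : rep_hom V X) (g : rep_hom W X) x :
  'Hom(dsum V W x, X x) := linfun (copair_fun (f x) (g x)).

Lemma copair_hom_nat V W X (f : rep_hom V X) (g : rep_hom W X) x y (yx : qle Q y x) :
  (copair_app f g y \o rmap (dsum V W) yx = rmap X yx \o copair_app f g x)%VF.
Proof.
by apply/lfunP => v; rewrite !comp_lfunE !lfunE /= /dsum_lfun /copair_fun /= !hom_natE linearB.
Qed.

Definition copair_hom V W X (f : rep_hom V X) (g : rep_hom W X) : rep_hom (dsum V W) X :=
  RepHom (copair_hom_nat f g).

Lemma copair_homE V W X (f : rep_hom V X) (g : rep_hom W X) x v :
  copair_hom f g x v = f x v.1 - g x v.2.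
Proof. by rewrite /= lfunE. Qed.

Lemma in_rep_quotient V W (g : rep_hom V W) : is_epi g -> in_rep V -> in_rep W.
Proof.
move=> eg [n [I [pI [p ep]]]]; exists n, I; split => //.
by exists (comp_hom g p) => x; rewrite /= limg_comp ep eg.
Qed.

Lemma one_lfun_id (b : bool) : one_lfun k b b = \1%VF.
Proof.
apply/lfunP => v; rewrite !lfunE /=; case: b v => v.
  by apply/rowP => i; rewrite !mxE big_ord1 !mxE mulr1 !ord1.
by apply/rowP => -[].
Qed.

(** The identity law holds for interval representations, survives direct sums, and descends along
    the epimorphism [p]. *)
Lemma in_rep_rmap_id V x (xx : qle Q x x) : in_rep V -> rmap V xx = \1%VF.
Proof.
move=> [n [I [_ [p ep]]]].
set E := \big[_/_]_(i < n) _ in p ep.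
have hE : rmap E xx = \1%VF.
  rewrite /E; elim/big_ind: _ xx => [xx|A B hA hB xx|i _ xx] /=.
  - exact: one_lfun_id.
  - apply/lfunP => v; rewrite lfunE /= /dsum_lfun hA hB !id_lfunE; by case: v.
  - exact: one_lfun_id.
by apply: (epi_cancel ep); rewrite -happ_nat hE comp_lfun1r comp_lfun1l.
Qed.

Section Kernel.
Variables (V A : rep k Q) (p : rep_hom V A).

Definition ker_obj (x : R) : vectType k := subvs_of (lker (p x)).

Definition ker_map x y (yx : qle Q y x) : 'Hom(ker_obj x, ker_obj y) :=
  linfun (vsproj (lker (p y)) \o rmap V yx \o vsval).

Lemma ker_mapE x y (yx : qle Q y x) u : vsval (ker_map yx u) = rmap V yx (vsval u).
Proof.
rewrite lfunE /= vsprojK // memv_ker hom_natE.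
by have := subvsP u; rewrite memv_ker => /eqP ->; rewrite linear0.
Qed.

Lemma ker_map_comp x y z (yx : qle Q y x) (zy : qle Q z y) (zx : qle Q z x) :
  ker_map zx = (ker_map zy \o ker_map yx)%VF.
Proof.
apply/lfunP => u; apply: subvs_inj.
by rewrite comp_lfunE !ker_mapE (rmap_comp V yx zy zx) comp_lfunE.
Qed.

Definition ker_rep : rep k Q := Rep ker_map_comp.

End Kernel.

Lemma dim_prod (A B : vectType k) : \dim {:(A * B)%type} = (\dim {:A} + \dim {:B})%N.
Proof. by rewrite !dimvf. Qed.

(** [V] is the sum of [A] and the kernel of [p]. The kernel is the image of the projection
    [1 - i p], hence a quotient of [V] and an object of the category, so that indecomposability
    applies and forces it to vanish. *)
Lemma retract_bij V A (i : rep_hom A V) (p : rep_hom V A) :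
  in_rep V -> indecomposable V -> ~ is_zero A ->
  (forall x, (p x \o i x)%VF = \1%VF) -> forall x, lbij (i x).
Proof.
move=> rV [_ iV] nA pi.
have epi_p : is_epi p.
  move=> x; apply/eqP; rewrite eqEsubv subvf /=; apply/subvP => a _.
  by have /lfunP/(_ a) := pi x; rewrite comp_lfunE id_lfunE => <-; rewrite memv_img ?memvf.
pose e x : 'End(V x) := (\1 - (i x \o p x))%VF.
have eE x v : e x v = v - i x (p x v) by rewrite /e add_lfunE opp_lfunE id_lfunE comp_lfunE.
have eK x v : e x v \in lker (p x).
  rewrite memv_ker eE linearB /=.
  by have /lfunP/(_ (p x v)) := pi x; rewrite comp_lfunE id_lfunE => ->; rewrite subrr.
pose q x : 'Hom(V x, ker_rep p x) := linfun (vsproj (lker (p x)) \o e x).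
have qE x v : vsval (q x v) = v - i x (p x v).
  by rewrite -eE lfunE; apply: vsprojK (eK x v).
have qnat x y (yx : qle Q y x) : (q y \o rmap V yx = rmap (ker_rep p) yx \o q x)%VF.
  apply/lfunP => v; apply: subvs_inj; rewrite !comp_lfunE qE ker_mapE qE.
  by rewrite linearB /= !hom_natE.
pose qh : rep_hom V (ker_rep p) := RepHom qnat.
have epi_q : is_epi qh.
  move=> x; apply/eqP; rewrite eqEsubv subvf /=; apply/subvP => u _.
  apply/memv_imgP; exists (vsval u); rewrite ?memvf //; apply: subvs_inj; rewrite qE.
  by have := subvsP u; rewrite memv_ker => /eqP ->; rewrite linear0 subr0.
have bph x : lbij (pair_hom p qh x).
  apply: lbijP.
    apply/eqP/lker0P => u v; rewrite !pair_homE => -[e1 /(congr1 vsval)].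
    by rewrite !qE e1 => /addIr.
  apply/eqP; rewrite eqEsubv subvf /=; apply/subvP => -[a u] _.
  apply/memv_imgP; exists (i x a + vsval u); rewrite ?memvf //.
  have pa : p x (i x a) = a by have /lfunP/(_ a) := pi x; rewrite comp_lfunE id_lfunE.
  have pu : p x (vsval u) = 0 by apply/eqP; rewrite -memv_ker subvsP.
  rewrite pair_homE linearD /= pa pu addr0; congr pair.
  apply: subvs_inj; rewrite qE linearD /= pa pu addr0 addrAC subrr add0r //.
have iso : isomorphic V (dsum A (ker_rep p)) by exists (pair_hom p qh); apply/is_isoP.
case: (iV _ _ (in_rep_quotient epi_p rV) (in_rep_quotient epi_q rV) iso) => // K0 x.
have bp : lbij (p x).
  apply: lbij_epi_dim (epi_p x) _.
  by rewrite (isomorphic_dim x iso) dim_prod K0 addn0.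
by apply: (lbij_of_inverse (pi x)); apply: (lbij_inj bp); rewrite comp_lfunA pi comp_lfun1l comp_lfun1r.
Qed.

End Representations.
(** * The geometry of the quiver *)

Lemma even_idx_cases (n : int) :
  (even_idx n /\ exists m, n = 2 * m) \/ (~~ even_idx n /\ exists m, n = 2 * m + 1).
Proof.
rewrite /even_idx; case: n => n.
  case: (boolP (odd n)) => on; [right|left]; split => //.
    by exists (n./2)%:Z; move: (odd_double_half n); rewrite on; lia.
  by exists (n./2)%:Z; move: (odd_double_half n); rewrite (negPf on); lia.
rewrite /=; case: (boolP (odd n)) => on /=; [left|right]; split => //.
  by exists (- ((n./2)%:Z + 1)); move: (odd_double_half n); rewrite on; lia.
by exists (- ((n./2)%:Z + 1)); move: (odd_double_half n); rewrite (negPf on); lia.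
Qed.

Lemma even_idx_double (n : int) : even_idx (2 * n).
Proof. by rewrite /even_idx abszM oddM. Qed.

Lemma even_idxD1 (n : int) : even_idx (n + 1) = ~~ even_idx n.
Proof.
rewrite /even_idx; case: n => n; first by rewrite -PoszD addn1 /= .
have -> : Negz n + 1 = - (n%:Z) by lia.
by rewrite abszN /= negbK.
Qed.

Lemma even_idxN (n : int) : even_idx (- n) = even_idx n.
Proof. by rewrite /even_idx abszN. Qed.

Section Geometry.
Variables (R : realType) (Q : quiver R).
Implicit Types (x y z : R) (m n : int).

Lemma pt_lt m n : has_pt Q m -> has_pt Q n -> m < n -> (pt Q m < pt Q n)%E.
Proof. by move=> hm hn mn; apply: qpt_incr => //; rewrite lte_fin. Qed.

Lemma pt_ltE m n : has_pt Q m -> has_pt Q n -> (pt Q m < pt Q n)%E = (m < n).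
Proof.
move=> hm hn; case: (ltP m n) => mn; first exact: pt_lt.
by apply/negbTE; rewrite -leNgt; apply: pt_le.
Qed.

Lemma pt_leE m n : has_pt Q m -> has_pt Q n -> (pt Q m <= pt Q n)%E = (m <= n).
Proof. by move=> hm hn; rewrite leNgt pt_ltE // -leNgt. Qed.

Lemma has_pt_convex m n p : has_pt Q m -> has_pt Q p -> m <= n -> n <= p -> has_pt Q n.
Proof. by move=> hm hp mn np; apply: (qidx_convex hm hp); rewrite lee_fin. Qed.

Lemma pt_qset n x : has_pt Q n -> pt Q n = x%:E -> qset Q x.
Proof.
move=> hn e; have : (qpt Q @` qidx Q) x%:E by exists n%:E.
by rewrite qpt_image => -[[r Sr [<-]] //|[]].
Qed.

(** Otherwise [-oo] must have index [-oo], so every negative integer is an index, and the points of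
    negative index decrease while staying above [x]: their infimum would be a limit point of S. *)
Lemma index_below x : exists n, has_pt Q n /\ (pt Q n <= x%:E)%E.
Proof.
apply: contrapT => H.
have {}H n : has_pt Q n -> (x%:E < pt Q n)%E.
  by move=> hn; rewrite ltNge; apply/negP => le; apply: H; exists n.
have : ext_set (qset Q) -oo%E by right; left.
rewrite -qpt_image => -[[i| |] qi e].
- by have := H i qi; rewrite /pt e.
- by have := qpt_incr (qidx_zero Q) qi (ltry 0); rewrite e ltNge leNye.
have hn n : n <= 0 -> has_pt Q n.
  by move=> n0; apply: (qidx_convex qi (qidx_zero Q)); rewrite ?leNye ?lee_fin.
pose T := [set r : R | exists2 n : int, n < 0 & pt Q n = r%:E].
have Tn n : n < 0 -> exists2 r, T r & pt Q n = r%:E.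
  move=> n0; have h1 := H n (hn n (ltW n0)).
  have h2 := pt_lt (hn n (ltW n0)) (qidx_zero Q) n0.
  case E : (pt Q n) h1 h2 => [r| |] //; first by exists r => //; exists n.
  by move=> _; rewrite ltNge leey.
have lbT : has_inf T.
  split; first by have [r Tr _] := Tn (- 1) isT; exists r.
  exists x => r [n n0 e']; rewrite -lee_fin -e'; exact/ltW/H/hn/ltW.
have : limit_point (qset Q) (inf T).
  move=> U /nbhs_ballP[d /= d0 bU].
  have [t [n n0 et] td] := inf_adherent d0 lbT.
  (* The point of the preceding index lies strictly between [inf T] (inclusive) and [t], so [t]
     differs from the infimum. *)
  have [|r Tr er] := Tn (n - 1); first by lia.
  have rt : r < t.
    rewrite -lte_fin -et -er; apply: pt_lt; try apply: hn; lia.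
  have ir : inf T <= r by apply: ge_inf => //; case: lbT.
  exists t; split; first by rewrite gt_eqF // (le_lt_trans ir).
    by apply: (pt_qset _ et); apply: hn; lia.
  apply: bU; rewrite /ball /= distrC ger0_norm; first by lra.
  by rewrite subr_ge0 (le_trans ir) // ltW.
by rewrite qset_no_limit.
Qed.

End Geometry.

(* The reflection x |-> -x reduces statements on right ends to left ends. *)
Section Opposite.
Variables (R : realType) (Q : quiver R).

Fact opp_no_limit : limit_point [set x : R | qset Q (- x)] = set0.
Proof.
apply/seteqP; split => // x lx; have : limit_point (qset Q) (- x).
  move=> U /nbhs_ballP[d /= d0 bU].
  have : nbhs x (-%R @^-1` U).
    apply/nbhs_ballP; exists d => //= y; rewrite /ball /= => xy.
    by apply: bU; rewrite /ball /= -opprD normrN.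
  move=> /lx[y [yx Sy Uy]]; exists (- y); split => //.
  by apply: contra yx; rewrite eqr_opp.
by rewrite qset_no_limit.
Qed.

Fact opp_idx_zero : [set i : \bar int | qidx Q (- i)%E] 0%E.
Proof. by have := qidx_zero Q; rewrite -[X in qidx Q X]oppe0. Qed.

Fact opp_convex (i j l : \bar int) : [set i : \bar int | qidx Q (- i)%E] i ->
  [set i : \bar int | qidx Q (- i)%E] l -> (i <= j)%E -> (j <= l)%E ->
  [set i : \bar int | qidx Q (- i)%E] j.
Proof.
by move=> /= hi hl ij jl; apply: (qidx_convex hl hi); rewrite leeN2.
Qed.

Fact opp_incr (i j : \bar int) : [set i : \bar int | qidx Q (- i)%E] i ->
  [set i : \bar int | qidx Q (- i)%E] j -> (i < j)%E ->
  (- qpt Q (- i) < - qpt Q (- j))%E.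
Proof. by move=> /= hi hj ij; rewrite lteN2; apply: qpt_incr => //; rewrite lteN2. Qed.

Fact opp_image : (fun i => - qpt Q (- i))%E @` [set i : \bar int | qidx Q (- i)%E] =
  ext_set [set x : R | qset Q (- x)].
Proof.
have H (r : \bar R) : ext_set (qset Q) r <-> exists2 i, qidx Q i & qpt Q i = r.
  by rewrite -qpt_image.
apply/seteqP; split => r /=.
  move=> [i qi <-]; have : ext_set (qset Q) (qpt Q (- i)%E) by apply/H; exists (- i)%E.
  move=> [[s Ss <-]|[->|->]]; last 2 first.
  - by right; right.
  - by right; left.
  by left; exists (- s) => //=; rewrite opprK.
have : ext_set [set x | qset Q (- x)] r -> ext_set (qset Q) (- r)%E.
  move=> [[s /= Ss <-]|[->|->]]; last 2 first.
  - by right; right.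
  - by right; left.
  by left; exists (- s).
by move=> h /h/H[i qi e]; exists (- i)%E; rewrite /= oppeK // e oppeK.
Qed.

(** Negating the index preserves its parity, so sinks remain sinks and the partial order is carried
    over without being reversed. *)
Definition opp_quiver : quiver R :=
  Quiver opp_no_limit opp_idx_zero opp_convex opp_incr opp_image.

Lemma has_pt_opp n : has_pt opp_quiver n = has_pt Q (- n).
Proof. by []. Qed.

Lemma pt_opp n : pt opp_quiver n = (- pt Q (- n))%E.
Proof. by []. Qed.

Lemma qle_opp_imp y x : qle opp_quiver y x -> qle Q (- y) (- x).
Proof.
move=> [n []]; rewrite !has_pt_opp !pt_opp => h0 h1 /andP[x0 x1] /andP[y0 y1] e.
(* The segment from [n] to [n + 1] becomes the one from [- (n + 1)] to [- n]. Its left index has the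
   other parity, which compensates for the reversal of the usual order. *)
exists (- (n + 1)); rewrite opprD addrNK -opprD; split => //.
- by rewrite !EFinN -[(_ <= - x%:E)%E]leeN2 -[(- x%:E <= _)%E]leeN2 !oppeK x0 x1.
- by rewrite !EFinN -[(_ <= - y%:E)%E]leeN2 -[(- y%:E <= _)%E]leeN2 !oppeK y0 y1.
by rewrite even_idxN even_idxD1; case: (even_idx n) e => /=; rewrite lerN2.
Qed.

Lemma qle_opp_inv y x : qle Q (- y) (- x) -> qle opp_quiver y x.
Proof.
move=> [n [h0 h1 /andP[x0 x1] /andP[y0 y1] e]].
exists (- (n + 1)); rewrite !has_pt_opp !pt_opp opprK.
have -> : - (- (n + 1) + 1) = n by lia.
split => //.
- by rewrite -[(_ <= x%:E)%E]leeN2 -[(x%:E <= _)%E]leeN2 !oppeK -EFinN x0 x1.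
- by rewrite -[(_ <= y%:E)%E]leeN2 -[(y%:E <= _)%E]leeN2 !oppeK -EFinN y0 y1.
by rewrite even_idxN even_idxD1; case: (even_idx n) e => /=; rewrite lerN2.
Qed.

Lemma qle_opp y x : qle opp_quiver y x <-> qle Q (- y) (- x).
Proof. by split; [apply: qle_opp_imp|apply: qle_opp_inv]. Qed.

End Opposite.

Section Segments.
Variables (R : realType) (Q : quiver R).
Implicit Types (x y z : R) (m n : int).

Lemma segment_right x : exists n,
  [/\ has_pt Q n, has_pt Q (n + 1) & (pt Q n <= x%:E < pt Q (n + 1))%E].
Proof.
have [n0 [hn0 n0x]] := index_below Q x.
have [m [hm xm]] : exists m, has_pt Q m /\ (x%:E < pt Q m)%E.
  (* The shift by 1 turns the weak inequality of [index_below] into a strict one. *)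
  have [m []] := index_below (opp_quiver Q) (- (x + 1)).
  rewrite has_pt_opp pt_opp EFinN leeN2 => hm xm; exists (- m); split => //.
  by apply: lt_le_trans xm; rewrite lte_fin ltrDl.
have lt0m : n0 < m by rewrite -(pt_ltE hn0 hm); apply: le_lt_trans xm.
suff H (d : nat) : has_pt Q (n0 + d%:Z) -> (x%:E < pt Q (n0 + d%:Z))%E -> exists n,
    [/\ has_pt Q n, has_pt Q (n + 1) & (pt Q n <= x%:E < pt Q (n + 1))%E].
  by apply: (H `|m - n0|%N); have -> : n0 + `|m - n0|%N%:Z = m by lia.
elim: d => [|d IH] hd xd.
  by move: xd; rewrite addr0 ltNge n0x.
have hd' : has_pt Q (n0 + d%:Z) by apply: (has_pt_convex hn0 hd); lia.
case: (ltP x%:E (pt Q (n0 + d%:Z))) => [|le]; first exact: IH.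
have e : n0 + d.+1%:Z = n0 + d%:Z + 1 by lia.
by exists (n0 + d%:Z); rewrite -e; split => //; rewrite le.
Qed.

(** Two different segments meet at most in a common end, so a relation witnessed by another segment
    forces [x = y]. *)
Lemma qle_segment n x y : has_pt Q n -> has_pt Q (n + 1) ->
  (pt Q n <= x%:E <= pt Q (n + 1))%E -> (pt Q n <= y%:E <= pt Q (n + 1))%E ->
  qle Q y x <-> (if even_idx n then y <= x else x <= y).
Proof.
move=> h0 h1 nx ny; split; last by move=> e; exists n; split.
move=> [m [m0 m1 mx my e]]; case: (ltgtP m n) => mn; last by rewrite -mn.
- have le : (pt Q (m + 1) <= pt Q n)%E by rewrite pt_leE //; lia.
  move: nx ny mx my => /andP[nx _] /andP[ny _] /andP[_ mx] /andP[_ my].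
  have : x%:E = y%:E.
    apply/le_anti; rewrite (le_trans mx (le_trans le ny)).
    by rewrite (le_trans my (le_trans le nx)).
  by case=> ->; rewrite lexx if_same.
- have le : (pt Q (n + 1) <= pt Q m)%E by rewrite pt_leE //; lia.
  move: nx ny mx my => /andP[_ nx] /andP[_ ny] /andP[mx _] /andP[my _].
  have : x%:E = y%:E.
    apply/le_anti; rewrite (le_trans nx (le_trans le my)).
    by rewrite (le_trans ny (le_trans le mx)).
  by case=> ->; rewrite lexx if_same.
Qed.

Lemma qle_refl x : qle Q x x.
Proof.
have [n [h0 h1 /andP[nx xn]]] := segment_right x.
by apply/(qle_segment h0 h1); rewrite ?nx ?(ltW xn) // lexx if_same.
Qed.

Lemma qle_anti x y : qle Q y x -> qle Q x y -> x = y.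
Proof.
move=> h1 h2; apply/le_anti; have := qle_between h1 h2.
by move=> /orP[/andP[-> ->]|/andP[-> ->]].
Qed.

Lemma qle_conv x y z : qle Q y x -> (x <= z <= y) || (y <= z <= x) ->
  qle Q y z /\ qle Q z x.
Proof.
move=> [n [h0 h1 /andP[x0 x1] /andP[y0 y1] e]] zxy.
have zn : (pt Q n <= z%:E <= pt Q (n + 1))%E.
  apply/andP; case/orP: zxy => /andP[a b]; split.
  - by apply: le_trans x0 _; rewrite lee_fin.
  - by apply: le_trans y1; rewrite lee_fin.
  - by apply: le_trans y0 _; rewrite lee_fin.
  - by apply: le_trans x1; rewrite lee_fin.
split; apply/(qle_segment h0 h1); rewrite ?x0 ?y0 ?x1 ?y1 //;
  move: e zxy; case: even_idx; lra.
Qed.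

Lemma segment_mid x y n : (pt Q n <= x%:E)%E -> (y%:E <= pt Q (n + 1))%E -> forall z,
  x <= z -> z <= y -> (pt Q n <= z%:E <= pt Q (n + 1))%E.
Proof.
move=> nx yn z xz zy; apply/andP; split.
  by apply: le_trans nx _; rewrite lee_fin.
by apply: le_trans yn; rewrite lee_fin.
Qed.

Lemma qle_comparable x y : x <= y ->
  (forall n, has_pt Q n -> ~ (x%:E < pt Q n < y%:E)%E) -> qle Q x y \/ qle Q y x.
Proof.
move=> xy H; have [n [h0 h1 /andP[nx xn]]] := segment_right x.
have yn : (y%:E <= pt Q (n + 1))%E.
  by rewrite leNgt; apply/negP => lt; apply: (H _ h1); rewrite xn lt.
have := segment_mid nx yn => mid.
have bx := mid x (lexx _) xy; have by_ := mid y xy (lexx _).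
case e : (even_idx n); [left|right]; apply/(qle_segment h0 h1) => //; by rewrite e.
Qed.

Lemma pt_fin n x y : (x%:E <= pt Q n)%E -> (pt Q n <= y%:E)%E -> exists z, pt Q n = z%:E.
Proof.
by case: (pt Q n) => [z| |] //; exists z.
Qed.

(* Any two points of a convex set are joined by a path of comparable points:
   go through the elements of S between them. *)
Lemma zigzag (K P : set R) : (forall x y z, K x -> K z -> x <= y -> y <= z -> K y) ->
  (forall x y, K x -> K y -> qle Q y x -> P x <-> P y) ->
  forall x y, K x -> K y -> P x -> P y.
Proof.
move=> cK HP.
have H d n x y : has_pt Q n -> has_pt Q (n + 1) -> (pt Q n <= x%:E < pt Q (n + 1))%E ->
    (x%:E <= y%:E)%E ->
    has_pt Q (n + d%:Z + 1) -> (y%:E < pt Q (n + d%:Z + 1))%E -> K x -> K y -> P x <-> P y.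
  elim: d n x => [|d IH] n x h0 h1 /andP[nx xn] xy hd yd Kx Ky.
    move: hd yd; rewrite addr0 => _ yd.
    have [||h|h] := @qle_comparable x y; rewrite -?lee_fin //.
    - move=> m hm /andP[xm my].
      have := le_lt_trans nx xm; rewrite pt_ltE // => nm.
      by have := lt_trans my yd; rewrite pt_ltE //; lia.
    - by apply: iff_sym; apply: HP.
    - exact: HP.
  have e : n + d.+1%:Z + 1 = (n + 1) + d%:Z + 1 by lia.
  case: (ltP y%:E (pt Q (n + 1))) => [yn|ny].
    have hd' : has_pt Q (n + d%:Z + 1) by apply: (has_pt_convex h1 hd); lia.
    apply: (IH n) => //; first by rewrite nx.
    by apply: lt_le_trans yn _; apply: pt_le => //; lia.
  have [z ez] := pt_fin (ltW xn) ny.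
  have xz : x <= z by rewrite -lee_fin -ez ltW.
  have zy : z <= y by rewrite -lee_fin -ez.
  have Kz : K z by apply: cK xz zy.
  have -> : P x <-> P z.
    have bx : (pt Q n <= x%:E <= pt Q (n + 1))%E by rewrite nx ltW.
    have bz : (pt Q n <= z%:E <= pt Q (n + 1))%E by rewrite ez lexx (le_trans nx) ?lee_fin.
    case ee : (even_idx n).
      by apply: iff_sym; apply: HP => //; apply/(qle_segment h0 h1) => //; rewrite ee.
    by apply: HP => //; apply/(qle_segment h0 h1) => //; rewrite ee.
  have h2 : has_pt Q (n + 1 + 1) by apply: (has_pt_convex h1 hd); lia.
  apply: (IH (n + 1)) => //; rewrite -?e //.
  by rewrite -ez lexx /=; apply: pt_lt => //; lia.
have L x y : x <= y -> K x -> K y -> P x <-> P y.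
  move=> xy Kx Ky; have [n [n0 n1 nx]] := segment_right x.
  have [m [m0 m1 /andP[my ym]]] := segment_right y.
  have nm : n <= m.
    case/andP: nx => nx _; have : (pt Q n < pt Q (m + 1))%E.
      by apply: le_lt_trans nx (le_lt_trans _ ym); rewrite lee_fin.
    by rewrite pt_ltE //; lia.
  have e : n + `|m - n|%N%:Z + 1 = m + 1 by lia.
  by apply: (H `|m - n|%N n) => //; rewrite ?e ?lee_fin.
move=> x y Kx Ky; case: (leP x y) => [xy|/ltW yx]; first by case: (L _ _ xy Kx Ky).
by case: (L _ _ yx Ky Kx).
Qed.

End Segments.

Section SegmentsLeft.
Variables (R : realType) (Q : quiver R).

Lemma segment_left (x : R) : exists n,
  [/\ has_pt Q n, has_pt Q (n + 1) & (pt Q n < x%:E <= pt Q (n + 1))%E].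
Proof.
have [n [hn hn1 /andP[]]] := segment_right (opp_quiver Q) (- x).
rewrite !pt_opp EFinN leeN2 lteN2 => xn nx; exists (- (n + 1)).
have -> : - (n + 1) + 1 = - n by lia.
by split => //; rewrite xn nx.
Qed.

End SegmentsLeft.

(** * Steps between rays *)

Section Rays.
Variables (R : realType).

Definition upset (A : set R) := forall x y, A x -> x <= y -> A y.
Definition downset (B : set R) := forall x y, B x -> y <= x -> B y.
Definition refl_set (A : set R) : set R := [set x | A (- x)].

(* The canonical map between the interval representations supported by A and C
   is natural. *)
Definition hom_ok (Q : quiver R) (A C : set R) :=
  forall x y, qle Q y x -> A x -> C y -> (A y <-> C x).

(** Left almost split maps, for one end only: a canonical map from [A] to some [C] other than [A]
    extends to [A']. The last clause says that the composite through [A'] does not vanish where the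
    original map is nonzero. *)
Definition almost_split_step (Q : quiver R) (fam : set R -> Prop) (A A' : set R) :=
  hom_ok Q A A' /\
  forall C, fam C -> hom_ok Q A C -> (exists x, ~ (A x <-> C x)) ->
    hom_ok Q A' C /\ (forall x, A x -> C x -> A' x).

(** The bound is an element of integer index, possibly infinite. This is the notion that leaves only
    finitely many segments to cover. *)
Definition bounded_below (Q : quiver R) (A : set R) :=
  exists2 n, has_pt Q n & forall x, A x -> (pt Q n <= x%:E)%E.
Definition bounded_above (Q : quiver R) (A : set R) :=
  exists2 n, has_pt Q n & forall x, A x -> (x%:E <= pt Q n)%E.

Variable Q : quiver R.
Implicit Types (A B C D : set R) (x y z : R) (n m : int).

Lemma hom_ok_refl A : hom_ok Q A A.
Proof. by move=> x y _ Ax Ay. Qed.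

Lemma hom_okI A B C D : hom_ok Q A C -> hom_ok Q B D -> hom_ok Q (A `&` B) (C `&` D).
Proof.
move=> h1 h2 x y yx [Ax Bx] [Cy Dy]; move: (h1 x y yx Ax Cy) (h2 x y yx Bx Dy) => [a b] [c d].
by split=> -[? ?]; split; auto.
Qed.

Lemma hom_ok_opp A C : hom_ok (opp_quiver Q) (refl_set A) (refl_set C) <-> hom_ok Q A C.
Proof.
split=> h x y yx Ax Cy.
  have := h (- x) (- y); rewrite /refl_set /= !opprK; apply => //.
  by apply/qle_opp; rewrite !opprK.
by apply: h => //; apply/qle_opp.
Qed.

Lemma refl_setK A : refl_set (refl_set A) = A.
Proof. by apply/funext => x; rewrite /refl_set /= opprK. Qed.

Lemma upset_refl A : upset A -> downset (refl_set A).
Proof. by move=> uA x y Ax yx; apply: uA Ax _; rewrite lerN2. Qed.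

Lemma downset_refl A : downset A -> upset (refl_set A).
Proof. by move=> uA x y Ax yx; apply: uA Ax _; rewrite lerN2. Qed.

(** To the left of [z] the right rays impose no condition, and a relation that straddles [z] can be
    replaced by one having [z] as an end. *)
Lemma hom_ok_rays_left A B C D z : upset A -> downset B -> upset C -> downset D ->
  A z -> B z -> C z -> D z -> hom_ok Q (A `&` B) (C `&` D) -> hom_ok Q A C.
Proof.
move=> uA dB uC dD Az Bz Cz Dz h x y yx Ax Cy.
case: (leP z y) => zy; case: (leP z x) => zx.
- by split=> _; [apply: uC Cz _|apply: uA Az _].
- split=> _; last exact: uA Az zy.
  have [_ zx'] := @qle_conv _ _ x y z yx ltac:(by rewrite (ltW zx) zy).
  have Bx := dB _ _ Bz (ltW zx).
  by have [] := (h x z zx' (conj Ax Bx) (conj Cz Dz)).1 (conj Az Bz).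
- split=> _; first exact: uC Cz zx.
  have [yz _] := @qle_conv _ _ x y z yx ltac:(by rewrite (ltW zy) zx orbT).
  have Dy := dD _ _ Dz (ltW zy).
  by have [] := (h z y yz (conj Az Bz) (conj Cy Dy)).2 (conj Cz Dz).
- have Bx := dB _ _ Bz (ltW zx); have Dx := dD _ _ Dz (ltW zx).
  have By := dB _ _ Bz (ltW zy); have Dy := dD _ _ Dz (ltW zy).
  have [h1 h2] := h x y yx (conj Ax Bx) (conj Cy Dy).
  split=> [Ay|Cx]; first by have [] := h1 (conj Ay By).
  by have [] := h2 (conj Cx Dx).
Qed.

Lemma upset_total A C y : upset A -> upset C -> A y -> ~ C y -> forall x, C x -> A x.
Proof.
move=> uA uC Ay nC x Cx; apply: (uA _ _ Ay); rewrite leNgt; apply/negP => xy.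
by apply: nC; apply: uC Cx (ltW xy).
Qed.

Lemma shrink_step A A' : upset A -> upset A' -> (forall x, A' x -> A x) ->
  (forall x y, qle Q y x -> A x -> A' y -> A' x) ->
  (forall x c, A x -> ~ A' c -> x <= c -> qle Q c x) ->
  (forall y, ~ A y -> exists z x, [/\ y <= z, ~ A z, A x & qle Q z x]) ->
  almost_split_step Q upset A A'.
Proof.
move=> uA uA' sub h1 h2 h3; split.
  by move=> x y yx Ax Ay; split=> _; [apply: h1 yx Ax Ay|apply: sub].
move=> C uC hC [x0 neq].
have CA c : C c -> A c.
  move=> Cc; apply: contrapT => nAc; have [z [x [cz nAz Ax zx]]] := h3 _ nAc.
  have Cz := uC _ _ Cc cz.
  by apply: (nAz); apply/(hC _ _ zx Ax Cz); apply: upset_total uC uA Cz nAz _ Ax.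
have [Ax0 nCx0] : A x0 /\ ~ C x0.
  by move: (CA x0) neq; case: (pselect (A x0)); case: (pselect (C x0)); tauto.
have CA' c : C c -> A' c.
  move=> Cc; apply: contrapT => nA'.
  have xc : x0 <= c by rewrite leNgt; apply/negP => /ltW cx; apply/nCx0/uC/cx.
  have cx := h2 _ _ Ax0 nA' xc.
  by apply/nCx0/(hC _ _ cx Ax0 Cc)/CA.
split=> [x y yx A'x Cy|x _ /CA'//]; split=> _; last exact: CA'.
by apply/(hC _ _ yx (sub _ A'x) Cy)/CA.
Qed.

(** Only relations starting at an added point [x] and going to the right are critical. There the
    last hypothesis gives [A] inside [C]; as [C] is not [A], it contains a point outside [A], which
    is at most [x], and so contains [x]. *)
Lemma grow_step A A' : upset A -> upset A' -> (forall x, A x -> A' x) ->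
  (forall x y, qle Q y x -> A x -> A' y -> A y) ->
  (forall x y, qle Q y x -> A' x -> A' y) ->
  (forall x y, qle Q y x -> A' x -> ~ A x -> x < y ->
    (forall z, A z -> z <= y -> qle Q y z) /\ (forall z, x < z -> A z)) ->
  almost_split_step Q upset A A'.
Proof.
move=> uA uA' sub h1 h2 h3; split.
  by move=> x y yx Ax Ay; split=> _; [apply: sub|apply: h1 yx Ax Ay].
move=> C uC hC [x0 neq]; split=> [x y yx A'x Cy|x /sub //].
split=> _; last exact: h2 yx A'x.
case: (pselect (A x)) => [Ax|nAx].
  by apply/(hC _ _ yx Ax Cy)/(h1 _ _ yx Ax)/(h2 _ _ yx).
apply: contrapT => nCx.
have xy : x < y by rewrite ltNge; apply/negP => yx'; apply/nCx/uC/yx'.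
have [h4 h5] := h3 _ _ yx A'x nAx xy.
have Ay := h5 _ xy.
have AC z : A z -> C z.
  move=> Az; case: (leP z y) => zy; last exact: uC Cy (ltW zy).
  by apply/(hC _ _ (h4 _ Az zy) Az Cy).
have [c Cc nAc] : exists2 c, C c & ~ A c.
  apply: contrapT => h; apply: neq; split; first exact: AC.
  by move=> Cx; apply: contrapT => nA; apply: h; exists x0.
have cx : c <= x by rewrite leNgt; apply/negP => /h5.
exact/nCx/uC/cx.
Qed.

End Rays.

(** * The four kinds of ends and their almost split steps *)

Section Ends.
Variables (R : realType) (Q : quiver R).
Implicit Types (x y z : R) (n m : int).

Definition lray (l : itv_bound (\bar R)) : set R := [set x | (l <= BLeft x%:E)%O].
Definition rray (r : itv_bound (\bar R)) : set R := [set x | (BRight x%:E <= r)%O].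

Lemma lray_upset l : upset (lray l).
Proof. by move=> x y /= lx xy; apply: le_trans lx _; rewrite bnd_simp lee_fin. Qed.

Lemma rray_downset r : downset (rray r).
Proof. by move=> x y /= lx xy; apply: le_trans lx; rewrite bnd_simp lee_fin. Qed.

(* [left_end lI lL t]: the left ends lI and lL of the first and the last term
   of one of the sixteen sequences; t is the larger of the two end points. *)
Inductive left_end : itv_bound (\bar R) -> itv_bound (\bar R) -> \bar R -> Prop :=
| left_end1 (a : R) of ~ ext_set (qset Q) a%:E & sink_left Q a :
    left_end (BLeft a%:E) (BRight a%:E) a%:E
| left_end2 (a : R) of ~ ext_set (qset Q) a%:E & sink_right Q a :
    left_end (BRight a%:E) (BLeft a%:E) a%:E
| left_end3 (n : int) of has_pt Q (2 * n - 1) & has_pt Q (2 * n) :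
    left_end (BLeft (pt Q (2 * n - 1))) (BRight (pt Q (2 * n))) (pt Q (2 * n))
| left_end4 (n : int) of has_pt Q (2 * n) & has_pt Q (2 * n + 1) :
    left_end (BRight (pt Q (2 * n + 1))) (BLeft (pt Q (2 * n))) (pt Q (2 * n + 1)).

Inductive right_end : itv_bound (\bar R) -> itv_bound (\bar R) -> \bar R -> Prop :=
| right_end1 (b : R) of ~ ext_set (qset Q) b%:E & sink_left Q b :
    right_end (BLeft b%:E) (BRight b%:E) b%:E
| right_end2 (b : R) of ~ ext_set (qset Q) b%:E & sink_right Q b :
    right_end (BRight b%:E) (BLeft b%:E) b%:E
| right_end3 (n : int) of has_pt Q (2 * n) & has_pt Q (2 * n + 1) :
    right_end (BRight (pt Q (2 * n + 1))) (BLeft (pt Q (2 * n))) (pt Q (2 * n))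
| right_end4 (n : int) of has_pt Q (2 * n - 1) & has_pt Q (2 * n) :
    right_end (BLeft (pt Q (2 * n - 1))) (BRight (pt Q (2 * n))) (pt Q (2 * n - 1)).

(** The types correspond one to one to pairs of a left and a right end, and [l < r] is the
    inequality between the inner end points required in each type. *)
Lemma ends_ar_type lI lL l rI rL r : left_end lI lL l -> right_end rI rL r ->
  (l < r)%E ->
  ar_type Q (Interval lI rI) (Interval lI rL) (Interval lL rI) (Interval lL rL).
Proof.
have lt1 n : has_pt Q (2 * n - 1) -> has_pt Q (2 * n) ->
    (pt Q (2 * n - 1) < pt Q (2 * n))%E by move=> *; apply: pt_lt => //; lia.
have lt2 n : has_pt Q (2 * n) -> has_pt Q (2 * n + 1) ->
    (pt Q (2 * n) < pt Q (2 * n + 1))%E by move=> *; apply: pt_lt => //; lia.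
case=> [a|a|n|n] h1 h2; case=> [b|b|m|m] h3 h4 lr.
- exact: ar_type1.
- exact: ar_type2.
- by apply: ar_type9; auto.
- by apply: ar_type11; auto.
- exact: ar_type3.
- exact: ar_type4.
- by apply: ar_type10; auto.
- by apply: ar_type12; auto.
- by apply: ar_type5; auto.
- by apply: ar_type6; auto.
- by apply: ar_type14; auto.
- by apply: ar_type16; auto.
- by apply: ar_type7; auto.
- by apply: ar_type8; auto.
- by apply: ar_type13; auto.
- by apply: ar_type15; auto.
Qed.

(** An element of infinite index would lie beyond all those of integer index, and there are such
    elements on both sides of any real [x]. *)
Lemma ext_setP x : ~ ext_set (qset Q) x%:E <-> (forall n, has_pt Q n -> pt Q n <> x%:E).
Proof.
split=> [h n hn e|h].
  by apply: h; rewrite -qpt_image; exists n%:E.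
rewrite -qpt_image => -[[n| |] qi e]; first exact: h n qi e.
- have [m []] := index_below (opp_quiver Q) (- (x + 1)).
  rewrite has_pt_opp pt_opp EFinN leeN2 => hm le.
  have := qpt_incr hm qi (ltry _); rewrite e => /(le_lt_trans le).
  by rewrite lte_fin; lra.
- have [m [hm le]] := index_below Q (x - 1).
  have := qpt_incr qi hm (ltNyr _); rewrite e => lt; have := lt_le_trans lt le.
  by rewrite lte_fin; lra.
Qed.

Lemma sink_leftP x : sink_left Q x -> exists n,
  [/\ has_pt Q n, has_pt Q (n + 1), (pt Q n < x%:E < pt Q (n + 1))%E & even_idx n].
Proof.
move=> [t [n [h0 h1 nx ->]] lt]; exists n; split => //.
by apply: contraTT lt => /negPf ->; case/andP: nx => _ /ltW; rewrite leNgt.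
Qed.

Lemma sink_rightP x : sink_right Q x -> exists n,
  [/\ has_pt Q n, has_pt Q (n + 1), (pt Q n < x%:E < pt Q (n + 1))%E & ~~ even_idx n].
Proof.
move=> [t [n [h0 h1 nx ->]] lt]; exists n; split => //.
by apply: contraTN lt => ->; case/andP: nx => /ltW + _; rewrite leNgt.
Qed.

End Ends.

Section EndFacts.
Variables (R : realType).
Implicit Types (x y z a : R) (p q : \bar R).

Lemma ereal_between p q : (p < q)%E -> exists r : R, (p < r%:E < q)%E.
Proof.
case: p q => [p| |] [q| |] //=; rewrite ?lte_fin => pq.
- by exists ((p + q) / 2); rewrite !lte_fin; lra.
- by exists (p + 1); rewrite lte_fin ltry; lra.
- by exists (q - 1); rewrite lte_fin ltNyr; lra.
- by exists 0; rewrite ltry ltNyr.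
Qed.

Lemma between_below p y a : (p < a%:E)%E -> y < a ->
  exists z, [/\ y < z, z < a & (p < z%:E)%E].
Proof.
move=> pa ya; have : (maxe p y%:E < a%:E)%E by rewrite gt_max pa lte_fin.
by move=> /ereal_between[z]; rewrite gt_max !lte_fin => /andP[/andP[h1 h2] h3]; exists z.
Qed.

Variable Q : quiver R.
Implicit Types (n m : int).

Lemma open_segment n x y : has_pt Q n -> has_pt Q (n + 1) ->
  (pt Q n < x%:E < pt Q (n + 1))%E -> qle Q y x \/ qle Q x y ->
  (pt Q n <= y%:E <= pt Q (n + 1))%E.
Proof.
move=> h0 h1 /andP[nx xn] H.
have [m [m0 m1 /andP[mx xm] my]] : exists m, [/\ has_pt Q m, has_pt Q (m + 1),
    (pt Q m <= x%:E <= pt Q (m + 1))%E & (pt Q m <= y%:E <= pt Q (m + 1))%E].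
  by case: H => -[m [m0 m1 mx my _]]; exists m.
have := le_lt_trans mx xn; rewrite pt_ltE // => a.
have := lt_le_trans nx xm; rewrite pt_ltE // => b.
by have <- : m = n by lia.
Qed.

Lemma open_even n x y : has_pt Q n -> has_pt Q (n + 1) ->
  (pt Q n < x%:E < pt Q (n + 1))%E -> even_idx n ->
  (qle Q y x -> y <= x) /\ (qle Q x y -> x <= y).
Proof.
move=> h0 h1 nx en; have nx' : (pt Q n <= x%:E <= pt Q (n + 1))%E.
  by case/andP: nx => a b; rewrite !ltW.
split=> h; have ny := open_segment h0 h1 nx (y := y) ltac:(tauto).
  by move/(qle_segment h0 h1 nx' ny): h; rewrite en.
by move/(qle_segment h0 h1 ny nx'): h; rewrite en.
Qed.

Lemma open_odd n x y : has_pt Q n -> has_pt Q (n + 1) ->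
  (pt Q n < x%:E < pt Q (n + 1))%E -> ~~ even_idx n ->
  (qle Q y x -> x <= y) /\ (qle Q x y -> y <= x).
Proof.
move=> h0 h1 nx /negPf en; have nx' : (pt Q n <= x%:E <= pt Q (n + 1))%E.
  by case/andP: nx => a b; rewrite !ltW.
split=> h; have ny := open_segment h0 h1 nx (y := y) ltac:(tauto).
  by move/(qle_segment h0 h1 nx' ny): h; rewrite en.
by move/(qle_segment h0 h1 ny nx'): h; rewrite en.
Qed.

Lemma pt_cases n m x : has_pt Q n -> pt Q n = x%:E -> has_pt Q m -> has_pt Q (m + 1) ->
  (pt Q m <= x%:E <= pt Q (m + 1))%E -> m = n \/ m + 1 = n.
Proof.
by move=> hn <- m0 m1; rewrite !pt_leE //; lia.
Qed.

Lemma sink_min n x y : has_pt Q n -> even_idx n -> pt Q n = x%:E -> qle Q y x -> y = x.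
Proof.
move=> hn en ex [m [m0 m1 mx /andP[my ym] e]].
case: (pt_cases hn ex m0 m1 mx) => mn.
  by subst m; move: e; rewrite en => yx; apply/le_anti; rewrite yx -lee_fin -ex my.
move: e; have -> : even_idx m = false.
  by apply/negbTE; rewrite -even_idxD1 mn.
by move=> xy; apply/le_anti; rewrite xy andbT -lee_fin -ex -mn ym.
Qed.

Lemma source_max n x y : has_pt Q n -> ~~ even_idx n -> pt Q n = x%:E -> qle Q x y -> y = x.
Proof.
move=> hn en ex [m [m0 m1 /andP[my ym] mx e]].
case: (pt_cases hn ex m0 m1 mx) => mn.
  by subst m; move: e; rewrite (negPf en) => yx; apply/le_anti; rewrite yx -lee_fin -ex my.
move: e; have -> : even_idx m by rewrite -[even_idx m]negbK -even_idxD1 mn.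
by move=> xy; apply/le_anti; rewrite xy andbT -lee_fin -ex -mn ym.
Qed.

Lemma even_pred n : even_idx (2 * n - 1) = false.
Proof.
by have := even_idxD1 (2 * n - 1); rewrite subrK even_idx_double; case: even_idx.
Qed.

Lemma even_succ n : even_idx (2 * n + 1) = false.
Proof. by rewrite even_idxD1 even_idx_double. Qed.

Lemma lrayL p x : lray (BLeft p) x = (p <= x%:E)%E :> Prop.
Proof. by rewrite /lray /= bnd_simp. Qed.

Lemma lrayR p x : lray (BRight p) x = (p < x%:E)%E :> Prop.
Proof. by rewrite /lray /= bnd_simp. Qed.

(** Ends 1 and 3 shrink the ray, ends 2 and 4 enlarge it. Ends 1 and 2 change one point; ends 3 and
    4 change the part of a segment between its source and its sink. *)
Lemma left_end_step lI lL l : left_end Q lI lL l ->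
  almost_split_step Q (@upset R) (lray lI) (lray lL).
Proof.
case=> [a _|a _|n h0 h1|n h0 h1].
- move=> /sink_leftP[n [h0 h1 na en]].
  apply: shrink_step; try exact: lray_upset.
  + by move=> x; rewrite lrayL lrayR => /ltW.
  + move=> x y yx; rewrite lrayL !lrayR !lee_fin !lte_fin => ax ay.
    rewrite lt_neqAle ax andbT; apply/eqP => e; subst x.
    by have := (open_even y h0 h1 na en).1 yx; lra.
  + move=> x c; rewrite lrayL lrayR lee_fin lte_fin => ax /negP; rewrite -leNgt => ca xc.
    have -> : c = x by lra.
    exact: qle_refl.
  + move=> y; rewrite lrayL lee_fin => /negP; rewrite -ltNge => ya.
    have [z [yz za pz]] := between_below (andP na).1 ya.
    exists z, a; rewrite !lrayL !lee_fin; split => //; first exact: ltW.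
      by apply/negP; rewrite -ltNge.
    case/andP: na => na an; apply/(qle_segment h0 h1); first by rewrite (ltW na) (ltW an).
      by rewrite (ltW pz) (le_trans _ (ltW an)) // lee_fin ltW.
    by rewrite en ltW.
- move=> /sink_rightP[n [h0 h1 na en]].
  apply: grow_step; try exact: lray_upset.
  + by move=> x; rewrite lrayL lrayR => /ltW.
  + move=> x y yx; rewrite lrayL !lrayR !lee_fin !lte_fin => ax ay.
    rewrite lt_neqAle ay andbT; apply/eqP => e; subst y.
    by have := (open_odd x h0 h1 na en).2 yx; lra.
  + move=> x y yx; rewrite !lrayL !lee_fin => ax; rewrite leNgt; apply/negP => ya.
    have [_ h] := @qle_conv _ Q x y a yx ltac:(lra).
    have := (open_odd x h0 h1 na en).2 h => xa.
    have e : x = a by lra.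
    by subst x; have := (open_odd y h0 h1 na en).1 yx; lra.
  + move=> x y yx; rewrite lrayL lrayR lee_fin lte_fin => ax /negP; rewrite -leNgt => xa xy.
    have e : x = a by lra.
    subst x; split=> [z|z]; rewrite lrayR lte_fin // => az zy.
    by have [] := @qle_conv _ Q a y z yx ltac:(lra).
- have h0' : has_pt Q (2 * n - 1 + 1) by rewrite subrK.
  apply: shrink_step; try exact: lray_upset.
  + move=> x; rewrite lrayL lrayR => /ltW; apply: le_trans; apply: pt_le => //; lia.
  + move=> x y yx; rewrite lrayL !lrayR => ax ay; rewrite ltNge; apply/negP => xn.
    have [r er] := pt_fin xn (ltW ay).
    move: xn ay; rewrite er lee_fin lte_fin => xr ry.
    have [yr _] := @qle_conv _ Q x y r yx ltac:(lra).
    by have := sink_min h1 (even_idx_double n) er yr; lra.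
  + move=> x c; rewrite lrayL lrayR => ax /negP; rewrite -leNgt => cn xc.
    apply/(qle_segment h0 h0'); rewrite ?even_pred // ?subrK.
      by rewrite ax /= (le_trans _ cn) // lee_fin.
    by rewrite cn (le_trans ax) // lee_fin.
  + move=> y; rewrite lrayL => /negP; rewrite -ltNge => ya.
    have lt : (pt Q (2 * n - 1) < pt Q (2 * n))%E by apply: pt_lt => //; lia.
    have [r er] : exists r, pt Q (2 * n - 1) = r%:E.
      case: (pt Q (2 * n - 1)) ya lt => [r| |] //; first by exists r.
      by move=> _; rewrite ltNge leey.
    (* The source is finite, as [y] lies to its left. The segment ending there starts at a sink, so
       points just to the left of the source are below it in the order: these are the relations
       leaving the ray. *)
    have [m [m0 m1 /andP[mr rm]]] := segment_left Q r.
    move: (mr) (rm); rewrite -er pt_ltE // pt_leE // => a b.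
    have em : even_idx m by rewrite -[even_idx m]negbK -even_idxD1 (_ : m + 1 = 2 * n - 1) ?even_pred //; lia.
    move: ya; rewrite er lte_fin => yr.
    have [z [yz zr pz]] := between_below mr yr.
    exists z, r; rewrite !lrayL !lee_fin; split => //; first exact: ltW.
      by apply/negP; rewrite -ltNge.
    apply/(qle_segment m0 m1); first by rewrite (ltW mr) rm.
      by rewrite (ltW pz) (le_trans _ rm) // lee_fin ltW.
    by rewrite em ltW.
- apply: grow_step; try exact: lray_upset.
  + move=> x; rewrite lrayL lrayR => /ltW; apply: le_trans; apply: pt_le => //; lia.
  + move=> x y yx; rewrite lrayL !lrayR => ax ay; rewrite ltNge; apply/negP => xn.
    have [r er] := pt_fin xn (ltW ax).
    move: xn ax; rewrite er lee_fin lte_fin => xr ry.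
    have [_ yr] := @qle_conv _ Q x y r yx ltac:(lra).
    by have := source_max h1 (negbT (even_succ n)) er yr; lra.
  + move=> x y yx; rewrite !lrayL => ax; rewrite leNgt; apply/negP => yn.
    have [r er] := pt_fin (ltW yn) ax.
    move: yn ax; rewrite er lte_fin lee_fin => yr rx.
    have [yr' _] := @qle_conv _ Q x y r yx ltac:(lra).
    by have := sink_min h0 (even_idx_double n) er yr'; lra.
  + move=> x y yx; rewrite lrayL lrayR => nx /negP; rewrite -leNgt => xn xy.
    (* Within this segment relations lead only to the left, so a relation from [x] to a larger [y]
       is possible only at the source. *)
    have ex : pt Q (2 * n + 1) = x%:E.
      apply/le_anti; rewrite xn andbT leNgt; apply/negP => lt.
      have bx : (pt Q (2 * n) <= x%:E <= pt Q (2 * n + 1))%E by rewrite nx xn.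
      case: (leP y%:E (pt Q (2 * n + 1))) => ny.
        have by_ : (pt Q (2 * n) <= y%:E <= pt Q (2 * n + 1))%E.
          by rewrite ny (le_trans nx) // lee_fin ltW.
        by have := (qle_segment h0 h1 bx by_).1 yx; rewrite even_idx_double; lra.
      have [r er] := pt_fin xn (ltW ny).
      move: (lt) (ny); rewrite er !lte_fin => xr ry.
      have [_ rx] := @qle_conv _ Q x y r yx ltac:(lra).
      have br : (pt Q (2 * n) <= r%:E <= pt Q (2 * n + 1))%E.
        by rewrite er lexx (le_trans nx) // lee_fin ltW.
      by have := (qle_segment h0 h1 bx br).1 rx; rewrite even_idx_double; lra.
    split=> [z|z xz]; rewrite lrayR ex lte_fin // => xz zy.
    by have [] := @qle_conv _ Q x y z yx ltac:(lra).
Qed.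

Lemma left_end_bounds lI lL l : left_end Q lI lL l ->
  [/\ (exists d, ~ (lray lI d <-> lray lL d)),
      (forall d, ~ (lray lI d <-> lray lL d) -> (d%:E <= l)%E),
      (forall z, (l < z%:E)%E -> lray lI z /\ lray lL z),
      bounded_below Q (lray lI) & bounded_below Q (lray lL)].
Proof.
case=> [a _ _|a _ _|n h0 h1|n h0 h1].
- have [n [hn na]] := index_below Q a; split.
  + by exists a; rewrite lrayL lrayR lee_fin lte_fin lexx ltxx => -[/(_ isT)].
  + move=> d; rewrite lrayL lrayR => H; rewrite leNgt; apply/negP => ad.
    by apply: H; rewrite ad ltW.
  + by move=> z; rewrite lrayL lrayR => az; rewrite az ltW.
  + by exists n => // x; rewrite lrayL; apply: le_trans.
  + by exists n => // x; rewrite lrayR => /ltW; apply: le_trans.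
- have [n [hn na]] := index_below Q a; split.
  + by exists a; rewrite lrayL lrayR lee_fin lte_fin lexx ltxx => -[_ /(_ isT)].
  + move=> d; rewrite lrayL lrayR => H; rewrite leNgt; apply/negP => ad.
    by apply: H; rewrite ad ltW.
  + by move=> z; rewrite lrayL lrayR => az; rewrite az ltW.
  + by exists n => // x; rewrite lrayR => /ltW; apply: le_trans.
  + by exists n => // x; rewrite lrayL; apply: le_trans.
- have lt : (pt Q (2 * n - 1) < pt Q (2 * n))%E by apply: pt_lt => //; lia.
  split.
  + have [d /andP[d1 d2]] := ereal_between lt; exists d.
    by rewrite lrayL lrayR (ltW d1) ltNge (ltW d2) => -[/(_ isT)].
  + move=> d; rewrite lrayL lrayR => H; rewrite leNgt; apply/negP => ad.
    by apply: H; rewrite ad (le_trans (ltW lt) (ltW ad)).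
  + by move=> z; rewrite lrayL lrayR => az; rewrite az (le_trans (ltW lt) (ltW az)).
  + by exists (2 * n - 1) => // x; rewrite lrayL.
  + by exists (2 * n) => // x; rewrite lrayR => /ltW.
- have lt : (pt Q (2 * n) < pt Q (2 * n + 1))%E by apply: pt_lt => //; lia.
  split.
  + have [d /andP[d1 d2]] := ereal_between lt; exists d.
    by rewrite lrayL lrayR (ltW d1) ltNge (ltW d2) => -[_ /(_ isT)].
  + move=> d; rewrite lrayL lrayR => H; rewrite leNgt; apply/negP => ad.
    by apply: H; rewrite ad (le_trans (ltW lt) (ltW ad)).
  + by move=> z; rewrite lrayL lrayR => az; rewrite az (le_trans (ltW lt) (ltW az)).
  + by exists (2 * n + 1) => // x; rewrite lrayR => /ltW.
  + by exists (2 * n) => // x; rewrite lrayL.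
Qed.

End EndFacts.

(** * Listed ends and ends that can be approximated *)

Section Classification.
Variables (R : realType).
Implicit Types (x y z : R) (A B : set R).

(* [A2] differs from the end [A] of the interval A /\ B by a piece on which a
   representation with colouring [c] is constant, in such a way that every map
   into it from M_(A2 /\ B) induces one from M_(A /\ B), by restriction (the
   first case, where the map vanishes on the piece) or by extension from [x]
   (the second case). *)
Definition bad_end (Q : quiver R) (c : R -> nat) (fam : set R -> Prop) A B : Prop :=
  exists A2, [/\ fam A2, hom_ok Q A2 A, (exists l, [/\ A2 l, A l & B l]),
    (exists d, ~ (A d <-> A2 d)) /\ (forall d, ~ (A d <-> A2 d) -> B d)
  & ((forall x, A x -> A2 x) /\
     (forall d, A2 d -> ~ A d -> exists y, [/\ qle Q y d, ~ A2 y & c y = c d])) \/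
    ((forall x, A2 x -> A x) /\
     exists x, [/\ A2 x, B x & forall d, A d -> ~ A2 d -> [/\ qle Q x d, c x = c d
       & forall y, qle Q y d -> (A y /\ ~ A2 y) \/ qle Q y x]])].

(** Among the points between [p] and [a], [u] has the largest colour; the bound [N] makes it exist,
    and by monotonicity no change occurs from [u] up to [a]. On the other side, [colour_above] takes
    a smallest colour. *)
Lemma colour_below (c : R -> nat) N (p : \bar R) (a : R) :
  (forall x y, x <= y -> (c x <= c y)%N) -> (forall x, (c x <= N)%N) -> (p < a%:E)%E ->
  exists u, [/\ (p < u%:E)%E, u < a & forall z, u <= z -> z < a -> c z = c u].
Proof.
move=> mc bc pa.
pose P n := `[< exists x : R, [/\ (p < x%:E)%E, x < a & c x = n] >].
have exP : exists n, P n.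
  have [x /andP[h1 h2]] := ereal_between pa; exists (c x); apply/asboolP; exists x.
  by rewrite -lte_fin.
have bP n : P n -> (n <= N)%N by move=> /asboolP[x [_ _ <-]].
case: (ex_maxnP exP bP) => n /asboolP[u [pu ua cu]] maxn.
exists u; split => // z uz za; apply/eqP; rewrite eqn_leq (mc u) // andbT cu.
apply: maxn; apply/asboolP; exists z; split => //.
by apply: lt_le_trans pu _; rewrite lee_fin.
Qed.

Lemma colour_above (c : R -> nat) (a p : \bar R) :
  (forall x y, x <= y -> (c x <= c y)%N) -> (a < p)%E ->
  exists u : R, [/\ (a < u%:E)%E, (u%:E < p)%E & forall z, (a < z%:E)%E -> z <= u -> c z = c u].
Proof.
move=> mc pa.
pose P n := `[< exists x : R, [/\ (a < x%:E)%E, (x%:E < p)%E & c x = n] >].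
have exP : exists n, P n.
  by have [x /andP[h1 h2]] := ereal_between pa; exists (c x); apply/asboolP; exists x.
case: (ex_minnP exP) => n /asboolP[u [pu ua cu]] minn.
exists u; split => // z uz za; apply/eqP; rewrite eqn_leq (mc z u) //= cu.
apply: minn; apply/asboolP; exists z; split => //.
by apply: le_lt_trans ua; rewrite lee_fin.
Qed.

Lemma upset_ray A l : upset A -> A l ->
  exists a : \bar R,
    (A = lray (BRight a) /\ (a = -oo%E \/ exists r, a = r%:E)) \/
    (exists r, a = r%:E /\ A = lray (BLeft a)).
Proof.
move=> uA Al; case: (pselect (has_lbound A)) => [lbA|nlb].
  have iA : has_inf A by split => //; exists l.
  exists (inf A)%:E.
  have inA x : A x -> inf A <= x by move=> Ax; apply: ge_inf.
  have Ain x : inf A < x -> A x.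
    move=> ix; have [y Ay yx] := @inf_adherent _ A (x - inf A) ltac:(lra) iA.
    by apply: uA Ay _; lra.
  case: (pselect (A (inf A))) => [Ai|nAi]; [right|left].
    exists (inf A); split => //; apply/seteqP; split=> x; rewrite lrayL lee_fin.
      exact: inA.
    by move=> ix; apply: uA Ai ix.
  split; last by right; exists (inf A).
  apply/seteqP; split=> x; rewrite lrayR lte_fin; last exact: Ain.
  move=> Ax; rewrite lt_neqAle inA // andbT; apply/eqP => e; apply: nAi.
  by rewrite e.
exists -oo%E; left; split; last by left.
apply/seteqP; split=> x; first by rewrite lrayR ltNyr.
move=> _; apply: contrapT => nAx; apply: nlb; exists x => y Ay.
by rewrite leNgt; apply/negP => yx; apply: nAx; apply: uA Ay (ltW yx).
Qed.

Variable Q : quiver R.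

Definition left_fam A := upset A /\ bounded_below Q A.
Definition right_fam B := downset B /\ bounded_above Q B.

Lemma bounded_below_ray x : bounded_below Q (lray (BLeft x%:E)).
Proof.
by have [n [hn nx]] := index_below Q x; exists n => // y; rewrite lrayL; apply: le_trans.
Qed.

(** Just to the left of [a] the order is the usual one. The ray is enlarged to start at the midpoint
    [v] of [u] and [a]; the point [u] stays outside, lies below the added piece and has its colour,
    so a map into the representation vanishes on that piece. *)
Lemma bad_closed_end (c : R -> nat) N (a l : R) B n :
  (forall x y, x <= y -> (c x <= c y)%N) -> (forall x, (c x <= N)%N) ->
  downset B -> B l -> a <= l -> has_pt Q n -> has_pt Q (n + 1) ->
  (pt Q n < a%:E <= pt Q (n + 1))%E -> even_idx n ->
  bad_end Q c left_fam (lray (BLeft a%:E)) B.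
Proof.
move=> mc bc dB Bl al h0 h1 /andP[na an] en.
have [u [nu ua cu]] := colour_below mc bc na.
have seg z : u <= z -> z <= a -> (pt Q n <= z%:E <= pt Q (n + 1))%E.
  move=> uz za; rewrite (le_trans (ltW nu)) ?lee_fin //.
  by rewrite (le_trans _ an) ?lee_fin.
pose v := (u + a) / 2; have uv : u < v by rewrite /v; lra.
have va : v < a by rewrite /v; lra.
have D d : ~ (lray (BLeft a%:E) d <-> lray (BLeft v%:E) d) -> v <= d /\ d < a.
  rewrite !lrayL !lee_fin => H; split.
    by rewrite leNgt; apply/negP => dv; apply: H; rewrite !leNgt dv (lt_trans dv va).
  by rewrite ltNge; apply/negP => dv; apply: H; rewrite dv (le_trans (ltW va) dv).
exists (lray (BLeft v%:E)); split.
- by split; [apply: lray_upset|apply: bounded_below_ray].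
- move=> x y yx; rewrite !lrayL !lee_fin => vx ay; split=> _; last by lra.
  rewrite leNgt; apply/negP => xa.
  have xn : (pt Q n < x%:E < pt Q (n + 1))%E.
    rewrite (lt_le_trans nu) ?lee_fin; last lra.
    by rewrite (lt_le_trans _ an) ?lte_fin.
  by have := (open_even y h0 h1 xn en).1 yx; lra.
- exists l; rewrite !lrayL !lee_fin; split => //; lra.
- split; last by move=> d /D[_ da]; apply: dB Bl _; lra.
  exists v; rewrite !lrayL !lee_fin lexx => -[_ /(_ isT)]; lra.
left; split=> [x|d]; rewrite !lrayL !lee_fin; first by lra.
move=> vd /negP; rewrite -ltNge => da.
have c1 := cu d ltac:(lra) da.
exists u; rewrite lrayL lee_fin; split; [|lra|by []].
apply/(qle_segment h0 h1); rewrite ?en; try apply: seg; lra.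
Qed.

(** Just to the right of [a] the order is reversed. The ray is cut back to start at [u]; every
    removed point maps isomorphically to [u], so maps extend back from [u]. *)
Lemma bad_open_end (c : R -> nat) (a : \bar R) (l : R) B n :
  (forall x y, x <= y -> (c x <= c y)%N) ->
  downset B -> B l -> (a < l%:E)%E -> has_pt Q n -> has_pt Q (n + 1) ->
  (pt Q n <= a)%E -> (a < pt Q (n + 1))%E -> ~~ even_idx n ->
  bad_end Q c left_fam (lray (BRight a)) B.
Proof.
move=> mc dB Bl al h0 h1 na an en.
(* Keeping [u] below [l] places the removed piece in [B]; keeping it below the next indexed point
   places it in one segment. *)
have am : (a < mine l%:E (pt Q (n + 1)))%E by rewrite lt_min al an.
have [u [au + cu]] := colour_above mc am.
rewrite lt_min lte_fin => /andP[ul un].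
have Bu : B u by apply: dB Bl _; lra.
have seg z : (a < z%:E)%E -> z <= u -> (pt Q n < z%:E < pt Q (n + 1))%E.
  by move=> az zu; rewrite (le_lt_trans na az) (le_lt_trans _ un) ?lee_fin.
exists (lray (BLeft u%:E)); split.
- by split; [apply: lray_upset|apply: bounded_below_ray].
- move=> x y yx; rewrite !lrayL lrayR !lee_fin => ux ay; split=> _.
    by apply: lt_le_trans au _; rewrite lee_fin.
  rewrite leNgt; apply/negP => yu.
  by have := (open_odd x h0 h1 (seg y ay (ltW yu)) en).2 yx; lra.
- by exists l; rewrite lrayL lrayR lee_fin ltW.
- have [w /andP[aw]] := ereal_between au; rewrite lte_fin => wu; split.
    exists w; rewrite lrayL lrayR lee_fin aw => -[/(_ isT)]; lra.
  move=> d; rewrite lrayL lrayR lee_fin => H.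
  apply: dB Bu _; rewrite leNgt; apply/negP => ud; apply: H.
  by rewrite (ltW ud) (lt_trans au) ?lte_fin.
right; split=> [x|].
  by rewrite lrayL lrayR lee_fin => ux; apply: lt_le_trans au _; rewrite lee_fin.
exists u; rewrite lrayL lee_fin lexx; split => // d; rewrite lrayL lrayR lee_fin.
move=> ad /negP; rewrite -ltNge => du.
have sd := seg _ ad (ltW du); have su := seg u au (lexx _).
have w x : (pt Q n < x%:E < pt Q (n + 1))%E -> (pt Q n <= x%:E <= pt Q (n + 1))%E.
  by move=> /andP[? ?]; rewrite !ltW.
split.
- by apply/(qle_segment h0 h1 (w _ sd) (w _ su)); rewrite (negPf en) ltW.
- by rewrite (cu d) // ltW.
move=> y yd; have dy := (open_odd y h0 h1 sd en).1 yd.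
case: (ltP y u) => [yu|uy]; [left|right].
  rewrite lrayR lrayL lee_fin; split; last lra.
  by apply: lt_le_trans ad _; rewrite lee_fin.
apply/(qle_segment h0 h1 (w _ su)); rewrite ?(negPf en) //.
by apply: (open_segment h0 h1 sd); left.
Qed.

Lemma has_pt_pred n r : has_pt Q n -> pt Q n = r%:E -> has_pt Q (n - 1).
Proof.
move=> hn e; have [m [hm le]] := index_below Q (r - 1).
have mn : (pt Q m < pt Q n)%E by apply: le_lt_trans le _; rewrite e lte_fin; lra.
by move: mn; rewrite pt_ltE // => mn; apply: (has_pt_convex hm hn); lia.
Qed.

Lemma not_ext_set n a : has_pt Q n -> has_pt Q (n + 1) ->
  (pt Q n < a%:E < pt Q (n + 1))%E -> ~ ext_set (qset Q) a%:E.
Proof.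
move=> h0 h1 /andP[na an]; apply/ext_setP => m hm e.
by move: na an; rewrite -e !pt_ltE //; lia.
Qed.

(** An open end is listed when the segment to its right starts at a sink, a closed one when the
    segment to its left ends at a sink. If the end is itself that sink, the neighbouring source
    enters and ends 3 and 4 arise. *)
Lemma left_end_cases (c : R -> nat) N A l :
  (forall x y, x <= y -> (c x <= c y)%N) -> (forall x, (c x <= N)%N) ->
  left_fam A -> A l ->
  (forall B, downset B -> B l -> bad_end Q c left_fam A B) \/
  exists lI lL t, left_end Q lI lL t /\ A = lray lL.
Proof.
move=> mc bc [uA [n0 hn0 bA]] Al.
have [a [[eA [ea|[r er]]]|[r [er eA]]]] := upset_ray uA Al.
(* On the whole line the bound forces [-oo] to have an integer index. As open and closed brackets
   agree there, a sink at [-oo] is an instance of [left_end4]. *)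
- have pn0 : pt Q n0 = -oo%E.
    case: (pt Q n0) bA => [s| |] // bA; last by have := bA l Al.
    have : A (s - 1) by rewrite eA ea lrayR ltNyr.
    by move=> /bA; rewrite lee_fin leNgt ltrBlDr ltrDl ltr01.
  have [m [m0 m1 /andP[ml lm]]] := segment_right Q l.
  have h1 : has_pt Q (n0 + 1).
    have : (pt Q n0 < pt Q (m + 1))%E by rewrite pn0; apply: le_lt_trans lm; rewrite leNye.
    by rewrite pt_ltE // => lt; apply: (has_pt_convex hn0 m1); lia.
  case: (even_idx_cases n0) => -[en [p ep]].
    right; exists (BRight (pt Q (2 * p + 1))), (BLeft (pt Q (2 * p))), (pt Q (2 * p + 1)).
    split; first by apply: left_end4; rewrite -ep.
    by rewrite eA ea -ep pn0; apply/seteqP; split=> x _; rewrite ?lrayL ?lrayR ?leNye ?ltNyr.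
  left=> B dB Bl; rewrite eA; apply: (bad_open_end mc dB Bl _ hn0 h1 _ _ en).
  + by rewrite ea ltNyr.
  + by rewrite pn0 ea.
  + by rewrite ea -pn0; apply: pt_lt => //; lia.
- have [n [h0 h1 /andP[nr rn]]] := segment_right Q r.
  case: (even_idx_cases n) => -[en [p ep]]; last first.
    left=> B dB Bl; rewrite eA er; apply: (bad_open_end mc dB Bl _ h0 h1 nr rn en).
    by move: Al; rewrite eA er lrayR.
  right; move: nr; rewrite le_eqVlt => /orP[/eqP e|nr].
    have h2 := has_pt_pred h0 e; subst n.
    exists (BLeft (pt Q (2 * p - 1))), (BRight (pt Q (2 * p))), (pt Q (2 * p)).
    by split; [apply: left_end3|rewrite eA er e].
  exists (BLeft r%:E), (BRight r%:E), r%:E; split; last by rewrite eA er.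
  have nrn : (pt Q n < r%:E < pt Q (n + 1))%E by rewrite nr rn.
  apply: left_end1; first exact: not_ext_set h0 h1 nrn.
  by exists (pt Q n) => //; exists n; rewrite en.
have [n [h0 h1 /andP[nr rn]]] := segment_left Q r.
case: (even_idx_cases n) => -[en [p ep]].
  left=> B dB Bl; rewrite eA er; apply: (bad_closed_end mc bc dB Bl _ h0 h1 _ en).
    by move: Al; rewrite eA er lrayL lee_fin.
  by rewrite nr.
right; move: rn; rewrite le_eqVlt => /orP[/eqP e|rn].
  have [m [m0 m1 /andP[mr rm]]] := segment_right Q r.
  have h2 : has_pt Q (n + 1 + 1).
    by move: rm; rewrite e pt_ltE // => ?; apply: (has_pt_convex h1 m1); lia.
  have e2 : n + 1 = 2 * (p + 1) by lia.
  rewrite e2 in e h1 h2 *.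
  exists (BRight (pt Q (2 * (p + 1) + 1))), (BLeft (pt Q (2 * (p + 1)))), (pt Q (2 * (p + 1) + 1)).
  by split; [apply: left_end4|rewrite eA er e].
exists (BRight r%:E), (BLeft r%:E), r%:E; split; last by rewrite eA er.
have nrn : (pt Q n < r%:E < pt Q (n + 1))%E by rewrite nr rn.
apply: left_end2; first exact: not_ext_set h0 h1 nrn.
by exists (pt Q (n + 1)) => //; exists n; rewrite (negPf en).
Qed.

End Classification.

(** * Right ends by reflection, and the projective exceptions *)

Section RightEnds.
Variables (R : realType) (Q : quiver R).
Implicit Types (x y z : R) (A B : set R) (n m : int).

(** Flipping the side keeps closed ends closed: [BLeft] is the closed side at a left end, [BRight]
    at a right end. *)
Definition opp_bnd (b : itv_bound (\bar R)) : itv_bound (\bar R) :=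
  match b with BSide s p => BSide (~~ s) (- p)%E | BInfty s => BInfty _ (~~ s) end.

Lemma opp_bndK : involutive opp_bnd.
Proof. by case=> [s p|s] /=; rewrite negbK ?oppeK. Qed.

Lemma rray_opp b : rray (opp_bnd b) = refl_set (lray b).
Proof.
apply/funext => x; apply/propext; case: b => [[] p|[]];
  rewrite /rray /lray /refl_set /= ?bnd_simp //.
- by rewrite EFinN leeNr.
- by rewrite EFinN lteNr.
Qed.

Lemma lray_opp b : lray (opp_bnd b) = refl_set (rray b).
Proof. by rewrite -[in RHS](opp_bndK b) rray_opp refl_setK. Qed.

Lemma ext_set_fin (S : set R) x : ext_set S x%:E <-> S x.
Proof. by split=> [[[y Sy [<-]] //|[]//]|Sx]; left; exists x. Qed.

Lemma near_sink_opp x t : is_near_sink (opp_quiver Q) x t <-> is_near_sink Q (- x) (- t)%E.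
Proof.
split=> -[n [h0 h1 /andP[nx xn] e]]; exists (- (n + 1)).
  have e1 : - (n + 1) + 1 = - n by lia.
  move: h0 h1 nx xn; rewrite !has_pt_opp !pt_opp e1 => h0 h1 nx xn; split => //.
    by rewrite EFinN -[X in X && _]lteN2 -[X in _ && X]lteN2 !oppeK xn nx.
  by rewrite e even_idxN even_idxD1 !pt_opp; case: even_idx => /=; rewrite oppeK.
have e1 : - (- (n + 1)) = n + 1 by lia.
have e2 : - (- (n + 1) + 1) = n by lia.
rewrite !has_pt_opp !pt_opp e1 e2; split => //.
  by rewrite -[X in X && _]lteN2 -[X in _ && X]lteN2 !oppeK -EFinN xn nx.
by rewrite -[t]oppeK e even_idxN even_idxD1; case: even_idx.
Qed.

Lemma sink_left_opp x : sink_left (opp_quiver Q) x <-> sink_right Q (- x).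
Proof.
split=> -[t ht lt]; exists (- t)%E.
- exact/near_sink_opp.
- by rewrite EFinN lteN2.
- by apply/near_sink_opp; rewrite oppeK.
- by rewrite -[x%:E]oppeK lteN2 -EFinN.
Qed.

Lemma sink_right_opp x : sink_right (opp_quiver Q) x <-> sink_left Q (- x).
Proof.
split=> -[t ht lt]; exists (- t)%E.
- exact/near_sink_opp.
- by rewrite EFinN lteN2.
- by apply/near_sink_opp; rewrite oppeK.
- by rewrite -[x%:E]oppeK lteN2 -EFinN.
Qed.

Lemma right_end_opp lI lL l : left_end (opp_quiver Q) lI lL l ->
  right_end Q (opp_bnd lI) (opp_bnd lL) (- l)%E.
Proof.
case=> [a ea /sink_left_opp h|a ea /sink_right_opp h|n|n]; rewrite /opp_bnd ?negbK.
- by apply: right_end2 => // /ext_set_fin e; apply/ea/ext_set_fin.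
- by apply: right_end1 => // /ext_set_fin e; apply/ea/ext_set_fin.
- rewrite !has_pt_opp !pt_opp !oppeK.
  have -> : - (2 * n - 1) = 2 * (- n) + 1 by lia.
  have -> : - (2 * n) = 2 * (- n) by lia.
  by move=> *; apply: right_end3.
- rewrite !has_pt_opp !pt_opp !oppeK.
  have -> : - (2 * n + 1) = 2 * (- n) - 1 by lia.
  have -> : - (2 * n) = 2 * (- n) by lia.
  by move=> *; apply: right_end4.
Qed.

Lemma left_end_opp rI rL r : right_end Q rI rL r ->
  left_end (opp_quiver Q) (opp_bnd rI) (opp_bnd rL) (- r)%E.
Proof.
case=> [a ea h|a ea h|n h0 h1|n h0 h1]; rewrite /opp_bnd.
- rewrite -EFinN; apply: left_end2.
    by move=> /ext_set_fin; rewrite /= opprK => e; apply/ea/ext_set_fin.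
  by apply/sink_right_opp; rewrite opprK.
- rewrite -EFinN; apply: left_end1.
    by move=> /ext_set_fin; rewrite /= opprK => e; apply/ea/ext_set_fin.
  by apply/sink_left_opp; rewrite opprK.
- have := @left_end3 _ (opp_quiver Q) (- n); rewrite !has_pt_opp !pt_opp.
  have -> : - (2 * (- n) - 1) = 2 * n + 1 by lia.
  have -> : - (2 * (- n)) = 2 * n by lia.
  exact.
- have := @left_end4 _ (opp_quiver Q) (- n); rewrite !has_pt_opp !pt_opp.
  have -> : - (2 * (- n) + 1) = 2 * n - 1 by lia.
  have -> : - (2 * (- n)) = 2 * n by lia.
  exact.
Qed.

Lemma almost_split_opp B B' : almost_split_step (opp_quiver Q) (@upset R) (refl_set B) (refl_set B') ->
  almost_split_step Q (@downset R) B B'.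
Proof.
move=> [/hom_ok_opp h1 h2]; split => // C dC hC [x neq].
have [||/hom_ok_opp h3 h4] := h2 (refl_set C) (downset_refl dC).
- exact/hom_ok_opp.
- by exists (- x); rewrite /refl_set /= opprK.
split => // y By Cy; have := h4 (- y); rewrite /refl_set /= opprK; exact.
Qed.

Lemma right_end_step rI rL r : right_end Q rI rL r ->
  almost_split_step Q (@downset R) (rray rI) (rray rL).
Proof.
by move=> /left_end_opp/left_end_step; rewrite !lray_opp => /almost_split_opp.
Qed.

Lemma bounded_opp B : bounded_below (opp_quiver Q) (refl_set B) -> bounded_above Q B.
Proof.
move=> [n hn h]; exists (- n) => // x Bx; have := h (- x).
by rewrite pt_opp EFinN leeN2 /refl_set /= opprK; apply.
Qed.

Lemma bounded_opp_inv B : bounded_above Q B -> bounded_below (opp_quiver Q) (refl_set B).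
Proof.
move=> [n hn h]; exists (- n); first by rewrite has_pt_opp opprK.
by move=> x /h; rewrite pt_opp opprK EFinN leeNl.
Qed.

Lemma right_end_bounds rI rL r : right_end Q rI rL r ->
  [/\ (exists d, ~ (rray rI d <-> rray rL d)),
      (forall d, ~ (rray rI d <-> rray rL d) -> (r <= d%:E)%E),
      (forall z, (z%:E < r)%E -> rray rI z /\ rray rL z),
      bounded_above Q (rray rI) & bounded_above Q (rray rL)].
Proof.
move=> /left_end_opp/left_end_bounds; rewrite !lray_opp => -[[d hd] h2 h3 /bounded_opp h4 /bounded_opp h5].
split => //; first by exists (- d).
- move=> x hx; have := h2 (- x); rewrite /refl_set /= opprK EFinN leeN2; exact.
- move=> x hx; have := h3 (- x); rewrite /refl_set /= opprK EFinN lteN2; exact.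
Qed.

(** The reflected colouring is subtracted from [N] to be increasing again. Since [c] is bounded by
    [N], truncated subtraction is injective here, and equalities of colours can be carried back. *)
Lemma bad_end_opp (c : R -> nat) N A B : (forall x, (c x <= N)%N) ->
  bad_end (opp_quiver Q) (fun x => N - c (- x))%N (left_fam (opp_quiver Q))
    (refl_set A) (refl_set B) ->
  bad_end Q c (right_fam Q) A B.
Proof.
move=> bc [A2 [[uA2 bA2] hA2 [l [l1 l2 l3]] [[d nd] hd] H]].
have eA2 : A2 = refl_set (refl_set A2) by rewrite refl_setK.
exists (refl_set A2); split.
- by split; [apply: upset_refl|apply: bounded_opp; rewrite refl_setK].
- by apply/hom_ok_opp; rewrite refl_setK.
- by exists (- l); rewrite /refl_set /= opprK.
- split; first by exists (- d); rewrite /refl_set /= opprK.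
  by move=> x nx; have := hd (- x); rewrite /refl_set /= opprK; apply.
case: H => -[sub H]; [left|right]; split.
- by move=> x Ax; apply: sub; rewrite /refl_set /= opprK.
- move=> x A2x nAx; have [|y [yx nA2y cy]] := H (- x) A2x.
    by rewrite /refl_set /= opprK.
  exists (- y); split.
  + by move/qle_opp: yx; rewrite opprK.
  + by rewrite /refl_set /= opprK.
  + by move: cy; rewrite opprK; have := bc x; have := bc (- y); lia.
- by move=> x A2x; have := sub _ A2x; rewrite /refl_set /= opprK.
have [x [A2x Bx Hx]] := H; exists (- x); split.
- by rewrite /refl_set /= opprK.
- exact: Bx.
move=> e Ae nA2e; have [||h1 h2 h3] := Hx (- e).
- by rewrite /refl_set /= opprK.
- exact: nA2e.
split.
- by move/qle_opp: h1; rewrite opprK.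
- by move: h2; rewrite opprK; have := bc e; have := bc (- x); lia.
move=> y ye; case: (h3 (- y)).
- by apply/qle_opp; rewrite !opprK.
- by rewrite /refl_set /= opprK => -[? ?]; left.
- by move/qle_opp; rewrite opprK; right.
Qed.

Lemma right_end_cases (c : R -> nat) N B l :
  (forall x y, x <= y -> (c x <= c y)%N) -> (forall x, (c x <= N)%N) ->
  right_fam Q B -> B l ->
  (forall A, upset A -> A l -> bad_end Q c (right_fam Q) B A) \/
  exists rI rL t, right_end Q rI rL t /\ B = rray rL.
Proof.
move=> mc bc [dB bB] Bl.
have [||||H|[lI [lL [t [le e]]]]] := @left_end_cases R (opp_quiver Q)
  (fun x => N - c (- x))%N N (refl_set B) (- l).
- by move=> x y xy; apply: leq_sub2l; apply: mc; rewrite lerN2.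
- by move=> x; apply: leq_subr.
- by split; [apply: downset_refl|apply: bounded_opp_inv].
- by rewrite /refl_set /= opprK.
- left=> A uA Al; apply: (bad_end_opp bc); apply: H; first exact: upset_refl.
  by rewrite /refl_set /= opprK.
right; exists (opp_bnd lI), (opp_bnd lL), (- t)%E; split; first exact: right_end_opp.
by rewrite rray_opp -e refl_setK.
Qed.

Lemma rrayL p x : rray (BLeft p) x = (x%:E < p)%E :> Prop.
Proof. by rewrite /rray /= bnd_simp. Qed.

Lemma rrayR p x : rray (BRight p) x = (x%:E <= p)%E :> Prop.
Proof. by rewrite /rray /= bnd_simp. Qed.

Lemma open_segment_eq n m x : has_pt Q n -> has_pt Q (n + 1) ->
  has_pt Q m -> has_pt Q (m + 1) ->
  (pt Q n < x%:E < pt Q (n + 1))%E -> (pt Q m <= x%:E <= pt Q (m + 1))%E -> m = n.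
Proof.
move=> h0 h1 h2 h3 /andP[a b] /andP[c d].
by move: (lt_le_trans a d) (le_lt_trans c b); rewrite !pt_ltE //; lia.
Qed.

(* The exceptional pairs of ends are those of the projectives P_c. *)
Lemma ends_projective lI lL l rI rL r z : left_end Q lI lL l -> right_end Q rI rL r ->
  lray lL z -> rray rL z -> ~ (l < r)%E ->
  exists c, forall x, lray lL x /\ rray rL x <-> qle Q x c.
Proof.
move=> hl hr + + /negP; rewrite -leNgt.
have absurd (p : \bar R) : (p <= z%:E)%E -> (z%:E < p)%E -> False.
  by move=> a b; have := le_lt_trans a b; rewrite ltxx.
have absurd' (p : \bar R) : (p < z%:E)%E -> (z%:E <= p)%E -> False.
  by move=> a b; have := lt_le_trans a b; rewrite ltxx.
(* Of the sixteen pairs only three survive: end 2 with end 4, end 4 with end 1, and end 4 with end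
   4. In the others the point [z], the parity of a segment or the order of the indices gives a
   contradiction. *)
case: hl => [a _ /sink_leftP[k [k0 k1 ka ek]]|a _ /sink_rightP[k [k0 k1 ka ek]]|n h0 h1|n h0 h1];
case: hr => [b _ /sink_leftP[j [j0 j1 jb ej]]|b _ /sink_rightP[j [j0 j1 jb ej]]|m h2 h3|m h2 h3];
rewrite ?lrayL ?lrayR ?rrayL ?rrayR => lz zr rl.
- by case: (absurd' _ lz (le_trans zr rl)).
- by case: (absurd' _ lz (le_trans (ltW zr) rl)).
- by case: (absurd' _ lz (le_trans (ltW zr) rl)).
- have h4 : has_pt Q (2 * m - 1 + 1) by rewrite subrK.
  have e := open_segment_eq k0 k1 h2 h4 ka.
  move: ek; rewrite -e ?even_pred // subrK rl /=.
  exact: le_trans (ltW lz) zr.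
- have ab : a = b.
    by apply/le_anti; rewrite -!lee_fin rl (le_trans lz zr).
  subst b; have e := open_segment_eq k0 k1 j0 j1 ka.
  by move: ek; rewrite -e ?ej //; case/andP: jb => ? ?; rewrite !ltW.
- by case: (absurd _ lz (lt_le_trans zr rl)).
- by case: (absurd _ lz (lt_le_trans zr rl)).
- have h4 : has_pt Q (2 * m - 1 + 1) by rewrite subrK.
  have e : 2 * m - 1 = k.
    by apply: (open_segment_eq k0 k1 h2 h4 ka); rewrite subrK rl (le_trans lz zr).
  have ka' : (pt Q k <= a%:E <= pt Q (k + 1))%E by case/andP: ka => ? ?; rewrite !ltW.
  have e2 : k + 1 = 2 * m by lia.
  exists a => x; rewrite lrayL rrayR -e2; split.
    move=> [ax xm]; apply/(qle_segment k0 k1 ka'); rewrite ?(negPf ek) -?lee_fin //.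
    by rewrite xm andbT; case/andP: ka' => ? _; apply: le_trans ax.
  move=> xa; rewrite lee_fin; split; first by apply: (open_odd x k0 k1 ka ek).1.
  by have /andP[] := open_segment k0 k1 ka (or_introl xa).
- by case: (absurd' _ lz (le_trans zr rl)).
- by case: (absurd' _ lz (le_trans (ltW zr) rl)).
- by case: (absurd' _ lz (le_trans (ltW zr) rl)).
- by move: (lt_le_trans lz zr) rl; rewrite pt_ltE // pt_leE //; lia.
- have e : 2 * n = j.
    by apply: (open_segment_eq j0 j1 h0 h1 jb); rewrite rl (le_trans lz zr).
  subst j; have jb' : (pt Q (2 * n) <= b%:E <= pt Q (2 * n + 1))%E by case/andP: jb => ? ?; rewrite !ltW.
  exists b => x; rewrite lrayL rrayR; split.
    move=> [nx xb]; apply/(qle_segment j0 j1 jb'); rewrite ?ej -?lee_fin //.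
    by rewrite nx; case/andP: jb' => _; apply: le_trans.
  move=> xb; rewrite lee_fin; split; last by apply: (open_even x j0 j1 jb ej).1.
  by have /andP[] := open_segment j0 j1 jb (or_introl xb).
- have e : 2 * n = j.
    by apply: (open_segment_eq j0 j1 h0 h1 jb); rewrite rl (le_trans lz (ltW zr)).
  by move: ej; rewrite -e even_idx_double.
- by move: (le_lt_trans lz zr) rl; rewrite pt_ltE // pt_leE //; lia.
have nm : (pt Q (2 * n) <= pt Q (2 * m))%E := le_trans lz zr.
move: (nm) (rl); rewrite !pt_leE // => nm' mn'.
(* Either the support is a single sink, or it lies between two successive sinks and is generated by
   the source between them. *)
have [e|e] : m = n \/ m = n + 1 by lia.
  subst m; have ez : pt Q (2 * n) = z%:E by apply/le_anti; rewrite lz zr.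
  exists z => x; rewrite lrayL rrayR ez; split.
    by move=> /andP/le_anti[->]; apply: qle_refl.
  by move=> /(sink_min h0 (even_idx_double n) ez) ->.
subst m; have e1 : 2 * (n + 1) = 2 * n + 1 + 1 by lia.
rewrite e1 in h3 zr *.
have lt1 := pt_lt h0 h1 ltac:(lia); have lt2 := pt_lt h1 h3 ltac:(lia).
have [s es] : exists s, pt Q (2 * n + 1) = s%:E.
  case: (pt Q (2 * n + 1)) lt1 lt2 => [s| |] //; first by exists s.
    by move=> _; rewrite ltNge leey.
  by rewrite ltNge leNye.
have s1 : (pt Q (2 * n) <= s%:E <= pt Q (2 * n + 1))%E by rewrite -es lexx ltW.
have s2 : (pt Q (2 * n + 1) <= s%:E <= pt Q (2 * n + 1 + 1))%E by rewrite -es lexx ltW.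
exists s => x; rewrite lrayL rrayR; split=> [[nx xn]|].
  case: (leP x s) => xs.
    apply/(qle_segment h0 h1 s1); rewrite ?even_idx_double //.
    by rewrite nx es lee_fin.
  apply/(qle_segment h1 h3 s2); last by rewrite even_succ ltW.
  by rewrite xn es lee_fin ltW.
move=> [m [m0 m1 ms /andP[mx xm] _]].
case: (pt_cases h1 es m0 m1 ms) => e; last first.
  have e' : m = 2 * n := addIr 1 e.
  by move: mx xm; rewrite e' => -> xm; rewrite (le_trans xm (ltW lt2)).
by move: mx xm; rewrite e => mx ->; rewrite (le_trans (ltW lt1) mx).
Qed.

End RightEnds.

(** * Projective covers of intervals *)

Section Covers.
Variables (R : realType).
Implicit Types (Q : quiver R) (x y z t : R) (A B K P : set R) (n m : int).

Definition convex_set K := forall x y z, K x -> K z -> x <= y -> y <= z -> K y.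

Definition supp (I : interval (\bar R)) : set R := [set x | x%:E \in I].

Lemma suppE l r : supp (Interval l r) = lray l `&` rray r.
Proof.
apply/funext => x; apply/propext; rewrite /supp /= itv_boundlr.
by split=> [/andP[]|[? ?]] //; apply/andP.
Qed.

Lemma supp_convex I : convex_set (supp I).
Proof. by move=> x y z Ix Iz xy yz; apply: itv_mid xy yz Ix Iz. Qed.

Lemma upset_lray A : upset A -> exists l, A = lray l.
Proof.
move=> uA; case: (pselect (exists l, A l)) => [[l Al]|nA].
  have [a [[e _]|[r [_ e]]]] := upset_ray uA Al; first by exists (BRight a).
  by exists (BLeft a).
exists +oo%O; apply/seteqP; split=> x // Ax; exfalso; apply: nA; by exists x.
Qed.

Lemma downset_rray B : downset B -> exists r, B = rray r.
Proof.
move=> dB; have [l e] := upset_lray (downset_refl dB).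
by exists (opp_bnd l); rewrite rray_opp -e refl_setK.
Qed.

Definition up_closure K : set R := [set x | exists2 y, K y & y <= x].
Definition down_closure K : set R := [set x | exists2 y, K y & x <= y].

Lemma up_closure_upset K : upset (up_closure K).
Proof. by move=> x y [z Kz zx] xy; exists z => //; apply: le_trans zx xy. Qed.

Lemma down_closure_downset K : downset (down_closure K).
Proof. by move=> x y [z Kz zx] xy; exists z => //; apply: le_trans xy zx. Qed.

Lemma convex_closures K : convex_set K -> K = up_closure K `&` down_closure K.
Proof.
move=> cK; apply/seteqP; split=> x.
  by move=> Kx; split; exists x.
by move=> [[y Ky yx] [z Kz xz]]; apply: cK Ky Kz yx xz.
Qed.

Lemma convex_supp K : convex_set K -> exists I, supp I = K.
Proof.
move=> cK; have [l el] := upset_lray (@up_closure_upset K).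
have [r er] := downset_rray (@down_closure_downset K).
by exists (Interval l r); rewrite suppE -el -er -convex_closures.
Qed.

Lemma rays_convex A B : upset A -> downset B -> convex_set (A `&` B).
Proof.
by move=> uA dB x y z [Ax _] [_ Bz] xy yz; split; [apply: uA Ax xy|apply: dB Bz yz].
Qed.

(** If [y] is inside a segment, all three points lie in that segment. If [y] is a sink or a source,
    one of the two relations is an equality. *)
Lemma qle_trans Q x y z : qle Q y x -> qle Q z y -> qle Q z x.
Proof.
move=> yx zy; have [n [h0 h1 xn yn e]] := yx.
have [e'|neq] := eqVneq y x; first by rewrite -e'.
have endpt m : has_pt Q m -> pt Q m = y%:E -> qle Q z x.
  move=> hm em; case: (boolP (even_idx m)) => om.
    by rewrite (sink_min hm om em zy).
  by rewrite (source_max hm om em yx) eqxx in neq.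
case/andP: (yn); rewrite le_eqVlt => /orP[/eqP en _|ny]; first exact: endpt en.
rewrite le_eqVlt => /orP[/eqP/esym|yn1]; first exact: endpt.
have nyn : (pt Q n < y%:E < pt Q (n + 1))%E by rewrite ny yn1.
have zn := open_segment h0 h1 nyn (or_introl zy).
apply/(qle_segment h0 h1 xn zn).
by move: (qle_segment h0 h1 yn zn).1 e => /(_ zy); case: even_idx; lra.
Qed.

Lemma hom_ok_principal Q K t : convex_set K -> K t -> hom_ok Q [set x | qle Q x t] K.
Proof.
move=> cK Kt x y yx /= xt Ky; split=> _; last exact: qle_trans xt yx.
by case/orP: (qle_between xt yx) => /andP[h1 h2]; [apply: cK Kt Ky h1 h2|apply: cK Ky Kt h1 h2].
Qed.

Lemma principal_convex Q t : convex_set [set x | qle Q x t].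
Proof.
move=> x y z /= xt zt xy yz; case: (leP t y) => ty.
  by have [] := qle_conv zt (z := y) ltac:(lra).
by have [] := qle_conv xt (z := y) ltac:(lra).
Qed.

Lemma principal_support Q t : proj_support Q [set x | qle Q x t].
Proof.
by split; [exists t; apply: qle_refl|left; exists t; apply: Or31].
Qed.

(* [P] supports a projective with a map onto the part of M_K above [A]. *)
Definition covered Q K A : Prop :=
  exists P, [/\ proj_support Q P, convex_set P, hom_ok Q P K & forall x, K x -> A x -> P x].

(** The part of [K] in the segment is generated from its right end. A maximum [t] gives the
    projective of [t]; otherwise the right end is a supremum, which gives an open half of a
    projective, or it is [+oo], which is then a source of index [n + 1]. *)
Lemma covered_even Q K n : convex_set K -> has_pt Q n -> has_pt Q (n + 1) -> even_idx n ->
  (exists x, K x /\ (pt Q n <= x%:E <= pt Q (n + 1))%E) ->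
  covered Q K [set x | (pt Q n <= x%:E <= pt Q (n + 1))%E].
Proof.
move=> cK h0 h1 en [z [Kz zn]].
pose T := [set x | K x /\ (pt Q n <= x%:E <= pt Q (n + 1))%E].
case: (pselect (exists2 t, T t & forall x, T x -> x <= t)) => [[t [Kt tn] maxt]|nomax].
  exists [set x | qle Q x t]; split.
  - exact: principal_support.
  - exact: principal_convex.
  - exact: hom_ok_principal.
  by move=> x Kx xn; apply/(qle_segment h0 h1 tn xn); rewrite en maxt.
have nomax' x : T x -> exists2 y, T y & x < y.
  move=> Tx; apply: contrapT => H; apply: nomax; exists x => // y Ty.
  by rewrite leNgt; apply/negP => xy; apply: H; exists y.
suff [e [en1 He Te pe]] : exists e : \bar R, [/\ (e <= pt Q (n + 1))%E,
    (forall x, (x%:E < e)%E -> exists2 y, T y & x < y), (forall x, T x -> (x%:E < e)%E)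
    & proj_support Q [set x | (pt Q n <= x%:E)%E /\ (x%:E < e)%E]].
  exists [set x | (pt Q n <= x%:E)%E /\ (x%:E < e)%E]; split => //.
  - move=> x y w [nx _] [_ we] xy yw; split; first by apply: le_trans nx _; rewrite lee_fin.
    by apply: le_lt_trans we; rewrite lee_fin.
  - move=> x y yx [nx xe] Ky.
    have xn : (pt Q n <= x%:E <= pt Q (n + 1))%E by rewrite nx (le_trans (ltW xe)).
    have [yx' ny] : y <= x /\ (pt Q n <= y%:E)%E.
      move: nx; rewrite le_eqVlt => /orP[/eqP ex|nx].
        by rewrite (sink_min h0 en ex yx) ex lexx.
      have nxn : (pt Q n < x%:E < pt Q (n + 1))%E by rewrite nx (lt_le_trans xe).
      split; first exact: (open_even y h0 h1 nxn en).1.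
      by have /andP[] := open_segment h0 h1 nxn (or_introl yx).
    split=> _.
      by have [w [Kw _] xw] := He _ xe; apply: cK Ky Kw yx' (ltW xw).
    by split => //; apply: le_lt_trans xe; rewrite lee_fin.
  by move=> x Kx xn; split; [case/andP: xn|apply: Te].
case: (pselect (has_ubound T)) => [ubT|nub].
  have sT : has_sup T by split => //; exists z.
  have supT x : T x -> x <= sup T by move=> Tx; apply: ub_le_sup.
  have lt_supT x : T x -> x < sup T.
    by move=> /nomax'[y /supT ys xy]; apply: lt_le_trans xy ys.
  have adh x : x < sup T -> exists2 y, T y & x < y.
    move=> xs; have [y Ty yx] := @sup_adherent _ T (sup T - x) ltac:(lra) sT.
    by exists y => //; lra.
  have sn : ((sup T)%:E <= pt Q (n + 1))%E.
    rewrite leNgt; apply/negP => lt.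
    case E : (pt Q (n + 1)) lt => [p| |] //.
      rewrite lte_fin => /adh[y [_ /andP[_]]]; rewrite E lee_fin => yp py.
      by have := le_lt_trans yp py; rewrite ltxx.
    by case/andP: zn; rewrite E leNgt ltNyr.
  have ns : (pt Q n <= (sup T)%:E <= pt Q (n + 1))%E.
    rewrite sn andbT; case/andP: (zn) => nz _; apply: le_trans nz _.
    by rewrite lee_fin supT.
  exists (sup T)%:E; split => //.
  have e : [set x | (pt Q n <= x%:E)%E /\ (x%:E < (sup T)%:E)%E] =
           [set x | qle Q x (sup T) /\ x < sup T].
    apply/seteqP; split=> x /= [h2 h3]; rewrite ?lte_fin; split => //.
      apply/(qle_segment h0 h1 ns); last by rewrite en -lee_fin ltW.
      by rewrite h2 (le_trans _ sn) // ltW.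
    have [m [m0 m1 sm xm em]] := h2.
    case: (leP (pt Q n) x%:E) => // xn.
    have nm : (pt Q n < (sup T)%:E)%E.
      by case/andP: (zn) => nz _; apply: le_lt_trans nz _; rewrite lte_fin lt_supT.
    have [w ew] : exists w, pt Q n = w%:E by apply: pt_fin (ltW xn) (ltW nm).
    move: xn nm; rewrite ew !lte_fin => xw wt.
    have btw : (sup T <= w <= x) || (x <= w <= sup T) by rewrite (ltW xw) (ltW wt) orbT.
    by have := sink_min h0 en ew (qle_conv h2 btw).1 => e; move: xw; rewrite e ltxx.
  rewrite e; split; last by left; exists (sup T); apply: Or32.
  by rewrite -e; exists z; split; [case/andP: zn|rewrite lte_fin lt_supT].
have en1 : pt Q (n + 1) = +oo%E.
  case E : (pt Q (n + 1)) => [p| |] //.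
    by exfalso; apply: nub; exists p => x [_ /andP[_]]; rewrite E lee_fin.
  by case/andP: zn => _; rewrite E leNgt ltNyr.
exists +oo%E; split.
- by rewrite en1.
- move=> x _; apply: contrapT => H; apply: nub; exists x => y Ty.
  by rewrite leNgt; apply/negP => xy; apply: H; exists y.
- by move=> x _; rewrite ltry.
have e : [set x | (pt Q n <= x%:E)%E /\ (x%:E < +oo)%E] = [set x | (pt Q (n + 1 - 1) <= x%:E)%E].
  by rewrite addrK; apply/seteqP; split=> x /= => [[]//|->]; rewrite ltry.
rewrite e; split; first by exists z; rewrite /= addrK; case/andP: zn.
by right; right; exists (n + 1); rewrite even_idxD1 en.
Qed.

Lemma proj_support_opp Q P : proj_support (opp_quiver Q) (refl_set P) -> proj_support Q P.
Proof.
have E (A B : set R) : refl_set A = B -> A = refl_set B by move=> <-; rewrite refl_setK.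
move=> [[x Px] H]; split; first by exists (- x).
case: H => [[a H]|[[n [hn on en /E ->]]|[n [hn on en /E ->]]]].
- left; exists (- a); case: H => /E ->; [apply: Or31|apply: Or33|apply: Or32];
    apply/funext => y; apply/propext; rewrite /refl_set /mkset.
  + by rewrite qle_opp opprK.
  + by rewrite qle_opp opprK ltrNl.
  + by rewrite qle_opp opprK ltrNr.
- right; right; exists (- n); split.
  + by [].
  + by rewrite even_idxN.
  + by move: en; rewrite pt_opp => /(congr1 oppe); rewrite oppeK.
  + apply/funext => y; apply/propext; rewrite /refl_set /mkset pt_opp EFinN.
    by rewrite leeN2 opprD.
- right; left; exists (- n); split.
  + by [].
  + by rewrite even_idxN.
  + by move: en; rewrite pt_opp => /(congr1 oppe); rewrite oppeK.
  + apply/funext => y; apply/propext; rewrite /refl_set /mkset pt_opp EFinN.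
    by rewrite leeN2 opprD opprK.
Qed.

Lemma convex_refl K : convex_set K -> convex_set (refl_set K).
Proof.
by move=> cK x y z Kx Kz xy yz; apply: (cK _ _ _ Kz Kx); rewrite lerN2.
Qed.

Lemma covered_segment Q K n : convex_set K -> has_pt Q n -> has_pt Q (n + 1) ->
  (exists x, K x /\ (pt Q n <= x%:E <= pt Q (n + 1))%E) ->
  covered Q K [set x | (pt Q n <= x%:E <= pt Q (n + 1))%E].
Proof.
move=> cK h0 h1 [z [Kz /andP[nz zn]]]; case: (boolP (even_idx n)) => en.
  by apply: covered_even => //; exists z; rewrite nz zn.
have e1 : - (n + 1) + 1 = - n by lia.
have sw x : (pt (opp_quiver Q) (- (n + 1)) <= x%:E <= pt (opp_quiver Q) (- (n + 1) + 1))%E =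
    (pt Q n <= (- x)%:E <= pt Q (n + 1))%E.
  by rewrite e1 !pt_opp !opprK EFinN leeNl leeNr andbC.
have [||||P [pP cP hP HP]] := @covered_even (opp_quiver Q) (refl_set K) (- (n + 1)) (convex_refl cK).
- by rewrite has_pt_opp opprK.
- by rewrite has_pt_opp e1 opprK.
- by rewrite even_idxN even_idxD1.
- by exists (- z); rewrite /refl_set /= opprK sw opprK nz zn.
exists (refl_set P); split.
- by apply: proj_support_opp; rewrite refl_setK.
- exact: convex_refl.
- by apply/hom_ok_opp; rewrite refl_setK.
move=> x Kx xn; apply: HP; first by rewrite /refl_set /= opprK.
by rewrite /mkset sw opprK.
Qed.

End Covers.

(** * Interval representations *)

Section IntervalReps.
Variables (k : fieldType) (R : realType) (Q : quiver R).
Implicit Types (x y z : R) (I J K : interval (\bar R)) (V W X : rep k Q).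

Local Notation rk b := 'rV[k]_(nat_of_bool b).
Local Notation one := (one_lfun k).

Lemma dim_row (b : bool) : \dim {:rk b} = b.
Proof. by rewrite dimvf /dim /= mul1n. Qed.

(** Multiplication by a scalar where both fibres are k, and 0 elsewhere. Conjugating an endomorphism
    of the line by the maps [one] avoids a dependent case analysis on [b] and [c]. *)
Definition scal_lfun (s : 'End(rk true)) (b c : bool) : 'Hom(rk b, rk c) :=
  (one true c \o s \o one b true)%VF.

Lemma scal_lfun1 (b c : bool) : scal_lfun \1%VF b c = one b c.
Proof. by rewrite /scal_lfun comp_lfun1r -one_lfun_comp ?implybT. Qed.

Lemma scal_lfun_true s : scal_lfun s true true = s.
Proof. by rewrite /scal_lfun one_lfun_id comp_lfun1l comp_lfun1r. Qed.

Lemma scal_lfun_dom s (b c : bool) (f : 'Hom(rk b, rk c)) : ~~ (b && c) -> scal_lfun s b c = f.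
Proof.
case: b f => [|] f; last by move=> _; apply: lfun_dom0; exact: (dim_row false).
by case: c f => // f _; apply: lfun_cod0; exact: (dim_row false).
Qed.

Lemma scal_lfun_comp s t (b c d : bool) : (b && d ==> c) ->
  (scal_lfun s c d \o scal_lfun t b c)%VF = scal_lfun (s \o t)%VF b d.
Proof.
case: b => /=; last by move=> _; apply: lfun_dom0; exact: (dim_row false).
case: d => /=; last by move=> _; apply: lfun_cod0; exact: (dim_row false).
by case: c => //= _; rewrite !scal_lfun_true.
Qed.

(** The pointwise origin of [hom_ok]: only when both outer corners are k can the square fail, and
    then the two middle corners must be both present or both absent. *)
Lemma scal_lfun_square s (a b c d : bool) : (a -> d -> b = c) ->
  (scal_lfun s b d \o scal_lfun \1%VF a b = scal_lfun \1%VF c d \o scal_lfun s a c)%VF.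
Proof.
case: a; last by move=> _; apply: lfun_dom0; exact: (dim_row false).
case: d; last by move=> _; apply: lfun_cod0; exact: (dim_row false).
move=> /(_ isT isT) <-; case: b; first by rewrite !scal_lfun_true comp_lfun1l comp_lfun1r.
rewrite (@scal_lfun_dom s false true 0) // (@scal_lfun_dom s true false 0) //.
by rewrite comp_lfun0l comp_lfun0r.
Qed.

Lemma scal_lfun_square_inv s s' (a b c d : bool) : a -> d ->
  (scal_lfun s' b d \o scal_lfun \1%VF a b = scal_lfun \1%VF c d \o scal_lfun s a c)%VF ->
  [/\ b -> c -> s' = s, b -> ~~ c -> s' = 0 & ~~ b -> c -> s = 0].
Proof.
case: a; case: d => // _ _; case: b; case: c => e; split => // _ _; move: e;
  rewrite !scal_lfun_true ?comp_lfun1l ?comp_lfun1r //.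
  by rewrite (@scal_lfun_dom s true false 0) // comp_lfun0r.
by rewrite (@scal_lfun_dom s' false true 0) // comp_lfun0l.
Qed.

Lemma scal_lfun_of_hom (b c : bool) (h : 'Hom(rk b, rk c)) :
  h = scal_lfun (one c true \o h \o one true b)%VF b c.
Proof.
case: b h => h; last by apply: lfun_dom0; exact: (dim_row false).
case: c h => h; last by apply: lfun_cod0; exact: (dim_row false).
by rewrite scal_lfun_true !one_lfun_id comp_lfun1l comp_lfun1r.
Qed.

Lemma scal_lfun_bij s (b c : bool) : b = c -> lbij s -> lbij (scal_lfun s b c).
Proof.
move=> <-; case: b => bs; first by rewrite scal_lfun_true.
by apply: (@lbij_of_inverse _ _ _ _ 0); apply: lfun_dom0; exact: (dim_row false).
Qed.

Lemma itv_rmapE I x y (yx : qle Q y x) :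
  rmap (itv_rep k Q I) yx = scal_lfun \1%VF (x%:E \in I) (y%:E \in I).
Proof. by rewrite scal_lfun1. Qed.

Definition scal_app s I K x : 'Hom(itv_rep k Q I x, itv_rep k Q K x) :=
  scal_lfun s (x%:E \in I) (x%:E \in K).

Lemma suppP I x : supp I x <-> x%:E \in I.
Proof. by []. Qed.

Lemma scal_hom_nat s I K (ok : hom_ok Q (supp I) (supp K)) x y (yx : qle Q y x) :
  (scal_app s I K y \o rmap (itv_rep k Q I) yx)%VF =
  (rmap (itv_rep k Q K) yx \o scal_app s I K x)%VF.
Proof.
rewrite !itv_rmapE; apply: scal_lfun_square => Ix Ky.
by have [h1 h2] := ok x y yx Ix Ky; apply/idP/idP.
Qed.

Definition scal_hom s I K (ok : hom_ok Q (supp I) (supp K)) :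
    rep_hom (itv_rep k Q I) (itv_rep k Q K) :=
  RepHom (scal_hom_nat s ok).

Definition can_hom I K (ok : hom_ok Q (supp I) (supp K)) := scal_hom \1%VF ok.

Lemma can_homE I K ok x : @can_hom I K ok x = itv_lfun k I K x x.
Proof. by rewrite /= /scal_app scal_lfun1. Qed.

Lemma scal_app_comp s t I J K x : ((x%:E \in I) && (x%:E \in K) ==> (x%:E \in J)) ->
  (scal_app s J K x \o scal_app t I J x)%VF = scal_app (s \o t)%VF I K x.
Proof. exact: scal_lfun_comp. Qed.

(** Naturality makes the scalar equal at comparable points of the intersection, hence constant there
    by [zigzag]. If it is nonzero, a middle corner present on one side only would force it to
    vanish, whence [hom_ok]. *)
Lemma hom_itvE I K (h : rep_hom (itv_rep k Q I) (itv_rep k Q K)) :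
  exists s, (forall x, h x = scal_app s I K x) /\
    (nonzero_hom h -> [/\ s != 0, hom_ok Q (supp I) (supp K) & exists z, supp I z /\ supp K z]).
Proof.
pose s x : 'End(rk true) := (one (x%:E \in K) true \o h x \o one true (x%:E \in I))%VF.
have hE x : h x = scal_app (s x) I K x by apply: scal_lfun_of_hom.
have nat x y : qle Q y x -> x%:E \in I -> y%:E \in K ->
    [/\ y%:E \in I -> x%:E \in K -> s y = s x, y%:E \in I -> x%:E \notin K -> s y = 0
      & y%:E \notin I -> x%:E \in K -> s x = 0].
  move=> yx Ix Ky; apply: scal_lfun_square_inv Ix Ky _.
  by have := happ_nat h yx; rewrite !hE !itv_rmapE.
case: (pselect (exists z, supp I z /\ supp K z)) => [[z [Iz Kz]]|none]; last first.
  have h0 x : h x = 0.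
    rewrite hE; apply: scal_lfun_dom; apply/negP => /andP[Ix Kx].
    by apply: none; exists x.
  exists 0; split=> [x|[x]]; last by rewrite h0 eqxx.
  rewrite h0; apply/esym; apply: scal_lfun_dom; apply/negP => /andP[Ix Kx].
  by apply: none; exists x.
have cIK : convex_set (supp I `&` supp K).
  move=> a b c [Ia Ka] [Ic Kc] ab bc.
  by split; [apply: supp_convex Ia Ic ab bc|apply: supp_convex Ka Kc ab bc].
have sconst x : supp I x -> supp K x -> s x = s z.
  move=> Ix Kx; pose P : set R := fun x => s x = s z.
  have hP a b : (supp I `&` supp K) a -> (supp I `&` supp K) b -> qle Q b a -> P a <-> P b.
    move=> [Ia Ka] [Ib Kb] ba; have [e _ _] := nat a b ba Ia Kb.
    by rewrite /P (e Ib Ka).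
  exact: (zigzag cIK hP (conj Iz Kz) (conj Ix Kx) (erefl _)).
exists (s z); split=> [x|[x hx]].
  rewrite hE; case: (boolP ((x%:E \in I) && (x%:E \in K))) => [/andP[Ix Kx]|n].
    by rewrite (sconst x).
  exact: scal_lfun_dom.
have [Ix Kx] : supp I x /\ supp K x.
  apply/andP; apply: contraNT hx => n; rewrite hE; apply/eqP; exact: scal_lfun_dom.
have sz : s z != 0.
  apply: contraNneq hx => e; rewrite hE (sconst x) // e.
  by rewrite /scal_app /scal_lfun comp_lfun0r comp_lfun0l.
split => //; last by exists z.
move=> a b ba Ia Kb; have [_ h1 h2] := nat a b ba Ia Kb; rewrite !suppP.
split=> [Ib|Ka]; apply/negPn/negP => n; move/eqP: sz; apply.
  by rewrite -(sconst b Ib Kb) h1.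
by rewrite -(sconst a Ia Ka) h2.
Qed.

Lemma line_end_bij (s : 'End(rk true)) : s != 0 -> lbij s.
Proof.
move=> s0; apply: lbij_epi_dim => //; apply/eqP; rewrite eqEdim subvf dim_row /=.
rewrite lt0n dimv_eq0; apply: contra s0 => /eqP e; apply/eqP/lfunP => v.
rewrite zero_lfunE; apply/eqP; rewrite -memv0 -e memv_img ?memvf //.
Qed.

Lemma scal_app_bij s I K x : supp I = supp K -> lbij s -> lbij (scal_app s I K x).
Proof.
move=> IK bs; have e : (x%:E \in I) = (x%:E \in K).
  by apply/idP/idP; have := congr1 (@^~ x) IK; rewrite /supp /= => ->.
exact: scal_lfun_bij.
Qed.

Lemma itv_is_zero I : ~ is_zero (itv_rep k Q I) <-> exists x, supp I x.
Proof.
split=> [h|[x Ix] /(_ x)]; last by move/suppP: Ix => Ix; rewrite dim_row Ix.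
apply: contrapT => n; apply: h => x; rewrite dim_row.
by case: (boolP (x%:E \in I)) => // Ix; exfalso; apply: n; exists x.
Qed.

Lemma dsum_map_inj V W x y (yx : qle Q y x) :
  lbij (rmap (dsum V W) yx) -> lker (rmap V yx) = 0%VS /\ lker (rmap W yx) = 0%VS.
Proof.
move=> /lbij_lker/eqP/lker0P inj; split; apply/eqP/lker0P => u v e.
  have := inj (u, 0) (v, 0); rewrite !lfunE /= /dsum_lfun /= e => /(_ erefl).
  by case.
have := inj (0, u) (0, v); rewrite !lfunE /= /dsum_lfun /= e => /(_ erefl).
by case.
Qed.

Lemma lker0_dim (A B : vectType k) (f : 'Hom(A, B)) : lker f = 0%VS -> (\dim {:A} <= \dim {:B})%N.
Proof.
move=> f0; rewrite -(limg_ker_dim f fullv) f0 capv0 dimv0 add0n.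
exact: dimvS (subvf _).
Qed.

(** The maps of [M_I] inside the support are bijective, so those of a summand are injective. As the
    dimensions of the two summands add up to 1, each is constant along comparable points, hence on
    all of [I]. *)
Lemma indecomposable_itv I : (exists x, supp I x) -> indecomposable (itv_rep k Q I).
Proof.
move=> ne; split; first exact/itv_is_zero.
move=> A B _ _ iso; have [phi /is_isoP bphi] := iso.
have dAB x : (\dim {:A x} + \dim {:B x})%N = (x%:E \in I).
  by have := isomorphic_dim x iso; rewrite dim_row dim_prod.
have P x y : supp I x -> supp I y -> qle Q y x -> (\dim {:A x} = 0%N <-> \dim {:A y} = 0%N).
  move=> /suppP Ix /suppP Iy yx.
  have bI : lbij (rmap (itv_rep k Q I) yx).
    by rewrite itv_rmapE; apply: scal_lfun_bij (lbij1 _); rewrite Ix Iy.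
  have bD : lbij (rmap (dsum A B) yx).
    have -> : rmap (dsum A B) yx = (phi y \o rmap (itv_rep k Q I) yx \o (phi x)^-1)%VF.
      by rewrite happ_nat -comp_lfunA (bphi x).2 comp_lfun1r.
    apply: lbij_comp; first exact: lbij_comp.
    exact: (lbij_of_inverse (bphi x).2 (bphi x).1).
  have [/lker0_dim lA /lker0_dim lB] := dsum_map_inj bD.
  by move: (dAB x) (dAB y) lA lB; rewrite Ix Iy; lia.
case: (pselect (is_zero A)) => nA; [by left|right=> x].
have [y ay] : exists y, \dim {:A y} <> 0%N.
  by apply: contrapT => n; apply: nA => y; apply: contrapT => h; apply: n; exists y.
have := dAB x; case: (boolP (x%:E \in I)) => Ix; last by lia.
have Iy : supp I y by apply/suppP; move: (dAB y); case: (_ \in I) => //=; lia.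
suff : \dim {:A x} <> 0%N by lia.
move=> ax; apply: ay.
exact: (@zigzag R Q (supp I) [set x | \dim {:A x} = 0%N] (@supp_convex R I) P x y Ix Iy ax).
Qed.

Definition zero_hom V W : rep_hom V W.
Proof.
by exists (fun x => 0) => x y yx; rewrite comp_lfun0l comp_lfun0r.
Defined.

(** The canonical maps from the listed projectives are added up; the sum is onto at [x] as soon as
    one member of the list contains [x]. *)
Lemma covers_in_rep K (s : seq (set R)) :
  (forall P, List.In P s -> [/\ proj_support Q P, convex_set P & hom_ok Q P (supp K)]) ->
  (forall x, supp K x -> exists2 P, List.In P s & P x) ->
  in_rep (itv_rep k Q K).
Proof.
move=> hs cov.
have [t [ht covt]] : exists t : seq (interval (\bar R)),
    (forall i, (i < size t)%N -> proj_itv Q (nth `]0%E, 0%E[ t i) /\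
       hom_ok Q (supp (nth `]0%E, 0%E[ t i)) (supp K)) /\
    forall x, (exists2 P, List.In P s & P x) -> exists2 i, (i < size t)%N & supp (nth `]0%E, 0%E[ t i) x.
  elim: s hs {cov} => [_|P s IH hs]; first by exists [::]; split => // x [].
  have [t [ht covt]] := IH (fun P h => hs P (or_intror h)).
  have [pP cP hP] := hs P (or_introl erefl).
  have [I eI] := convex_supp cP.
  exists (I :: t); split; first by case=> [_|i] /=; [rewrite /proj_itv -/(supp I) eI|apply: ht].
  move=> x [P' [<- Px|P's P'x]]; first by exists 0%N; rewrite //= eI.
  by have [|i it ix] := covt x; [exists P'|exists i.+1].
exists (size t), (fun i => nth `]0%E, 0%E[ t i); split; first by move=> i; have [] := ht i (ltn_ord i).
set F := fun i : 'I_(size t) => itv_rep k Q (nth `]0%E, 0%E[ t i).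
suff [p hp] : exists p : rep_hom (\big[@dsum k R Q/zero_rep k Q]_(i <- index_enum 'I_(size t)) F i) (itv_rep k Q K),
    forall x, supp K x -> (exists2 i, i \in index_enum 'I_(size t) & supp (nth `]0%E, 0%E[ t i) x) ->
      limg (p x) = fullv.
  exists p => x; case: (boolP (x%:E \in K)) => Kx; last first.
    apply/eqP; rewrite eqEdim subvf dim_row (negPf Kx) //.
  apply: hp => //; have [i it ix] := covt x (cov x Kx).
  by exists (Ordinal it); rewrite ?mem_index_enum.
elim: (index_enum _) => [|i r [p hp]].
  by rewrite big_nil; exists (zero_hom _ _) => x _ [].
rewrite big_cons; have [_ ok] := ht i (ltn_ord i).
exists (copair_hom (can_hom ok) p) => x Kx [j]; rewrite inE => /orP[/eqP ->|jr] jx.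
  apply/eqP; rewrite eqEsubv subvf /=; apply/subvP => w _.
  have b : lbij (can_hom ok x).
    by apply: scal_lfun_bij (lbij1 _); move/suppP: jx => ->; move/suppP: Kx => ->.
  have : w \in limg (can_hom ok x) by rewrite (lbij_limg b) memvf.
  move=> /memv_imgP[v _ ->]; apply/memv_imgP; exists (v, 0); rewrite ?memvf //.
  by have := @copair_homE _ _ _ _ _ _ (can_hom ok) p x (v, 0); rewrite linear0 subr0 => <-.
apply/eqP; rewrite eqEsubv subvf /=; apply/subvP => w _.
have : w \in limg (p x) by rewrite hp ?memvf //; exists j.
(* The sign undoes the subtraction in [copair_hom]. *)
move=> /memv_imgP[v _ ->]; apply/memv_imgP; exists (0, - v); rewrite ?memvf //.
by have := @copair_homE _ _ _ _ _ _ (can_hom ok) p x (0, - v); rewrite linear0 sub0r linearN opprK => <-.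
Qed.

(** Only finitely many segments lie between the two bounds, and each is covered by one
    projective. *)
Lemma in_rep_bounded K : bounded_below Q (supp K) -> bounded_above Q (supp K) ->
  in_rep (itv_rep k Q K).
Proof.
move=> [m hm bm] [n hn bn].
have cK := @supp_convex R K.
suff [s [hs cov]] : exists s : seq (set R),
    (forall P, List.In P s -> [/\ proj_support Q P, convex_set P & hom_ok Q P (supp K)]) /\
    (forall x, supp K x -> (x%:E <= pt Q n)%E -> exists2 P, List.In P s & P x).
  by apply: (covers_in_rep hs) => x Kx; apply: cov => //; apply: bn.
have one_seg p : has_pt Q p -> has_pt Q (p + 1) -> exists s : seq (set R),
    (forall P, List.In P s -> [/\ proj_support Q P, convex_set P & hom_ok Q P (supp K)]) /\
    (forall x, supp K x -> (pt Q p <= x%:E <= pt Q (p + 1))%E -> exists2 P, List.In P s & P x).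
  move=> h0 h1; case: (pselect (exists x, supp K x /\ (pt Q p <= x%:E <= pt Q (p + 1))%E)).
    move=> /(covered_segment cK h0 h1)[P [pP cP hP cov]]; exists [:: P]; split.
      by move=> P' [<-|[]].
    by move=> x Kx xp; exists P; [left|apply: cov].
  by move=> none; exists [::]; split => // x Kx xp; exfalso; apply: none; exists x.
have cat s1 s2 : (forall P, List.In P s1 -> [/\ proj_support Q P, convex_set P & hom_ok Q P (supp K)]) ->
   (forall P, List.In P s2 -> [/\ proj_support Q P, convex_set P & hom_ok Q P (supp K)]) ->
   forall P, List.In P (s1 ++ s2) -> [/\ proj_support Q P, convex_set P & hom_ok Q P (supp K)].
  by move=> h1 h2 P /List.in_app_iff[]; auto.
suff H (d : nat) : has_pt Q (m + d%:Z) -> exists s : seq (set R),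
    (forall P, List.In P s -> [/\ proj_support Q P, convex_set P & hom_ok Q P (supp K)]) /\
    (forall x, supp K x -> (x%:E <= pt Q (m + d%:Z))%E -> exists2 P, List.In P s & P x).
  case: (lerP m n) => mn.
    have e : m + `|n - m|%N%:Z = n by lia.
    by have := H `|n - m|%N; rewrite e; apply.
  exists [::]; split => // x Kx xn; exfalso.
  have := le_trans (bm x Kx) xn; rewrite pt_leE //; lia.
elim: d => [|d IH] hd.
  (* Without any segment, the only possible point of the support is the lower bound itself, covered
     by its own projective. *)
  rewrite addr0; case: (pselect (exists x, supp K x /\ (x%:E <= pt Q m)%E)); last first.
    by move=> none; exists [::]; split => // x Kx xp; exfalso; apply: none; exists x.
  move=> [z [Kz zm]]; have ez : z%:E = pt Q m by apply/le_anti; rewrite zm bm.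
  exists [:: [set x | qle Q x z]]; split.
    move=> P' [<-|[]]; split; [exact: principal_support|exact: principal_convex|exact: hom_ok_principal].
  move=> x Kx xm; exists [set x | qle Q x z]; first by left.
  have -> : x = z by apply: EFin_inj; rewrite ez; apply/le_anti; rewrite xm bm.
  exact: qle_refl.
have h0 : has_pt Q (m + d%:Z) by apply: (has_pt_convex hm hd); lia.
have e : m + d.+1%:Z = m + d%:Z + 1 by lia.
rewrite e in hd *; have [s1 [hs1 cov1]] := IH h0; have [s2 [hs2 cov2]] := one_seg _ h0 hd.
exists (s1 ++ s2); split; first exact: cat.
move=> x Kx xd; case: (leP x%:E (pt Q (m + d%:Z))) => xm.
  by have [P Ps Px] := cov1 x Kx xm; exists P => //; apply/List.in_app_iff; left.
have [|P Ps Px] := cov2 x Kx; first by rewrite (ltW xm).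
by exists P => //; apply/List.in_app_iff; right.
Qed.

End IntervalReps.

(** * Colourings: finitely generated representations are piecewise constant *)

Section Colouring.
Variables (k : fieldType) (R : realType) (Q : quiver R).
Implicit Types (x y z : R) (V : rep k Q).

(* The classes of a colouring are intervals on which V is constant, and two
   points of adjacent classes are comparable, unless V vanishes there. *)
Definition colouring V (c : R -> nat) (N : nat) : Prop :=
  [/\ (forall x y, x <= y -> (c x <= c y)%N), (forall x, (c x <= N)%N),
      (forall x y (yx : qle Q y x), c x = c y -> lbij (rmap V yx)),
      (forall x y, c x = c y -> \dim {:V x} = \dim {:V y})
    & (forall x y, x <= y -> \dim {:V x} <> 0%N -> \dim {:V y} <> 0%N ->
         (forall z, ~ (c x < c z < c y)%N) -> qle Q x y \/ qle Q y x)].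

(** The colour counts the members that contain the point. Each membership is monotone, so equal
    totals at [x <= y] force equality term by term. *)
Lemma colour_of_upsets n (F : 'I_n -> set R) : (forall i, upset (F i)) ->
  exists c : R -> nat, [/\ (forall x y, x <= y -> (c x <= c y)%N), (forall x, (c x <= n)%N)
    & forall x y, x <= y -> c x = c y -> forall i, F i x <-> F i y].
Proof.
move=> uF; pose b i x : bool := `[< F i x >]; exists (fun x => \sum_(i < n) b i x)%N.
have mb i x y : x <= y -> (b i x <= b i y)%N.
  move=> xy; rewrite /b; case: (asboolP (F i x)) => // Fx.
  by have -> : `[< F i y >] = true by apply/asboolP; apply: uF Fx xy.
split=> [x y xy|x|x y xy e i].
- by apply: leq_sum => i _; apply: mb.
- rewrite -[X in (_ <= X)%N]card_ord -sum1_card; apply: leq_sum => i _; exact: leq_b1.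
have le : (\sum_(j < n | j != i) b j x <= \sum_(j < n | j != i) b j y)%N.
  by apply: leq_sum => j _; apply: mb.
have {}e : b i x = b i y.
  move: e (mb i _ _ xy); rewrite (bigD1 i) //= [in RHS](bigD1 i) //=.
  move: le; set u := (\sum_(_ < _ | _) _)%N; set v := (\sum_(_ < _ | _) _)%N.
  by case: (b i x); case: (b i y) => //=; lia.
by split=> /asboolP h; apply/asboolP; move: h; rewrite -!/(b _ _) e.
Qed.

Lemma proj_support_bounded P : proj_support Q P -> bounded_below Q P /\ bounded_above Q P.
Proof.
have sub a : bounded_below Q [set x | qle Q x a] /\ bounded_above Q [set x | qle Q x a].
  split.
    have [m [m0 m1 /andP[ma am]]] := segment_left Q a; exists m => // x [j [j0 j1 /andP[ja aj] /andP[jx _] _]].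
    apply: le_trans jx; rewrite pt_leE //.
    by have := lt_le_trans ma aj; rewrite pt_ltE //; lia.
  have [m [m0 m1 /andP[ma am]]] := segment_right Q a; exists (m + 1) => // x [j [j0 j1 /andP[ja aj] /andP[_ xj] _]].
  apply: le_trans xj _; rewrite pt_leE //.
  by have := le_lt_trans ja am; rewrite pt_ltE //; lia.
move=> [[z Pz] [[a H]|[[n [hn on en eP]]|[n [hn on en eP]]]]].
- have [[m hm bm] [p hp bp]] := sub a.
  have sP x : P x -> qle Q x a by case: H => -> // -[].
  by split; [exists m => // x /sP /bm|exists p => // x /sP /bp].
- have [m [m0 m1 /andP[mz zm]]] := segment_right Q z.
  split; first by exists n => // x _; rewrite en leNye.
  exists (n + 1); last by move=> x; rewrite eP.
  have : (pt Q n < pt Q (m + 1))%E by rewrite en; apply: le_lt_trans zm; rewrite leNye.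
  by rewrite pt_ltE // => lt; apply: (has_pt_convex hn m1); lia.
have [m [m0 m1 /andP[mz zm]]] := segment_left Q z.
split; last by exists n => // x _; rewrite en leey.
exists (n - 1); last by move=> x; rewrite eP.
have : (pt Q m < pt Q n)%E by rewrite en; apply: lt_le_trans mz _; rewrite leey.
by rewrite pt_ltE // => lt; apply: (has_pt_convex m0 hn); lia.
Qed.

Lemma dsum_mapE V W x y (yx : qle Q y x) v :
  dsum_map V W yx v = (rmap V yx v.1, rmap W yx v.2).
Proof. by rewrite lfunE. Qed.

Lemma zero_rep_dim x : \dim {:zero_rep k Q x} = 0%N.
Proof.
apply: etrans (dim_row k (x%:E \in `]0%E, 0%E[)) _; case: (boolP (_ \in _)) => //.
by rewrite in_itv /= => /andP[a b]; have := lt_trans a b; rewrite ltxx.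
Qed.

Section BigSum.
Variables (n : nat) (I : 'I_n -> interval (\bar R)).
Implicit Types (r : seq 'I_n).

Let E r : rep k Q := \big[@dsum k R Q/zero_rep k Q]_(i <- r) itv_rep k Q (I i).

Lemma big_itv_dim r x : (\dim {:E r x} <= size r)%N.
Proof.
rewrite /E; elim: r => [|i r IH]; first by rewrite big_nil zero_rep_dim.
rewrite big_cons; apply: leq_trans (eq_leq (dim_prod _ _)) _.
apply: (@leq_add _ _ 1 (size r)) IH; apply: leq_trans (eq_leq (dim_row k (x%:E \in I i))) (leq_b1 _).
Qed.

Lemma big_itv_dim0 r x : (forall i, ~ supp (I i) x) -> \dim {:E r x} = 0%N.
Proof.
move=> h; rewrite /E; elim: r => [|i r IH].
  by rewrite big_nil zero_rep_dim.
rewrite big_cons; apply: etrans (dim_prod _ _) _.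
rewrite IH addn0 (dim_row k (x%:E \in I i)).
by case: (boolP (_ \in _)) => // /(h i).
Qed.

Lemma big_itv_surj r x y (yx : qle Q y x) : (forall i, supp (I i) y -> supp (I i) x) ->
  limg (rmap (E r) yx) = fullv.
Proof.
move=> h; rewrite /E; elim: r => [|i r IH].
  by rewrite big_nil; apply/eqP; rewrite eqEdim subvf zero_rep_dim.
rewrite big_cons; apply/eqP; rewrite eqEsubv subvf /=; apply/subvP => -[u v] _.
have : v \in limg (rmap (\big[@dsum k R Q/zero_rep k Q]_(i <- r) itv_rep k Q (I i)) yx).
  by rewrite IH memvf.
move=> /memv_imgP[v' _ ->].
have : u \in limg (rmap (itv_rep k Q (I i)) yx).
  case: (boolP (y%:E \in I i)) => Iy.
    by rewrite lbij_limg ?memvf // itv_rmapE; apply: scal_lfun_bij (lbij1 _); rewrite Iy; apply: h.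
  suff -> : limg (rmap (itv_rep k Q (I i)) yx) = fullv by rewrite memvf.
  by apply/eqP; rewrite eqEdim subvf (dim_row k (y%:E \in I i)) (negPf Iy).
move=> /memv_imgP[u' _ ->]; apply/memv_imgP; exists (u', v'); rewrite ?memvf //.
by rewrite dsum_mapE.
Qed.

End BigSum.

Lemma proj_family_below n (I : 'I_n -> interval (\bar R)) : (forall i, proj_itv Q (I i)) ->
  exists2 n0, has_pt Q n0 & forall i x, supp (I i) x -> (pt Q n0 <= x%:E)%E.
Proof.
move=> pI.
have [m0 [hm0 _]] := index_below Q 0.
suff H (r : seq 'I_n) : exists2 n0, has_pt Q n0 & forall i x, i \in r -> supp (I i) x -> (pt Q n0 <= x%:E)%E.
  by have [n0 h0 b0] := H (index_enum 'I_n); exists n0 => // i x; apply: b0; apply: mem_index_enum.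
elim: r => [|i r [n0 h0 b0]]; first by exists m0.
have [[m hm bm] _] := proj_support_bounded (pI i).
exists (Num.min n0 m); first by rewrite /Num.min; case: ifP.
move=> j x; rewrite inE => /orP[/eqP ->|jr] jx.
  apply: le_trans (bm x jx); rewrite pt_leE // ?ge_min ?lexx ?orbT //.
  by rewrite /Num.min; case: ifP.
apply: le_trans (b0 j x jr jx); rewrite pt_leE // ?ge_min ?lexx ?orbT //.
by rewrite /Num.min; case: ifP.
Qed.

Lemma proj_family_above n (I : 'I_n -> interval (\bar R)) : (forall i, proj_itv Q (I i)) ->
  exists2 n1, has_pt Q n1 & forall i x, supp (I i) x -> (x%:E <= pt Q n1)%E.
Proof.
move=> pI.
have [m0 [hm0 _]] := index_below Q 0.
suff H (r : seq 'I_n) : exists2 n1, has_pt Q n1 & forall i x, i \in r -> supp (I i) x -> (x%:E <= pt Q n1)%E.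
  by have [n1 h0 b0] := H (index_enum 'I_n); exists n1 => // i x; apply: b0; apply: mem_index_enum.
elim: r => [|i r [n1 h0 b0]]; first by exists m0.
have [_ [m hm bm]] := proj_support_bounded (pI i).
exists (Num.max n1 m); first by rewrite /Num.max; case: ifP.
move=> j x; rewrite inE => /orP[/eqP ->|jr] jx.
  apply: le_trans (bm x jx) _; rewrite pt_leE // ?le_max ?lexx ?orbT //.
  by rewrite /Num.max; case: ifP.
apply: le_trans (b0 j x jr jx) _; rewrite pt_leE // ?le_max ?lexx ?orbT //.
by rewrite /Num.max; case: ifP.
Qed.

Lemma in_rep_support V : in_rep V ->
  exists n0 n1, [/\ has_pt Q n0, has_pt Q n1 &
    forall x, \dim {:V x} <> 0%N -> (pt Q n0 <= x%:E <= pt Q n1)%E].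
Proof.
move=> [n [I [pI [p ep]]]].
have [n0 hn0 bn0] := proj_family_below pI.
have [n1 hn1 bn1] := proj_family_above pI.
exists n0, n1; split=> // x d.
have [i Ix] : exists i, supp (I i) x.
  apply: contrapT => none; apply: d; apply/eqP; rewrite -leqn0.
  rewrite -(@big_itv_dim0 n I (index_enum 'I_n) x); last by move=> i Ix; apply: none; exists i.
  by rewrite -(ep x) -(limg_ker_dim (p x) fullv); exact: leq_addl.
by rewrite (bn0 i) ?(bn1 i).
Qed.

(** The line is cut at the ends of the supports of the projectives and at the indexed points near
    them; the maps of [V] inside a class are then onto. Cutting further by dimension makes them
    bijective. *)
Lemma colouring_exists V : in_rep V -> exists c N, colouring V c N.
Proof.
move=> [n [I [pI [p ep]]]].
set E := \big[_/_]_(i < n) _ in p ep.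
have [n0 hn0 bn0] := proj_family_below pI.
have [n1 hn1 bn1] := proj_family_above pI.
pose M := `|n1 - n0|%N.+1.
(* Cutting by both closed and open rays makes each indexed point from [n0] to [n1] a class by
   itself. The left and right ends of the supports give [c3] and [c4], the latter through
   complements, which are upsets. *)
have [c1 [m1 b1 e1]] := @colour_of_upsets M (fun j => lray (BLeft (pt Q (n0 + j%:Z)))) (fun j => @lray_upset R _).
have [c2 [m2 b2 e2]] := @colour_of_upsets M (fun j => lray (BRight (pt Q (n0 + j%:Z)))) (fun j => @lray_upset R _).
have [c3 [m3 b3 e3]] := @colour_of_upsets n (fun i => up_closure (supp (I i))) (fun i => @up_closure_upset R _).
have [c4 [m4 b4 e4]] := @colour_of_upsets n (fun i => ~` down_closure (supp (I i)))
  (fun i x y (h : (~` down_closure (supp (I i))) x) xy Dy => h (@down_closure_downset R _ y x Dy xy)).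
pose cE x := (c1 x + c2 x + (c3 x + c4 x))%N.
have mE x y : x <= y -> (cE x <= cE y)%N.
  by move=> xy; rewrite /cE !leq_add ?m1 ?m2 ?m3 ?m4.
have eE x y : x <= y -> cE x = cE y -> [/\ c1 x = c1 y, c2 x = c2 y, c3 x = c3 y & c4 x = c4 y].
  move=> xy; rewrite /cE; move: (m1 _ _ xy) (m2 _ _ xy) (m3 _ _ xy) (m4 _ _ xy).
  by move: (c1 x) (c2 x) (c3 x) (c4 x) (c1 y) (c2 y) (c3 y) (c4 y) => *; split; lia.
have bE x : (cE x <= M + M + (n + n))%N by rewrite /cE !leq_add.
have cut m x y : has_pt Q m -> n0 <= m -> m <= n1 -> x <= y -> cE x = cE y ->
    (((pt Q m <= x%:E)%E = (pt Q m <= y%:E)%E) * ((pt Q m < x%:E)%E = (pt Q m < y%:E)%E))%type.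
  move=> hm n0m mn1 xy e; have [E1 E2 _ _] := eE _ _ xy e.
  have jM : (`|m - n0| < M)%N by rewrite /M; lia.
  have ej : n0 + `|m - n0|%N%:Z = m by lia.
  have := e1 _ _ xy E1 (Ordinal jM); have := e2 _ _ xy E2 (Ordinal jM); rewrite /= ej.
  rewrite !lrayL !lrayR => h1 h2.
  by split; apply/idP/idP; tauto.
have sup x y i : cE x = cE y -> supp (I i) x -> supp (I i) y.
  suff H x' y' : x' <= y' -> cE x' = cE y' -> supp (I i) x' <-> supp (I i) y'.
    move=> e; case: (leP x y) => [xy|/ltW yx]; first by case: (H _ _ xy e).
    by case: (H _ _ yx (esym e)).
  move=> xy e; have [_ _ E3 E4] := eE _ _ xy e.
  rewrite (convex_closures (@supp_convex R (I i))).
  have h3 := e3 _ _ xy E3 i; have h4 := e4 _ _ xy E4 i.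
  have {}h4 : down_closure (supp (I i)) x' <-> down_closure (supp (I i)) y'.
    by split=> h; apply: contrapT => n'; [apply: (h4.2 n')|apply: (h4.1 n')].
  by split=> -[a b]; split; tauto.
have surj x y (yx : qle Q y x) : cE x = cE y -> limg (rmap V yx) = fullv.
  move=> e; have sE : limg (rmap E yx) = fullv by apply: big_itv_surj => i; apply: sup.
  apply/eqP; rewrite eqEsubv subvf /= -(ep y) -sE -limg_comp happ_nat limg_comp.
  exact: limgS (subvf _).
have dle x y : qle Q y x -> cE x = cE y -> (\dim {:V y} <= \dim {:V x})%N.
  move=> yx e; rewrite -(surj _ _ yx e) -(limg_ker_dim (rmap V yx) fullv); exact: leq_addl.
pose D := size (index_enum 'I_n).
have dE x : (\dim {:V x} <= \dim {:E x})%N.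
  by rewrite -(ep x) -(limg_ker_dim (p x) fullv); exact: leq_addl.
have dD x : (\dim {:V x} <= D)%N by apply: leq_trans (dE x) (big_itv_dim _ _ _).
have dI x : \dim {:V x} <> 0%N -> exists i, supp (I i) x.
  move=> d; apply: contrapT => none; apply: d; apply/eqP; rewrite -leqn0.
  rewrite -(@big_itv_dim0 n I (index_enum 'I_n) x) ?dE // => i Ix; apply: none; by exists i.
pose rising e := forall x y, cE x = e -> cE y = e -> x <= y -> (\dim {:V x} <= \dim {:V y})%N.
have rise e : rising e \/ forall x y, cE x = e -> cE y = e -> x <= y -> (\dim {:V y} <= \dim {:V x})%N.
  case: (pselect (rising e)) => [|nr]; [by left|right].
  have [x [y [ex ey xy dyx]]] : exists x y, [/\ cE x = e, cE y = e, x <= y & (\dim {:V y} < \dim {:V x})%N].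
    apply: contrapT => none; apply: nr => x y ex ey xy; rewrite leqNgt; apply/negP => lt.
    by apply: none; exists x, y.
  have xy' : x < y.
    by rewrite lt_neqAle xy andbT; apply/eqP => E1; move: dyx; rewrite E1 ltnn.
  have [i Ix] : exists i, supp (I i) x by apply: dI; lia.
  have Iy : supp (I i) y by apply: sup Ix; rewrite ex.
  (* A class with two points, one of them in some support, contains no indexed point, so it lies
     inside one open segment. The orientation of that segment fixes the direction in which the
     dimension can drop. *)
  have [m [h0 h1 /andP[mx xm]]] := segment_right Q x.
  have n0m : n0 <= m by have := le_lt_trans (bn0 i x Ix) xm; rewrite pt_ltE //; lia.
  have mn1 : m < n1.
    have : (pt Q m < pt Q n1)%E.
      by apply: le_lt_trans mx (lt_le_trans _ (bn1 i y Iy)); rewrite lte_fin.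
    by rewrite pt_ltE.
  have xye : cE x = cE y by rewrite ex.
  have n0m1 : n0 <= m + 1 by lia.
  have m1n1 : m + 1 <= n1 by lia.
  have mx' : (pt Q m < x%:E)%E.
    by rewrite (cut m x y h0 n0m (ltW mn1) xy xye); apply: le_lt_trans mx _; rewrite lte_fin.
  have xm' : (pt Q (m + 1) <= x%:E)%E = false by rewrite leNgt xm.
  have op z : cE z = e -> (pt Q m < z%:E < pt Q (m + 1))%E.
    move=> ez; have exz : cE x = cE z by rewrite ex.
    case: (leP x z) => [xz|/ltW zx].
      by rewrite -(cut m x z h0 n0m (ltW mn1) xz exz) mx' ltNge -(cut (m + 1) x z h1 n0m1 m1n1 xz exz) xm'.
    by rewrite (cut m z x h0 n0m (ltW mn1) zx (esym exz)) mx' ltNge (cut (m + 1) z x h1 n0m1 m1n1 zx (esym exz)) xm'.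
  have cl z : cE z = e -> (pt Q m <= z%:E <= pt Q (m + 1))%E by move=> /op/andP[? ?]; rewrite !ltW.
  case em : (even_idx m).
    exfalso; have yx : qle Q x y by apply/(qle_segment h0 h1 (cl _ ey) (cl _ ex)); rewrite em.
    by have := dle _ _ yx (esym xye); lia.
  move=> a b ea eb ab; apply: dle; last by rewrite ea.
  by apply/(qle_segment h0 h1 (cl _ ea) (cl _ eb)); rewrite em.
(* The dimension, reversed on the classes where it decreases to the right, so that the refinement is
   increasing. The weight [D.+1] exceeds every value of [rho], so colours compare
   lexicographically. *)
pose rho x := if `[< rising (cE x) >] then \dim {:V x} else (D - \dim {:V x})%N.
have rhoD x : (rho x <= D)%N by rewrite /rho; case: ifP => _ //; exact: leq_subr.
pose c x := (cE x * D.+1 + rho x)%N.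
have clt x y : (cE x < cE y)%N -> (c x < c y)%N.
  by move=> lt; rewrite /c; have := rhoD x; nia.
have mc x y : x <= y -> (c x <= c y)%N.
  move=> xy; case: (ltngtP (cE x) (cE y)) => e; first by apply/ltnW/clt.
    by have := mE _ _ xy; lia.
  rewrite /c e leq_add2l /rho e; case: asboolP => r; first exact: r.
  by apply: leq_sub2l; case: (rise (cE y)) => // h; apply: h.
have cE_eq x y : c x = c y -> cE x = cE y.
  move=> e; case: (ltngtP (cE x) (cE y)) => // /clt; rewrite e ltnn //.
have dim_eq x y : c x = c y -> \dim {:V x} = \dim {:V y}.
  move=> e; have e' := cE_eq _ _ e; move: e; rewrite /c /rho e'.
  by have := dD x; have := dD y; case: ifP => _; lia.
exists c, ((M + M + (n + n)) * D.+1 + D)%N; split=> //.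
- by move=> x; rewrite /c leq_add ?leq_mul2r ?bE ?orbT.
- move=> x y yx e; apply: lbij_epi_dim (dim_eq _ _ e).
  by apply: surj; apply: cE_eq.
(* An indexed point strictly between [x] and [y] would be a class of its own, with a colour strictly
   between theirs. *)
move=> x y xy /dI[i Ix] /dI[j Jy] none; apply: qle_comparable => // m hm /andP[xm my].
have [z ez] := pt_fin (ltW xm) (ltW my).
have n0m : n0 <= m by have := le_lt_trans (bn0 i x Ix) xm; rewrite pt_ltE //; lia.
have mn1 : m <= n1 by have := lt_le_trans my (bn1 j y Jy); rewrite pt_ltE //; lia.
move: xm my; rewrite ez !lte_fin => xz zy.
apply: (none z); apply/andP; split; apply: clt.
  rewrite ltn_neqAle mE ?ltW // andbT; apply/eqP => e.
  have := (cut m x z hm n0m mn1 (ltW xz) e).1; rewrite ez !lee_fin lexx.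
  by rewrite leNgt xz.
rewrite ltn_neqAle mE ?ltW // andbT; apply/eqP => e.
have := (cut m z y hm n0m mn1 (ltW zy) e).2; rewrite ez !lte_fin ltxx zy //.
Qed.

End Colouring.

(** * An indecomposable representation is an interval representation *)

Section Transport.
Variables (k : fieldType) (R : realType) (Q : quiver R) (V : rep k Q).
Hypothesis rmap_id : forall x (xx : qle Q x x), rmap V xx = \1%VF.
Implicit Types (x y z : R).

Definition comparable x y := qle Q x y \/ qle Q y x.

Lemma comparable_sym x y : comparable x y -> comparable y x.
Proof. by case; [right|left]. Qed.

(** The map of [V] along a relation of either direction, pseudo-inverted when the relation points
    the other way; 0 is a dummy value for incomparable points. *)
Definition transport x y : 'Hom(V x, V y) :=
  match pselect (qle Q y x) with
  | left yx => rmap V yx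
  | right _ => match pselect (qle Q x y) with
    | left xy => ((rmap V xy)^-1)%VF
    | right _ => 0
    end
  end.

Lemma transport_down x y (yx : qle Q y x) : transport x y = rmap V yx.
Proof. by rewrite /transport; case: pselect => // h; apply: rmap_irr. Qed.

(** It holds vacuously when [qle Q x y] fails, so only the relations inverted by [transport] are
    constrained. *)
Definition up_bij x y := forall h : qle Q x y, lbij (rmap V h).

Lemma transport_up x y (xy : qle Q x y) : up_bij x y ->
  (transport x y \o rmap V xy)%VF = \1%VF /\ (rmap V xy \o transport x y)%VF = \1%VF.
Proof.
move=> b; rewrite /transport; case: pselect => [yx|nyx].
  have e := qle_anti xy yx; subst y.
  by rewrite !rmap_id !comp_lfun1l.
by case: pselect => // h; rewrite (rmap_irr V xy h); split; [apply: (b h).1|apply: (b h).2].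
Qed.

Lemma transport_id x : transport x x = \1%VF.
Proof. by rewrite (transport_down (qle_refl Q x)) rmap_id. Qed.

Lemma transport_comp x y z : comparable x y -> comparable y z -> comparable x z ->
  up_bij x y -> up_bij y z -> up_bij x z ->
  (transport y z \o transport x y)%VF = transport x z.
Proof.
move=> cxy cyz cxz bxy byz bxz.
case: cxy => [xy|yx]; case: cyz => [yz|zy].
- have xz := qle_trans yz xy.
  apply: (lbij_surj (bxz xz)); rewrite (transport_up xz bxz).1 (rmap_comp V yz xy xz).
  rewrite comp_lfunA -[X in (X \o _)%VF]comp_lfunA (transport_up xy bxy).1 comp_lfun1r.
  by rewrite (transport_up yz byz).1.
- rewrite (transport_down zy); case: cxz => [xz|zx].
    apply: (lbij_inj (bxz xz)); rewrite (transport_up xz bxz).2 comp_lfunA.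
    by rewrite -(rmap_comp V zy xz xy) (transport_up xy bxy).2.
  rewrite (transport_down zx) (rmap_comp V xy zx zy) -comp_lfunA.
  by rewrite (transport_up xy bxy).2 comp_lfun1r.
- rewrite (transport_down yx); case: cxz => [xz|zx].
    apply: (lbij_surj (bxz xz)); rewrite (transport_up xz bxz).1 -comp_lfunA.
    by rewrite -(rmap_comp V xz yx yz) (transport_up yz byz).1.
  rewrite (transport_down zx) (rmap_comp V zx yz yx) comp_lfunA.
  by rewrite (transport_up yz byz).1 comp_lfun1l.
- have zx := qle_trans yx zy.
  by rewrite (transport_down yx) (transport_down zy) (transport_down zx) (rmap_comp V yx zy zx).
Qed.

End Transport.

(** * Splitting off an interval along the classes of a colouring *)

Section Splitting.
Variables (k : fieldType) (R : realType) (Q : quiver R) (V : rep k Q).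
Variables (c : R -> nat) (N : nat).
Hypothesis rV : in_rep V.
Hypothesis cV : colouring V c N.
Implicit Types (x y z : R) (j e : nat).

Local Notation line := 'rV[k]_true.
Local Notation tr := (transport V).

Let rmap_id x (xx : qle Q x x) : rmap V xx = \1%VF := in_rep_rmap_id xx rV.
Let colour_le x y : x <= y -> (c x <= c y)%N. Proof. by case: cV => h _ _ _ _; apply: h. Qed.
Let same_bij x y (yx : qle Q y x) : c x = c y -> lbij (rmap V yx).
Proof. by case: cV => _ _ h _ _; apply: h. Qed.
Let same_dim x y : c x = c y -> \dim {:V x} = \dim {:V y}.
Proof. by case: cV => _ _ _ h _; apply: h. Qed.

Lemma colour_lt x y : (c x < c y)%N -> x < y.
Proof. by move=> h; rewrite ltNge; apply/negP => /colour_le; rewrite leqNgt h. Qed.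

Lemma adjacent_comparable x y : \dim {:V x} <> 0%N -> \dim {:V y} <> 0%N ->
  (forall z, ~ (c x < c z < c y)%N) -> (c x <= c y)%N -> comparable Q x y.
Proof.
move=> dx dy none cxy; case: cV => _ _ _ _ h; case: (leP x y) => xy.
  exact: h.
have e : c x = c y by apply/eqP; rewrite eqn_leq cxy colour_le // ltW.
by apply: comparable_sym; apply: h => //; [exact: ltW|move=> z; rewrite e; lia].
Qed.

Lemma same_comparable x y : \dim {:V x} <> 0%N -> c x = c y -> comparable Q x y.
Proof.
move=> dx e; apply: adjacent_comparable => //; first by rewrite -(same_dim e).
  by move=> z; rewrite e; lia.
by rewrite e.
Qed.

Lemma same_up x y : c x = c y -> up_bij V x y.
Proof. by move=> e h; apply: same_bij. Qed.

Lemma down_up x y : qle Q y x -> c x <> c y -> up_bij V x y.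
Proof. by move=> yx ne xy; exfalso; apply: ne; rewrite (qle_anti xy yx). Qed.

(* [w] and [l] are, on the colours [P], a map into V from the interval
   representation of the colours at most [e], and one from V to it, with
   composite the identity. *)
Definition partial_splitting (P : nat -> Prop) e
    (w : forall z, 'Hom(line, V z)) (l : forall z, 'Hom(V z, line)) : Prop :=
  (forall z, P (c z) -> ((c z <= e)%N -> (l z \o w z)%VF = \1%VF) /\
     ((e < c z)%N -> w z = 0 /\ l z = 0)) /\
  (forall x y (yx : qle Q y x), P (c x) -> P (c y) ->
     ((c x <= e)%N -> (rmap V yx \o w x)%VF = w y) /\
     ((c y <= e)%N -> (l y \o rmap V yx)%VF = l x)).

Lemma line_id_neq0 z (w : 'Hom(line, V z)) (l : 'Hom(V z, line)) :
  (l \o w)%VF = \1%VF -> \dim {:V z} <> 0%N.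
Proof.
move=> lw dz; rewrite (lfun_cod0 w 0 dz) comp_lfun0r in lw.
have : one_lfun k true true = 0 by rewrite one_lfun_id -lw.
move=> /lfunP/(_ (const_mx 1)); rewrite one_lfun_id id_lfunE zero_lfunE.
by move=> /matrixP/(_ 0 0); rewrite !mxE => /eqP; rewrite oner_eq0.
Qed.

(** Relations of both directions between two such classes would, by convexity of the order, yield
    two distinct points each below the other. *)
Lemma adjacent_down j j' : (j < j')%N ->
  (forall x y, c x = j -> c y = j' -> comparable Q x y) ->
  forall x y x' y', c x = j -> c x' = j -> c y = j' -> c y' = j' -> qle Q y x -> qle Q y' x'.
Proof.
move=> lt cmp x y x' y' ex ex' ey ey' yx.
have xy : x < y by apply: colour_lt; rewrite ex ey.
have x'y : x' < y by apply: colour_lt; rewrite ex' ey.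
have x'y' : x' < y' by apply: colour_lt; rewrite ex' ey'.
have yx' : qle Q y x'.
  case: (cmp x' y ex' ey) => // h; exfalso; case: (leP x x') => xx'.
    have [yx' _] := qle_conv yx (z := x') ltac:(lra).
    by move: x'y; rewrite (qle_anti yx' h) ltxx.
  have [_ xy1] := qle_conv h (z := x) ltac:(lra).
  by move: xy; rewrite (qle_anti yx xy1) ltxx.
case: (leP y y') => yy'.
  case: (cmp x' y' ex' ey') => // h; exfalso.
  have [x'y1 _] := qle_conv h (z := y) ltac:(lra).
  by move: x'y; rewrite (qle_anti yx' x'y1) ltxx.
by have [] := qle_conv yx' (z := y') ltac:(lra).
Qed.

Lemma adjacent_up j j' : (j < j')%N ->
  (forall x y, c x = j -> c y = j' -> comparable Q x y) ->
  forall x y x' y', c x = j -> c x' = j -> c y = j' -> c y' = j' -> qle Q x y -> qle Q x' y'.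
Proof.
move=> lt cmp x y x' y' ex ex' ey ey' xy; case: (cmp x' y' ex' ey') => // y'x'; exfalso.
have yx := adjacent_down lt cmp ex' ex ey' ey y'x'.
by move: lt; rewrite -ex -ey (qle_anti xy yx) ltnn.
Qed.

Lemma partial_transport (P : nat -> Prop) e w l x y : partial_splitting P e w l -> P (c x) ->
  c x = c y -> \dim {:V x} <> 0%N -> (tr x y \o w x)%VF = w y /\ (l y \o tr x y)%VF = l x.
Proof.
move=> [h1 h2] Px exy dx; have Py : P (c y) by rewrite -exy.
case: (leqP (c x) e) => ce; last first.
  have [_ /(_ ce)[-> ->]] := h1 _ Px.
  by rewrite exy in ce; have [_ /(_ ce)[-> ->]] := h1 _ Py; rewrite comp_lfun0l comp_lfun0r.
have ce' : (c y <= e)%N by rewrite -exy.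
case: (same_comparable dx exy) => [xy|yx].
  have [/(_ ce') e1 /(_ ce) e2] := h2 _ _ xy Py Px.
  have [t1 t2] := transport_up rmap_id xy (same_up exy).
  by rewrite -e1 -e2 comp_lfunA t1 comp_lfun1l -comp_lfunA t2 comp_lfun1r.
by rewrite (transport_down V yx); have [/(_ ce) -> /(_ ce') ->] := h2 _ _ yx Px Py.
Qed.

(** One more class is added on the left. Inside it [w0] and [l0] are carried by [transport], and all
    relations with the next class reduce to the one between [x0] and [x1]. The premise on [x1] is
    conditional so that the last class is covered too. *)
Lemma extend_splitting x0 e w l (w0 : 'Hom(line, V x0)) (l0 : 'Hom(V x0, line)) x1 :
  (c x0 <= e)%N -> (l0 \o w0)%VF = \1%VF ->
  partial_splitting (fun i => (c x0 < i)%N) e w l ->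
  ((exists z, (c x0 < c z)%N) ->
   [/\ (c x0 < c x1)%N, (forall z, (c x0 < c z)%N -> (c x1 <= c z)%N),
    (forall h : qle Q x1 x0, (rmap V h \o w0)%VF = w x1 /\
      ((c x1 <= e)%N -> (l x1 \o rmap V h)%VF = l0))
   & (forall h : qle Q x0 x1, (l0 \o rmap V h)%VF = l x1 /\
      ((c x1 <= e)%N -> (rmap V h \o w x1)%VF = w0))]) ->
  exists w' l', [/\ w' x0 = w0, l' x0 = l0 &
    partial_splitting (fun i => (c x0 <= i)%N) e w' l'].
Proof.
move=> ce lw ps next; have d0 := line_id_neq0 lw; have [h1 h2] := ps.
pose j := c x0.
pose w' z := if c z == j then (tr x0 z \o w0)%VF else w z.
pose l' z := if c z == j then (l0 \o tr z x0)%VF else l z.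
have w'j z : c z = j -> w' z = (tr x0 z \o w0)%VF by rewrite /w' => ->; rewrite eqxx.
have l'j z : c z = j -> l' z = (l0 \o tr z x0)%VF by rewrite /l' => ->; rewrite eqxx.
have w't z : (j < c z)%N -> w' z = w z by rewrite /w'; case: eqP => // ->; rewrite ltnn.
have l't z : (j < c z)%N -> l' z = l z by rewrite /l'; case: eqP => // ->; rewrite ltnn.
have dj z : c z = j -> \dim {:V z} <> 0%N by move=> ez; rewrite (same_dim (y := x0)).
have cj x y : c x = j -> c y = j -> comparable Q x y.
  by move=> ex ey; apply: same_comparable; [apply: dj|rewrite ex ey].
have uj x y : c x = j -> c y = j -> up_bij V x y by move=> ex ey; apply: same_up; rewrite ex ey.
have ej : c x0 = j by [].
have trj x y z : c x = j -> c y = j -> c z = j -> (tr y z \o tr x y)%VF = tr x z.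
  by move=> *; apply: (transport_comp rmap_id); auto.
exists w', l'; split.
- by rewrite w'j // (transport_id rmap_id) comp_lfun1l.
- by rewrite l'j // (transport_id rmap_id) comp_lfun1r.
have w'0 z : (j < c z)%N -> \dim {:V z} = 0%N -> (e < c z)%N.
  move=> jz dz; rewrite ltnNge; apply/negP => cze.
  by have := line_id_neq0 ((h1 _ jz).1 cze).
split.
  move=> z; rewrite leq_eqVlt => /orP[/eqP/esym ez|jz].
    split; last by rewrite ez ltnNge ce.
    move=> _; rewrite w'j // l'j // comp_lfunA -[X in (X \o _)%VF]comp_lfunA trj //.
    by rewrite (transport_id rmap_id) comp_lfun1r.
  by rewrite w't // l't //; apply: h1.
have cmp : (exists z, (j < c z)%N) -> \dim {:V x1} <> 0%N ->
    forall x y, c x = j -> c y = c x1 -> comparable Q x y.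
  move=> /next[lt min _ _] d1 x y ex ey; apply: adjacent_comparable; first exact: dj.
  - by rewrite (same_dim ey).
  - by move=> z; rewrite ex ey => /andP[/min]; rewrite leqNgt => /negP.
  - by rewrite ex ey ltnW.
have down x y (yx : qle Q y x) : c x = j -> c y = c x1 -> (j < c y)%N ->
    (rmap V yx \o w' x)%VF = w y /\ ((c y <= e)%N -> (l y \o rmap V yx)%VF = l' x).
  move=> ex ey jy; have jne : exists z, (j < c z)%N by exists y.
  have [lt min S1 _] := next jne.
  case: (\dim {:V y} =P 0%N) => [dy|dy].
    split; first exact: lfun_cod0.
    by move=> cye; have := w'0 y jy dy; rewrite ltnNge cye.
  have d1 : \dim {:V x1} <> 0%N by rewrite -(same_dim ey).
  have cxy := cmp jne d1.
  have yx0 : qle Q y x0 := adjacent_down lt cxy ex ej ey ey yx.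
  have x1x0 : qle Q x1 x0 := adjacent_down lt cxy ex ej ey erefl yx.
  have x1x : qle Q x1 x := adjacent_down lt cxy ex ex ey erefl yx.
  have nej a b : c a = j -> c b = c x1 -> c a <> c b by move=> -> ->; move: lt; rewrite /j; lia.
  have cx1y : comparable Q x1 y by apply: same_comparable.
  have ux1y : up_bij V x1 y by apply: same_up.
  have [tw tl] := partial_transport ps lt (esym ey) d1.
  have [s1 s2] := S1 x1x0.
  have t1 : (tr x y \o tr x0 x)%VF = tr x0 y.
    by apply: (transport_comp rmap_id); auto; apply: down_up; auto.
  have t2 : (tr x1 y \o tr x0 x1)%VF = tr x0 y.
    by apply: (transport_comp rmap_id); auto; apply: down_up; auto.
  have t3 : (tr x0 x1 \o tr x x0)%VF = tr x x1.
    by apply: (transport_comp rmap_id); auto; apply: down_up; auto.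
  have t4 : (tr x1 y \o tr x x1)%VF = tr x y.
    by apply: (transport_comp rmap_id); auto; apply: down_up; auto.
  rewrite -(transport_down V yx); split=> [|cye].
    rewrite w'j // comp_lfunA t1 -t2 -comp_lfunA (transport_down V x1x0) s1 //.
  rewrite l'j // -t4 comp_lfunA tl -t3 comp_lfunA (transport_down V x1x0) s2 //.
  by rewrite -ey.
have up x y (xy : qle Q x y) : c x = j -> c y = c x1 -> (j < c y)%N ->
    (l' x \o rmap V xy)%VF = l y /\ ((c y <= e)%N -> (rmap V xy \o w y)%VF = w' x).
  move=> ex ey jy; have jne : exists z, (j < c z)%N by exists y.
  have [lt min _ S2] := next jne.
  case: (\dim {:V y} =P 0%N) => [dy|dy].
    split; first exact: lfun_dom0.
    by move=> cye; have := w'0 y jy dy; rewrite ltnNge cye.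
  have d1 : \dim {:V x1} <> 0%N by rewrite -(same_dim ey).
  have cxy := cmp jne d1.
  have x0y : qle Q x0 y := adjacent_up lt cxy ex ej ey ey xy.
  have x0x1 : qle Q x0 x1 := adjacent_up lt cxy ex ej ey erefl xy.
  have xx1 : qle Q x x1 := adjacent_up lt cxy ex ex ey erefl xy.
  have nej a b : c a = j -> c b = c x1 -> c b <> c a by move=> -> ->; move: lt; rewrite /j; lia.
  have cyx1 : comparable Q y x1 by apply: same_comparable.
  have uyx1 : up_bij V y x1 by apply: same_up.
  have [tw tl] := partial_transport ps jy ey dy.
  have [s1 s2] := S2 x0x1.
  have cmp' a b : c a = j -> c b = c x1 -> comparable Q b a by move=> *; apply: comparable_sym; apply: cxy.
  have t1 : (tr x x0 \o tr y x)%VF = tr y x0.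
    by apply: (transport_comp rmap_id); auto; apply: down_up; auto.
  have t2 : (tr x1 x0 \o tr y x1)%VF = tr y x0.
    by apply: (transport_comp rmap_id); auto; apply: down_up; auto.
  have t3 : (tr x0 x \o tr x1 x0)%VF = tr x1 x.
    by apply: (transport_comp rmap_id); auto; apply: down_up; auto.
  have t4 : (tr x1 x \o tr y x1)%VF = tr y x.
    by apply: (transport_comp rmap_id); auto; apply: down_up; auto.
  rewrite -(transport_down V xy); split=> [|cye].
    by rewrite l'j // -comp_lfunA t1 -t2 comp_lfunA (transport_down V x0x1) s1.
  rewrite w'j // -t4 -comp_lfunA tw -t3 -comp_lfunA (transport_down V x0x1) s2 //.
  by rewrite -ey.
move=> x y yx; rewrite leq_eqVlt => /orP[/eqP/esym ex|jx]; rewrite leq_eqVlt => /orP[/eqP/esym ey|jy].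
- rewrite -(transport_down V yx) !w'j // !l'j //; split=> _.
    by rewrite comp_lfunA trj.
  by rewrite -comp_lfunA trj.
- rewrite (w't y) // (l't y) //.
  have [lt min _ _] := next (ex_intro _ y jy).
  (* A relation that jumps past the class of [x1] factors through [x1] by convexity. *)
  case: (ltngtP (c y) (c x1)) => cy; first by have := min y jy; lia.
    have x1y : x1 < y by apply: colour_lt.
    have xx1 : x < x1 by apply: colour_lt; rewrite ex.
    have [yx1 x1x] := qle_conv yx (z := x1) ltac:(lra).
    have [d1 d2] := down x x1 x1x ex erefl lt.
    have [g1 g2] := h2 _ _ yx1 lt jy.
    rewrite (rmap_comp V x1x yx1 yx); split=> cle.
      rewrite -comp_lfunA d1; case: (leqP (c x1) e) => c1e; first exact: g1.
      have [-> _] := (h1 _ lt).2 c1e; have [-> _] := (h1 _ jy).2 (ltn_trans c1e cy).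
      by rewrite comp_lfun0r.
    by rewrite comp_lfunA (g2 cle) d2 //; apply: leq_trans (ltnW cy) cle.
  by have [d1 d2] := down x y yx ex cy jy.
- rewrite (w't x) // (l't x) //.
  have [lt min _ _] := next (ex_intro _ x jx).
  case: (ltngtP (c x) (c x1)) => cx; first by have := min x jx; lia.
    have x1x : x1 < x by apply: colour_lt.
    have yx1 : y < x1 by apply: colour_lt; rewrite ey.
    have [yx1' x1x'] := qle_conv yx (z := x1) ltac:(lra).
    have [d1 d2] := up y x1 yx1' ey erefl lt.
    have [g1 g2] := h2 _ _ x1x' jx lt.
    rewrite (rmap_comp V x1x' yx1' yx); split=> cle.
      by rewrite -comp_lfunA (g1 cle) d2 //; apply: leq_trans (ltnW cx) cle.
    rewrite comp_lfunA d1; case: (leqP (c x1) e) => c1e; first exact: g2.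
    have [_ ->] := (h1 _ lt).2 c1e; have [_ ->] := (h1 _ jx).2 (ltn_trans c1e cx).
    by rewrite comp_lfun0l.
  by have [d1 d2] := up y x yx ey cx jx.
by rewrite !w't // !l't //; apply: h2.
Qed.

(** Induction on the number of remaining colours. The direction of the map between [x0] and the next
    class decides between images and preimages, and the pair obtained from there is lifted back to
    [x0]. *)
Lemma splitting_from x0 (X Y : {vspace V x0}) : (Y <= X)%VS -> ~~ (X <= Y)%VS ->
  exists e w l, [/\ (c x0 <= e)%N, line_pair X Y (w x0) (l x0) &
    partial_splitting (fun i => (c x0 <= i)%N) e w l].
Proof.
have [d] := ubnP (N - c x0); elim: d x0 X Y => // d IH x0 X Y hd YX XY.
(* The interval ends at the class of [x0]: [e] is [c x0], and both families are zero on later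
   classes. *)
have stop w0 l0 x1 : line_pair X Y w0 l0 ->
    ((exists z, (c x0 < c z)%N) ->
     [/\ (c x0 < c x1)%N, (forall z, (c x0 < c z)%N -> (c x1 <= c z)%N),
       (forall h : qle Q x1 x0, (rmap V h \o w0)%VF = 0)
     & (forall h : qle Q x0 x1, (l0 \o rmap V h)%VF = 0)]) ->
    exists e w l, [/\ (c x0 <= e)%N, line_pair X Y (w x0) (l x0) &
      partial_splitting (fun i => (c x0 <= i)%N) e w l].
  move=> lp next; have [_ _ lw] := lp.
  have [||w' [l' [e1 e2 ps]]] := @extend_splitting x0 (c x0) (fun z => 0) (fun z => 0) w0 l0 x1 (leqnn _) lw.
  - split=> [z jz|x y yx jx jy].
      by split=> // h; move: jz; rewrite ltnNge h.
    by rewrite comp_lfun0l comp_lfun0r.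
  - move=> /next[lt min S1 S2]; split=> // h; split; rewrite ?S1 ?S2 // leqNgt lt //.
  by exists (c x0), w', l'; rewrite e1 e2.
case: (pselect (exists z, (c x0 < c z)%N)) => [ne|none]; last first.
  have [w0 [l0 lp]] := line_pair_exists XY.
  by apply: (stop w0 l0 x0 lp).
have [x1 lt min] : exists2 x1, (c x0 < c x1)%N & forall z, (c x0 < c z)%N -> (c x1 <= c z)%N.
  pose P i := `[< exists2 z, (c x0 < c z)%N & c z = i >].
  have exP : exists i, P i by have [z hz] := ne; exists (c z); apply/asboolP; exists z.
  case: (ex_minnP exP) => i /asboolP[z hz <-] mini; exists z => // y hy.
  by apply: mini; apply/asboolP; exists y.
have hd1 : (N - c x1 < d)%N.
  have : (c x1 <= N)%N by case: cV => _ h _ _ _; apply: h.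
  by move: hd lt; lia.
have ps_lt e w l : partial_splitting (fun i => (c x1 <= i)%N) e w l ->
    partial_splitting (fun i => (c x0 < i)%N) e w l.
  move=> [h1 h2]; split=> [z /min|x y yx /min jx /min jy]; first exact: h1.
  exact: h2.
case: (\dim {:V x1} =P 0%N) => [d1|d1].
  have [w0 [l0 lp]] := line_pair_exists XY.
  apply: (stop w0 l0 x1 lp) => _; split=> // h; first exact: lfun_cod0.
  exact: lfun_dom0.
have d0 : \dim {:V x0} <> 0%N.
  move=> /eqP; rewrite dimv_eq0 => /eqP V0; move: XY; apply/negP; rewrite negbK.
  by apply: subv_trans (subvf X) _; rewrite V0 sub0v.
have : comparable Q x0 x1.
  apply: adjacent_comparable => //; last exact: ltnW.
  by move=> z /andP[/min]; rewrite leqNgt => /negP.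
case=> [h01|h10].
  have nh : ~ qle Q x1 x0 by move=> h; move: lt; rewrite (qle_anti h01 h) ltnn.
  case: (line_pair_backward (rmap V h01) YX XY) => [[w0 [l0 [lp z0]]]|[X' [Y' [YX' XY' lift]]]].
    apply: (stop w0 l0 x1 lp) => _; split=> // h.
    by rewrite (rmap_irr V h h01).
  have [e [w [l [c1e lp1 ps]]]] := IH x1 X' Y' hd1 YX' XY'.
  have [l0 [lp l0m]] := lift _ _ lp1; have [_ _ lw] := lp.
  have [||w' [l' [e1 e2 ps']]] := @extend_splitting x0 e w l _ l0 x1 _ lw (ps_lt _ _ _ ps).
  - exact: leq_trans (ltnW lt) c1e.
  - move=> _; split=> // h; rewrite (rmap_irr V h h01); split=> //.
  by exists e, w', l'; rewrite e1 e2; split=> //; apply: leq_trans (ltnW lt) c1e.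
have nh : ~ qle Q x0 x1 by move=> h; move: lt; rewrite (qle_anti h10 h) ltnn.
case: (line_pair_forward (rmap V h10) YX XY) => [[w0 [l0 [lp z0]]]|[X' [Y' [YX' XY' lift]]]].
  apply: (stop w0 l0 x1 lp) => _; split=> // h.
  by rewrite (rmap_irr V h h10).
have [e [w [l [c1e lp1 ps]]]] := IH x1 X' Y' hd1 YX' XY'.
have [w0 [lp mw0]] := lift _ _ lp1; have [_ _ lw] := lp.
have [||w' [l' [e1 e2 ps']]] := @extend_splitting x0 e w l w0 _ x1 _ lw (ps_lt _ _ _ ps).
- exact: leq_trans (ltnW lt) c1e.
- move=> _; split=> // h; rewrite (rmap_irr V h h10); split=> //.
by exists e, w', l'; rewrite e1 e2; split=> //; apply: leq_trans (ltnW lt) c1e.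
Qed.

End Splitting.

Section IntervalSummand.
Variables (k : fieldType) (R : realType) (Q : quiver R).
Implicit Types (V : rep k Q) (x y z : R).

Local Notation line := 'rV[k]_true.

Lemma splitting_square_in (A B : vectType k) (m : 'Hom(A, B)) (b b' : bool)
    (w : 'Hom(line, A)) (w' : 'Hom(line, B)) :
  (b -> (m \o w)%VF = w') -> (b -> ~~ b' -> w' = 0) ->
  ((w' \o one_lfun k b' true) \o scal_lfun \1%VF b b' = m \o (w \o one_lfun k b true))%VF.
Proof.
case: b; last by move=> _ _; apply: lfun_dom0; exact: (dim_row k false).
move=> /(_ isT) mw /(_ isT); case: b' => [_|/(_ isT) w0].
  by rewrite scal_lfun_true !one_lfun_id !comp_lfun1r.
by rewrite [RHS]comp_lfunA mw w0 !comp_lfun0l.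
Qed.

Lemma splitting_square_out (A B : vectType k) (m : 'Hom(A, B)) (b b' : bool)
    (l : 'Hom(A, line)) (l' : 'Hom(B, line)) :
  (b' -> (l' \o m)%VF = l) -> (b' -> ~~ b -> l = 0) ->
  ((one_lfun k true b' \o l') \o m = scal_lfun \1%VF b b' \o (one_lfun k true b \o l))%VF.
Proof.
case: b'; last by move=> _ _; apply: lfun_cod0; exact: (dim_row k false).
move=> /(_ isT) lm /(_ isT); case: b => [_|/(_ isT) l0].
  by rewrite scal_lfun_true !one_lfun_id !comp_lfun1l.
by rewrite -[LHS]comp_lfunA lm l0 !comp_lfun0r.
Qed.

Lemma splitting_id (A : vectType k) (b : bool) (w : 'Hom(line, A)) (l : 'Hom(A, line)) :
  (b -> (l \o w)%VF = \1%VF) ->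
  ((one_lfun k true b \o l) \o (w \o one_lfun k b true) = \1)%VF.
Proof.
case: b; last by move=> _; apply: lfun_dom0; exact: (dim_row k false).
by move=> /(_ isT); rewrite !one_lfun_id comp_lfun1l comp_lfun1r.
Qed.

Lemma interval_summand V : in_rep V -> ~ is_zero V ->
  exists I (i : rep_hom (itv_rep k Q I) V) (p : rep_hom V (itv_rep k Q I)),
    (exists x, supp I x) /\ forall x, (p x \o i x)%VF = \1%VF.
Proof.
move=> rV nz; have [c [N cV]] := colouring_exists rV.
(* Starting at the smallest colour where [V] is nonzero leaves nothing to check to its left. *)
have [x0 d0 min0] : exists2 x0, \dim {:V x0} <> 0%N & forall z, \dim {:V z} <> 0%N -> (c x0 <= c z)%N.
  pose P i := `[< exists2 z, \dim {:V z} <> 0%N & c z = i >].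
  have exP : exists i, P i.
    apply: contrapT => h; apply: nz => z; apply: contrapT => dz; apply: h.
    by exists (c z); apply/asboolP; exists z.
  case: (ex_minnP exP) => i /asboolP[z hz <-] mini; exists z => // y hy.
  by apply: mini; apply/asboolP; exists y.
have Xn0 : ~~ ({:V x0} <= 0)%VS.
  by rewrite subv0 -dimv_eq0; apply/eqP.
have [e [w [l [ce lp [h1 h2]]]]] := splitting_from rV cV (sub0v _) Xn0.
have mc x y : x <= y -> (c x <= c y)%N by case: cV => h _ _ _ _; apply: h.
pose K : set R := [set z | (c x0 <= c z <= e)%N].
have cK : convex_set K.
  move=> x y z /andP[a _] /andP[_ b] xy yz; apply/andP; split.
    exact: leq_trans a (mc _ _ xy).
  exact: leq_trans (mc _ _ yz) b.
have [I eI] := convex_supp cK.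
have IK z : z%:E \in I -> (c x0 <= c z <= e)%N by move=> Iz; have : supp I z by []; rewrite eI.
have nIK z : z%:E \notin I -> (c x0 <= c z)%N -> (e < c z)%N.
  move=> nI cz; rewrite ltnNge; apply: contra nI => ze.
  by have : supp I z by rewrite eI /K /= cz ze.
pose i x : 'Hom(itv_rep k Q I x, V x) := (w x \o one_lfun k (x%:E \in I) true)%VF.
pose p x : 'Hom(V x, itv_rep k Q I x) := (one_lfun k true (x%:E \in I) \o l x)%VF.
have inat x y (yx : qle Q y x) : (i y \o rmap (itv_rep k Q I) yx = rmap V yx \o i x)%VF.
  rewrite itv_rmapE /i; case: (leqP (c x0) (c y)) => cy.
    apply: splitting_square_in => [/IK/andP[cx xe]|Ix ny].
      by have [-> //] := h2 _ _ yx cx cy.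
    by have [] := (h1 y cy).2 (nIK y ny cy).
  apply: lfun_cod0; apply: contrapT => /min0; by rewrite leqNgt cy.
have pnat x y (yx : qle Q y x) : (p y \o rmap V yx = rmap (itv_rep k Q I) yx \o p x)%VF.
  rewrite itv_rmapE /p; case: (leqP (c x0) (c x)) => cx.
    apply: splitting_square_out => [/IK/andP[cy ye]|Iy nx].
      by have [_ ->] := h2 _ _ yx cx cy.
    by have [] := (h1 x cx).2 (nIK x nx cx).
  apply: lfun_dom0; apply: contrapT => /min0; by rewrite leqNgt cx.
exists I, (RepHom inat), (RepHom pnat); split.
  by exists x0; rewrite eI /K /= leqnn ce.
by move=> x /=; apply: splitting_id => /IK/andP[cx xe]; apply: (h1 x cx).1.
Qed.

Lemma indecomposable_interval V : in_rep V -> indecomposable V ->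
  exists I (t : rep_hom V (itv_rep k Q I)), (forall x, lbij (t x)) /\ exists x, supp I x.
Proof.
move=> rV iV; have [I [i [p [ne pi]]]] := interval_summand rV iV.1.
have bi := retract_bij rV iV ((itv_is_zero k Q I).2 ne) pi.
exists I, p; split=> // x; apply: (lbij_of_inverse _ (pi x)).
by apply: (lbij_surj (bi x)); rewrite -comp_lfunA pi comp_lfun1r comp_lfun1l.
Qed.

End IntervalSummand.

(** * Auslander-Reiten sequences *)

Section Lifting.
Variables (k : fieldType) (R : realType) (Q : quiver R).
Variables (V : rep k Q) (L : interval (\bar R)) (g : rep_hom V (itv_rep k Q L)).
Implicit Types (x y z : R) (A B : set R).

Hypothesis not_retraction :
  ~ exists s : rep_hom (itv_rep k Q L) V, forall x, (g x \o s x)%VF = \1%VF.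
Hypothesis lifting : forall K (h : rep_hom (itv_rep k Q K) (itv_rep k Q L)),
  in_rep (itv_rep k Q K) -> (exists x, supp K x) -> supp K <> supp L -> nonzero_hom h ->
  exists h' : rep_hom (itv_rep k Q K) V, forall x, (g x \o h' x)%VF = h x.

Lemma itv_lfun_comp (I J K : interval (\bar R)) x y z :
  (x%:E \in I -> z%:E \in K -> y%:E \in J) ->
  (itv_lfun k J K y z \o itv_lfun k I J x y)%VF = itv_lfun k I K x z.
Proof.
by move=> h; rewrite -one_lfun_comp //; apply/implyP => /andP[Ix Kz]; apply: h.
Qed.

Lemma itv_rep_dom0 (K : interval (\bar R)) x (A : vectType k) (f f' : 'Hom(itv_rep k Q K x, A)) :
  x%:E \notin K -> f = f'.
Proof.
by move=> nK; apply: lfun_dom0; apply: etrans (dim_row k (x%:E \in K)) _; rewrite (negPf nK).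
Qed.

Lemma itv_lfun_id (K : interval (\bar R)) x : itv_lfun k K K x x = \1%VF.
Proof. exact: one_lfun_id. Qed.

Lemma can_hom_bij (I K : interval (\bar R)) (ok : hom_ok Q (supp I) (supp K)) x :
  (x%:E \in I) = (x%:E \in K) -> lbij (can_hom k ok x).
Proof. by move=> e; apply: scal_lfun_bij e (lbij1 _). Qed.

Lemma can_hom_nonzero (I K : interval (\bar R)) (ok : hom_ok Q (supp I) (supp K)) :
  (exists x, supp I x /\ supp K x) -> nonzero_hom (can_hom k ok).
Proof.
move=> [x [/suppP Ix /suppP Kx]]; exists x.
have b : lbij (can_hom k ok x) by apply: can_hom_bij; rewrite Ix Kx.
apply/eqP => e; have := lbij_lker b.
have -> : lker (can_hom k ok x) = fullv.
  by apply/vspaceP => v; rewrite memv_ker e zero_lfunE eqxx memvf.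
move=> /eqP; rewrite -dimv_eq0; apply/negP.
by rewrite (etrans (erefl _) (dim_row k (x%:E \in I))) Ix.
Qed.

(** The Yoneda argument: the generator at [p] is lifted by the pseudo-inverse of [g p], and the lift
    is pushed along the relations from [p] to obtain a section. *)
Lemma projective_absurd p : supp L = [set x | qle Q x p] -> is_epi g -> False.
Proof.
move=> eL eg; have Lp z : z%:E \in L -> qle Q z p.
  by move=> Lz; have : supp L z by []; rewrite eL.
have pL : p%:E \in L.
  by have : supp L p by rewrite eL; apply: qle_refl.
pose w := (g p)^-1%VF : 'Hom(itv_rep k Q L p, V p).
have gw : (g p \o w)%VF = \1%VF.
  by have := @lfun_limgK _ _ _ _ (g p) \1%VF; rewrite comp_lfun1r; apply; rewrite eg subvf.
pose s z : 'Hom(itv_rep k Q L z, V z) :=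
  match pselect (qle Q z p) with
  | left h => (rmap V h \o w \o itv_lfun k L L z p)%VF
  | right _ => 0
  end.
have sE z (h : qle Q z p) : s z = (rmap V h \o w \o itv_lfun k L L z p)%VF.
  by rewrite /s; case: pselect => // h'; rewrite (rmap_irr V h' h).
have snat y z (zy : qle Q z y) : (s z \o rmap (itv_rep k Q L) zy = rmap V zy \o s y)%VF.
  case: (boolP (y%:E \in L)) => Ly; last exact: itv_rep_dom0.
  have yp := Lp y Ly; have zp := qle_trans yp zy.
  rewrite (sE z zp) (sE y yp) -[LHS]comp_lfunA (@itv_lfun_comp L L L y z p) //; last first.
    by move=> _ _; have : supp L z by rewrite eL.
  by rewrite (rmap_comp V yp zy zp) !comp_lfunA.
apply: not_retraction; exists (RepHom snat) => z /=.
case: (boolP (z%:E \in L)) => Lz; last exact: itv_rep_dom0.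
have zp := Lp z Lz; have gsz : (g z \o (rmap V zp \o w))%VF = rmap (itv_rep k Q L) zp.
  by rewrite comp_lfunA happ_nat -comp_lfunA gw comp_lfun1r.
rewrite (sE z zp) comp_lfunA gsz (@itv_lfun_comp L L L z p z) //.
exact: itv_lfun_id.
Qed.

(** When [A2] contains [A], the map from [M_K] to [M_L] is onto and the lift kills its kernel, so it
    factors. When [A2] lies in [A], the lift is extended over the missing piece by inverting maps of
    [V] inside one class. *)
Lemma bad_end_absurd c N fam A B : colouring V c N -> supp L = A `&` B ->
  bad_end Q c fam A B ->
  (forall A2, fam A2 -> exists K, supp K = A2 `&` B /\ in_rep (itv_rep k Q K)) -> False.
Proof.
move=> [_ _ bV _ _] eL [A2 [fA2 hA2 [p [p1 p2 p3]] [[d0 nd0] hd] H]] hfam.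
have [K [eK rK]] := hfam _ fA2.
have LE z : z%:E \in L <-> A z /\ B z by rewrite -suppP eL.
have KE z : z%:E \in K <-> A2 z /\ B z by rewrite -suppP eK.
have ok : hom_ok Q (supp K) (supp L) by rewrite eK eL; exact: hom_okI hA2 (@hom_ok_refl R Q B).
have neKL : supp K <> supp L.
  move=> e; have Bd := hd d0 nd0; apply: nd0.
  have [h1 h2] : (A2 `&` B) d0 <-> (A `&` B) d0 by rewrite -eK e eL.
  by split=> [a|a]; [have [] := h2 (conj a Bd)|have [] := h1 (conj a Bd)].
have [||h gh] := lifting (h := can_hom k ok) rK _ neKL.
- by exists p; rewrite eK.
- by apply: can_hom_nonzero; exists p; rewrite eK eL.
case: H => [[sub H]|[sub [x [A2x Bx H]]]].
- have h0 d : A2 d -> ~ A d -> h d = 0.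
    move=> A2d nAd; have [y [yd nA2y cy]] := H d A2d nAd.
    have := happ_nat h yd; rewrite (itv_rep_dom0 (h y) 0); last by apply/negP => /KE[].
    rewrite comp_lfun0l => e.
    by apply: (lbij_inj (bV _ _ yd (esym cy))); rewrite -e comp_lfun0r.
  have LK z : z%:E \in L -> z%:E \in K by move=> /LE[Az Bz]; apply/KE; split => //; apply: sub.
  have epi_can : is_epi (can_hom k ok).
    move=> z; case: (boolP (z%:E \in L)) => Lz.
      by apply: lbij_limg; apply: can_hom_bij; rewrite Lz LK.
    by apply/eqP; rewrite eqEdim subvf (etrans (erefl _) (dim_row k (z%:E \in L))) (negPf Lz).
  have [z|s hs] := factor_epi (h := h) epi_can.
    case: (boolP (z%:E \in L)) => Lz.
      by rewrite (lbij_lker (can_hom_bij _ _)) ?sub0v // Lz LK.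
    have -> : h z = 0.
      case: (boolP (z%:E \in K)) => Kz; last exact: itv_rep_dom0.
      have [A2z Bz] := (KE z).1 Kz; apply: h0 => // Az.
      by move/negP: Lz; apply; apply/LE.
    by apply/subvP => v _; rewrite memv_ker zero_lfunE.
  apply: not_retraction; exists s => z.
  by apply: (epi_cancel epi_can); rewrite -comp_lfunA hs gh comp_lfun1l.
have KL z : z%:E \in K -> z%:E \in L by move=> /KE[A2z Bz]; apply/LE; split => //; apply: sub.
have Kx : x%:E \in K by apply/KE.
pose D z := A z /\ ~ A2 z.
have DB z : D z -> B z by move=> [Az nz]; apply: hd => -[/(_ Az)].
have Dx z : D z -> qle Q x z by move=> [Az nz]; have [] := H z Az nz.
have LD z : z%:E \in L -> D z \/ z%:E \in K.
  move=> /LE[Az Bz]; case: (pselect (A2 z)) => a; [right|by left].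
  by apply/KE.
pose s z : 'Hom(itv_rep k Q L z, V z) :=
  match pselect (D z) with
  | left dz => ((rmap V (Dx z dz))^-1 \o (h x \o itv_lfun k L K z x))%VF
  | right _ => (h z \o itv_lfun k L K z z)%VF
  end.
have Dbij z (xz : qle Q x z) : D z -> lbij (rmap V xz).
  by move=> [Az nz]; apply: bV; have [_ ->] := H z Az nz.
have sD z (dz : D z) (xz : qle Q x z) : (rmap V xz \o s z)%VF = (h x \o itv_lfun k L K z x)%VF.
  rewrite /s; case: pselect => // dz'; rewrite (rmap_irr V (Dx z dz') xz) comp_lfunA.
  by rewrite (Dbij z xz dz).2 comp_lfun1l.
have sK z : ~ D z -> s z = (h z \o itv_lfun k L K z z)%VF by rewrite /s; case: pselect.
have snat z y (yz : qle Q y z) : (s y \o rmap (itv_rep k Q L) yz = rmap V yz \o s z)%VF.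
  case: (boolP (z%:E \in L)) => Lz; last exact: itv_rep_dom0.
  case: (pselect (D z)) => [dz|ndz].
    have xz := Dx z dz; case: (pselect (D y)) => [dy|ndy].
      have xy := Dx y dy; apply: (lbij_inj (Dbij y xy dy)).
      rewrite [RHS]comp_lfunA -(rmap_comp V yz xy xz) (sD z dz xz) [LHS]comp_lfunA (sD y dy xy).
      rewrite -comp_lfunA (@itv_lfun_comp L L K z y x) // => _ _.
      by apply/LE; split; [case: dy|apply: DB].
    (* A relation that leaves the missing piece passes through [x], where the extended map is
       already known. *)
    have yx : qle Q y x.
      have [Az nz] := dz; have [_ _ h3] := H z Az nz.
      by case: (h3 y yz) => // -[Ay nA2y]; exfalso; apply: ndy.
    rewrite (rmap_comp V xz yx yz) -[RHS]comp_lfunA (sD z dz xz) [RHS]comp_lfunA -happ_nat.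
    rewrite (sK y ndy) -[LHS]comp_lfunA -[RHS]comp_lfunA.
    rewrite (@itv_lfun_comp L L K z y y); last by move=> _ /KL.
    by rewrite (@itv_lfun_comp L K K z x y).
  have Kz : z%:E \in K by case: (LD z Lz).
  (* No relation leads from [K] into the missing piece: [hom_ok] from [A2] to [A] would put [y] in
     [A2]. *)
  have ndy : ~ D y.
    move=> [Ay nA2y]; apply: nA2y; have [A2z Bz] := (KE z).1 Kz.
    by apply/(hA2 z y yz A2z Ay)/sub.
  rewrite (sK y ndy) (sK z ndz) [RHS]comp_lfunA -happ_nat -[LHS]comp_lfunA -[RHS]comp_lfunA.
  rewrite (@itv_lfun_comp L L K z y y); last by move=> _ /KL.
  by rewrite (@itv_lfun_comp L K K z z y).
apply: not_retraction; exists (RepHom snat) => z /=.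
case: (boolP (z%:E \in L)) => Lz; last exact: itv_rep_dom0.
case: (pselect (D z)) => [dz|ndz].
  have xz := Dx z dz.
  have bL : lbij (rmap (itv_rep k Q L) xz).
    by rewrite itv_rmapE; apply: scal_lfun_bij (lbij1 _); rewrite Lz KL.
  apply: (lbij_inj bL); rewrite [LHS]comp_lfunA -happ_nat -[LHS]comp_lfunA (sD z dz xz).
  rewrite comp_lfunA gh can_homE comp_lfun1r (@itv_lfun_comp L K L z x x) //.
have Kz : z%:E \in K by case: (LD z Lz).
rewrite (sK z ndz) comp_lfunA gh can_homE (@itv_lfun_comp L K L z z z) //.
exact: itv_lfun_id.
Qed.

End Lifting.

(** * Comparison with a listed sequence *)

Section GoodEnds.
Variables (k : fieldType) (R : realType) (Q : quiver R).
Variables (U V W : rep k Q) (f : rep_hom U V) (g : rep_hom V W).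
Implicit Types (x y z : R) (A B : set R).

Lemma hom_ok_rays_right A B C D z : upset A -> downset B -> upset C -> downset D ->
  A z -> B z -> C z -> D z -> hom_ok Q (A `&` B) (C `&` D) -> hom_ok Q B D.
Proof.
move=> uA dB uC dD Az Bz Cz Dz h; apply/hom_ok_opp.
apply: (@hom_ok_rays_left R (opp_quiver Q) (refl_set B) (refl_set A) (refl_set D) (refl_set C) (- z)).
- exact: downset_refl.
- exact: upset_refl.
- exact: downset_refl.
- exact: upset_refl.
- by rewrite /refl_set /= opprK.
- by rewrite /refl_set /= opprK.
- by rewrite /refl_set /= opprK.
- by rewrite /refl_set /= opprK.
have -> : refl_set B `&` refl_set A = refl_set (A `&` B) by rewrite setIC.
have -> : refl_set D `&` refl_set C = refl_set (C `&` D) by rewrite setIC.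
exact/hom_ok_opp.
Qed.

Lemma scal_lfunN s (b c : bool) : scal_lfun (- s) b c = (- scal_lfun (k := k) s b c)%R.
Proof. by rewrite /scal_lfun comp_lfunNr comp_lfunNl. Qed.

Lemma mono_dim_bij (A B : vectType k) (h : 'Hom(A, B)) :
  lker h = 0%VS -> \dim {:A} = \dim {:B} -> lbij h.
Proof.
move=> h0 d; apply: lbijP => //; apply/eqP; rewrite eqEdim subvf /= -d.
by rewrite -(limg_ker_dim h fullv) h0 capv0 dimv0.
Qed.

Lemma inverse_bij (A B : vectType k) (h : 'Hom(A, B)) : lbij h -> lbij (h^-1)%VF.
Proof. by move=> [h1 h2]; apply: lbij_of_inverse h2 h1. Qed.

Lemma canonical_hom (I K : interval (\bar R)) : hom_ok Q (supp I) (supp K) ->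
  exists h : rep_hom (itv_rep k Q I) (itv_rep k Q K),
    [/\ (forall x, h x = itv_lfun k I K x x),
        (forall x, (x%:E \in I) = (x%:E \in K) -> lbij (h x))
      & (exists x, supp I x /\ supp K x) -> nonzero_hom h].
Proof.
move=> ok; exists (can_hom k ok); split=> [x|x|].
- exact: can_homE.
- exact: can_hom_bij.
- exact: can_hom_nonzero.
Qed.

Hypothesis hAR : AR_sequence f g.

Section Ends.
Variables (lI lL rI rL : itv_bound (\bar R)) (l r : \bar R).
Hypothesis hl : left_end Q lI lL l.
Hypothesis hr : right_end Q rI rL r.
Hypothesis lr : (l < r)%E.

Local Notation I := (Interval lI rI).
Local Notation J1 := (Interval lI rL).
Local Notation J2 := (Interval lL rI).
Local Notation L := (Interval lL rL).

Variable t : rep_hom W (itv_rep k Q L).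
Hypothesis bt : forall x, lbij (t x).

Variable gt : rep_hom V (itv_rep k Q L).
Hypothesis gtE : forall x, gt x = (t x \o g x)%VF.
Hypothesis not_retraction :
  ~ exists s : rep_hom (itv_rep k Q L) V, forall x, (gt x \o s x)%VF = \1%VF.
Hypothesis lifting : forall K (h : rep_hom (itv_rep k Q K) (itv_rep k Q L)),
  in_rep (itv_rep k Q K) -> (exists x, supp K x) -> supp K <> supp L -> nonzero_hom h ->
  exists h' : rep_hom (itv_rep k Q K) V, forall x, (gt x \o h' x)%VF = h x.

Lemma itv_seq_of_ends : iso_to_itv_seq f g I J1 J2 L.
Proof.
have [[rU rV rW] [[[mf eg exfg] _ _] [iU iW _ _]]] := hAR.
have [stepl1 stepl2] := left_end_step hl; have [stepr1 stepr2] := right_end_step hr.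
have [[dl ndl] bdl midl bbl1 bbl2] := left_end_bounds hl.
have [[dr ndr] bdr midr bbr1 bbr2] := right_end_bounds hr.
have [z /andP[lz zr]] := ereal_between lr.
have [Az A'z] := midl z lz; have [Bz B'z] := midr z zr.
have near d : (d%:E <= l)%E -> (d%:E < r)%E by move=> h; apply: le_lt_trans h lr.
have far d : (r <= d%:E)%E -> (l < d%:E)%E by move=> h; apply: lt_le_trans lr h.
have okI1 : hom_ok Q (supp I) (supp J1).
  by rewrite !suppE; apply: hom_okI stepr1; apply: hom_ok_refl.
have okI2 : hom_ok Q (supp I) (supp J2).
  by rewrite !suppE; apply: hom_okI stepl1 _; apply: hom_ok_refl.
have ok1L : hom_ok Q (supp J1) (supp L).
  by rewrite !suppE; apply: hom_okI stepl1 _; apply: hom_ok_refl.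
have ok2L : hom_ok Q (supp J2) (supp L).
  by rewrite !suppE; apply: hom_okI stepr1; apply: hom_ok_refl.
have inE (a b : itv_bound (\bar R)) x : (x%:E \in Interval a b) = ((a <= BLeft x%:E)%O && (BRight x%:E <= b)%O).
  by rewrite itv_boundlr.
(* The left ends differ only up to [l], the right ends only from [r] on, and [l < r]; so no point
   sees both changes. *)
have agree x : (lI <= BLeft x%:E)%O = (lL <= BLeft x%:E)%O \/
               (BRight x%:E <= rI)%O = (BRight x%:E <= rL)%O.
  case: (pselect (lray lI x <-> lray lL x)) => [[h1 h2]|nl]; first by left; apply/idP/idP.
  case: (pselect (rray rI x <-> rray rL x)) => [[h1 h2]|nr]; first by right; apply/idP/idP.
  by exfalso; have := le_lt_trans (bdr x nr) (near x (bdl x nl)); rewrite ltxx.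
have ne1 : supp J1 <> supp L.
  rewrite !suppE => e; have [Bd B'd] := midr dl (near dl (bdl dl ndl)); apply: ndl.
  have : (lray lI `&` rray rL) dl <-> (lray lL `&` rray rL) dl by rewrite e.
  by move=> [h1 h2]; split=> h; [case: (h1 (conj h B'd))|case: (h2 (conj h B'd))].
have ne2 : supp J2 <> supp L.
  rewrite !suppE => e; have [Ad A'd] := midl dr (far dr (bdr dr ndr)); apply: ndr.
  have : (lray lL `&` rray rI) dr <-> (lray lL `&` rray rL) dr by rewrite e.
  by move=> [h1 h2]; split=> h; [case: (h1 (conj A'd h))|case: (h2 (conj A'd h))].
have bounded a b : bounded_below Q (lray a) -> bounded_above Q (rray b) ->
    in_rep (itv_rep k Q (Interval a b)).
  move=> [m hm bm] [n hn bn]; apply: in_rep_bounded; rewrite suppE.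
    by exists m => // x [/bm].
  by exists n => // x [_ /bn].
have [i1 [i1E i1b _]] := canonical_hom okI1.
have [i2 [i2E i2b _]] := canonical_hom okI2.
have [q1 [q1E q1b q1n]] := canonical_hom ok1L.
have [q2 [q2E q2b q2n]] := canonical_hom ok2L.
have [||p1 gp1] := lifting (bounded _ _ bbl1 bbr2) _ ne1 (h := q1).
- by exists z; rewrite suppE.
- by apply: q1n; exists z; rewrite !suppE.
have [||p2 gp2] := lifting (bounded _ _ bbl2 bbr1) _ ne2 (h := q2).
- by exists z; rewrite suppE.
- by apply: q2n; exists z; rewrite !suppE.
have [f' f'E] : exists f' : rep_hom (itv_rep k Q I) (dsum (itv_rep k Q J1) (itv_rep k Q J2)),
    forall x v, f' x v = (i1 x v, i2 x v).
  by exists (pair_hom i1 i2) => x v; apply: pair_homE.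
have [g' g'E] : exists g' : rep_hom (dsum (itv_rep k Q J1) (itv_rep k Q J2)) (itv_rep k Q L),
    forall x v, g' x v = q1 x v.1 - q2 x v.2.
  by exists (copair_hom q1 q2) => x v; apply: copair_homE.
have [phi phiE] : exists phi : rep_hom (dsum (itv_rep k Q J1) (itv_rep k Q J2)) V,
    forall x v, phi x v = p1 x v.1 - p2 x v.2.
  by exists (copair_hom p1 p2) => x v; apply: copair_homE.
have gphi x : (gt x \o phi x)%VF = g' x.
  apply/lfunP => v; rewrite comp_lfunE phiE g'E linearB.
  by rewrite -(gp1 x) -(gp2 x) !comp_lfunE.
have gf' x : (g' x \o f' x)%VF = 0.
  apply/lfunP => v; rewrite comp_lfunE g'E f'E zero_lfunE [_.1]/= [_.2]/= -!comp_lfunE.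
  rewrite i1E i2E q1E q2E.
  rewrite !itv_lfun_comp ?subrr // !inE => /andP[h1 h2] /andP[h3 h4]; by rewrite ?h1 ?h2 ?h3 ?h4.
have mono_f' : is_mono f'.
  move=> x; apply/eqP; rewrite -subv0; apply/subvP => v; rewrite memv_ker f'E => /eqP[e1 e2]; rewrite memv0.
  case: (boolP (x%:E \in I)) => Ix; last first.
    have /lfunP/(_ v) := itv_rep_dom0 (\1%VF : 'End(itv_rep k Q I x)) 0 Ix.
    by rewrite id_lfunE zero_lfunE => ->.
  have [J1x|J2x] : x%:E \in J1 \/ x%:E \in J2.
    move: Ix; rewrite !inE => /andP[h1 h2].
    by case: (agree x) => e; [right; rewrite -e h1 h2|left; rewrite h1 -e h2].
  - by rewrite -memv0 -(lbij_lker (i1b x _)) ?Ix ?J1x // memv_ker e1.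
  - by rewrite -memv0 -(lbij_lker (i2b x _)) ?Ix ?J2x // memv_ker e2.
have dims x : ((x%:E \in I) + (x%:E \in L) = (x%:E \in J1) + (x%:E \in J2))%N.
  rewrite !inE; case: (agree x) => ->; case: (_ <= _)%O; case: (_ <= _)%O; case: (_ <= _)%O => //.
have dI' K x : \dim {:itv_rep k Q K x} = (x%:E \in K) := dim_row k (x%:E \in K).
have epi_g' : is_epi g'.
  move=> x; case: (boolP (x%:E \in L)) => Lx; last first.
    by apply/eqP; rewrite eqEdim subvf dI' (negPf Lx).
  apply/eqP; rewrite eqEsubv subvf /=; apply/subvP => v _.
  have [J1x|J2x] : x%:E \in J1 \/ x%:E \in J2.
    move: Lx; rewrite !inE => /andP[h1 h2].
    by case: (agree x) => e; [left; rewrite e h1 h2|right; rewrite h1 e h2].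
  - have : v \in limg (q1 x) by rewrite lbij_limg ?memvf //; apply: q1b; rewrite Lx.
    move=> /memv_imgP[u _ ->]; apply/memv_imgP; exists (u, 0); rewrite ?memvf //.
    by rewrite g'E linear0 subr0.
  - have : v \in limg (q2 x) by rewrite lbij_limg ?memvf //; apply: q2b; rewrite Lx.
    move=> /memv_imgP[u _ ->]; apply/memv_imgP; exists (0, - u); rewrite ?memvf //.
    by rewrite g'E linear0 sub0r linearN opprK.
have ex' x : limg (f' x) = lker (g' x).
  apply/eqP; rewrite eqEdim; apply/andP; split.
    apply/subvP => _ /memv_imgP[v _ ->]; rewrite memv_ker -comp_lfunE.
    by rewrite gf' zero_lfunE.
  have d1 := limg_ker_dim (f' x) fullv; have d2 := limg_ker_dim (g' x) fullv.
  rewrite mono_f' capv0 dimv0 add0n in d1; rewrite epi_g' capfv in d2.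
  rewrite d1 -(leq_add2r (\dim {:itv_rep k Q L x})) d2 !dI' dims.
  by apply: eq_leq; apply: etrans (dim_prod _ _) _; rewrite !dI'.
have gtf x : (gt x \o f x)%VF = 0.
  apply/lfunP => v; rewrite gtE !comp_lfunE zero_lfunE.
  have : f x v \in lker (g x) by rewrite -exfg memv_img ?memvf.
  by rewrite memv_ker => /eqP ->; rewrite linear0.
have kgt x : lker (gt x) = limg (f x).
  apply/vspaceP => v; rewrite exfg !memv_ker gtE comp_lfunE; apply/eqP/eqP => [e|->]; last exact: linear0.
  apply/eqP; rewrite -memv0 -(lbij_lker (bt x)) memv_ker e eqxx //.
(* The composite of [f'] and [phi] is killed by [gt], so it lands in the image of [f]; this defines
   the comparison map on first terms. *)
have [x|psi fpsi] := @factor_mono _ _ _ _ _ _ f (comp_hom phi f') mf.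
  apply/subvP => _ /memv_imgP[v _ ->]; rewrite -kgt memv_ker -comp_lfunE.
  by rewrite comp_lfunA gphi gf' zero_lfunE.
have [I' [tU [btU neI']]] := indecomposable_interval rU iU.
pose h := comp_hom tU psi.
(* Given such a [th], subtracting from [phi] its transfer to [V] gives a map that kills [f'] and
   still lifts [g']. It descends along [g'] to a section. *)
have no_factor : ~ exists th : rep_hom (dsum (itv_rep k Q J1) (itv_rep k Q J2)) (itv_rep k Q I'),
    forall x, (th x \o f' x)%VF = h x.
  move=> [th eth]; apply: not_retraction.
  pose phi' := sub_hom phi (comp_hom f (comp_hom (inv_hom btU) th)).
  have phif x : (phi' x \o f' x)%VF = 0.
    rewrite /phi' /= comp_lfunDl comp_lfunNl -/(phi x) -/(f' x).
    rewrite -!comp_lfunA eth /h /= -/(psi x).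
    rewrite [X in (f x \o X)%VF]comp_lfunA (btU x).1 comp_lfun1l fpsi /=.
    by rewrite subrr.
  have gphi' x : (gt x \o phi' x)%VF = g' x.
    rewrite /phi' [X in (_ \o X)%VF]/= comp_lfunDr comp_lfunNr gphi.
    by rewrite [X in _ - X]comp_lfunA gtf comp_lfun0l subr0.
  have [x|s es] := factor_epi (h := phi') epi_g'.
    rewrite -ex'; apply/subvP => _ /memv_imgP[v _ ->]; rewrite memv_ker -comp_lfunE.
    by rewrite phif zero_lfunE.
  exists s => x; apply: (epi_cancel epi_g').
  by rewrite -comp_lfunA es gphi' comp_lfun1l.
have [s [hs nz]] := hom_itvE h.
have [nzh eII'] : nonzero_hom h /\ supp I = supp I'.
  case: (pselect (nonzero_hom h)) => [nzh|zh]; last first.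
    exfalso; apply: no_factor; exists (zero_hom _ _) => x; rewrite comp_lfun0l.
    by apply/esym/eqP/negPn/negP => hx; apply: zh; exists x.
  split=> //; apply: contrapT => neII'; apply: no_factor.
  have [s0 okII' [z0 [Iz0 I'z0]]] := nz nzh.
  have eI' := convex_closures (@supp_convex R I').
  set C := up_closure (supp I') in eI'; set D := down_closure (supp I') in eI'.
  have uC : upset C := @up_closure_upset R _; have dD : downset D := @down_closure_downset R _.
  move: (Iz0) (I'z0) okII'; rewrite {1}eI' suppE => -[Az0 Bz0] [Cz0 Dz0].
  rewrite eI' => okII'.
  have okAC := hom_ok_rays_left (@lray_upset R lI) (@rray_downset R rI) uC dD Az0 Bz0 Cz0 Dz0 okII'.
  have okBD := hom_ok_rays_right (@lray_upset R lI) (@rray_downset R rI) uC dD Az0 Bz0 Cz0 Dz0 okII'.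
  (* If the left ends of [I] and [I'] differ, the left step extends [h] to [J2], with [- s] to
     offset the sign in [copair_hom]. Otherwise the right ends differ, and the right step extends
     [h] to [J1]. *)
  case: (pselect (exists x, ~ (lray lI x <-> C x))) => [nAC|eAC].
    have [ok2 sub] := stepl2 C uC okAC nAC.
    have ok : hom_ok Q (supp J2) (supp I') by rewrite suppE eI'; apply: hom_okI ok2 okBD.
    exists (copair_hom (zero_hom _ _) (scal_hom (- s) ok)) => x; rewrite hs.
    apply/lfunP => v; rewrite comp_lfunE copair_homE f'E zero_lfunE sub0r [_.2]/= -comp_lfunE.
    rewrite i2E -can_homE (_ : scal_hom (- s) ok x = - scal_app Q s J2 I' x); last exact: scal_lfunN.
    rewrite comp_lfunNl opp_lfunE opprK scal_app_comp ?comp_lfun1r //.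
    apply/implyP => /andP[Ix I'x].
    have [Ax Bx] : lray lI x /\ rray rI x by rewrite -[_ /\ _]/((lray lI `&` rray rI) x) -suppE.
    have [Cx Dx] : C x /\ D x by rewrite -[_ /\ _]/((C `&` D) x) -eI'.
    have : supp J2 x by rewrite suppE; split=> //; apply: sub.
    by [].
  case: (pselect (exists x, ~ (rray rI x <-> D x))) => [nBD|eBD].
    have [ok1 sub] := stepr2 D dD okBD nBD.
    have ok : hom_ok Q (supp J1) (supp I') by rewrite suppE eI'; apply: hom_okI okAC ok1.
    exists (copair_hom (scal_hom s ok) (zero_hom _ _)) => x; rewrite hs.
    apply/lfunP => v; rewrite comp_lfunE copair_homE f'E zero_lfunE subr0 [_.1]/= -comp_lfunE.
    rewrite i1E -can_homE scal_app_comp ?comp_lfun1r //.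
    apply/implyP => /andP[Ix I'x].
    have [Ax Bx] : lray lI x /\ rray rI x by rewrite -[_ /\ _]/((lray lI `&` rray rI) x) -suppE.
    have [Cx Dx] : C x /\ D x by rewrite -[_ /\ _]/((C `&` D) x) -eI'.
    have : supp J1 x by rewrite suppE; split=> //; apply: sub.
    by [].
  exfalso; apply: neII'; rewrite suppE eI'; congr (_ `&` _); apply/funext => x; apply/propext.
    by apply: contrapT => n; apply: eAC; exists x.
  by apply: contrapT => n; apply: eBD; exists x.
have [s0 _ _] := nz nzh.
have bpsi x : lbij (psi x).
  have bh : lbij (h x) by rewrite hs; apply: scal_app_bij eII' (line_end_bij s0).
  have -> : psi x = ((tU x)^-1 \o h x)%VF by rewrite /= comp_lfunA (btU x).1 comp_lfun1l.
  exact: lbij_comp (inverse_bij (btU x)) bh.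
(* A five lemma: injectivity is a diagram chase, and both middle terms have the same dimension. *)
have bphi x : lbij (phi x).
  apply: mono_dim_bij.
    apply/eqP; rewrite -subv0; apply/subvP => v; rewrite memv_ker memv0 => /eqP phiv.
    have : v \in limg (f' x) by rewrite ex' memv_ker -gphi comp_lfunE phiv linear0.
    move=> /memv_imgP[u _ ev]; have : f x (psi x u) = 0.
      by have /lfunP/(_ u) := fpsi x; rewrite !comp_lfunE -ev phiv.
    move=> e; have : psi x u \in lker (f x) by rewrite memv_ker e.
    rewrite mf memv0 => /eqP e'; have : u \in lker (psi x) by rewrite memv_ker e'.
    by rewrite (lbij_lker (bpsi x)) memv0 => /eqP e''; rewrite ev e'' linear0.
  apply: etrans (dim_prod _ _) _; rewrite -(limg_ker_dim (g x) fullv) capfv -exfg eg.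
  have := limg_ker_dim (f x) fullv; rewrite mf capv0 dimv0 add0n => ->.
  by rewrite -(lbij_dim (bpsi x)) (lbij_dim (bt x)) !dI' dims.
exists f', g'; split.
- by move=> x v; rewrite f'E i1E i2E.
- by move=> x v; rewrite g'E q1E q2E.
exists (inv_hom bpsi), (inv_hom bphi), t; split.
- exact: is_iso_inv.
- exact: is_iso_inv.
- exact/is_isoP.
- move=> x; apply: (lbij_inj (bphi x)); rewrite [LHS]comp_lfunA (bphi x).2 comp_lfun1l.
  have e : (phi x \o f' x)%VF = (f x \o psi x)%VF by rewrite fpsi.
  by rewrite [RHS]comp_lfunA e -[RHS]comp_lfunA (bpsi x).2 comp_lfun1r.
- move=> x; apply: (lbij_surj (bphi x)); rewrite -[RHS]comp_lfunA (bphi x).1 comp_lfun1r.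
  by rewrite -gtE gphi.
Qed.

End Ends.

Lemma ar_not_retraction L (t : rep_hom W (itv_rep k Q L)) : (forall x, lbij (t x)) ->
  ~ exists s : rep_hom (itv_rep k Q L) V, forall x, (comp_hom t g x \o s x)%VF = \1%VF.
Proof.
move=> bt [s gs]; have [_ [[_ _ nr] _]] := hAR; apply: nr.
exists (comp_hom s t) => x; apply: (lbij_inj (bt x)).
by rewrite comp_lfun1r [LHS]comp_lfunA [LHS]comp_lfunA gs comp_lfun1l.
Qed.

Lemma ar_lifting L (t : rep_hom W (itv_rep k Q L)) : (forall x, lbij (t x)) ->
  forall K (h : rep_hom (itv_rep k Q K) (itv_rep k Q L)),
  in_rep (itv_rep k Q K) -> (exists x, supp K x) -> supp K <> supp L -> nonzero_hom h ->
  exists h' : rep_hom (itv_rep k Q K) V, forall x, (comp_hom t g x \o h' x)%VF = h x.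
Proof.
move=> bt K h rK neK KL [x0 hx0]; have [_ [_ [_ _ _ lift]]] := hAR.
have [||h' e] := lift _ (comp_hom (inv_hom bt) h) rK (indecomposable_itv k Q neK).
(* Isomorphic interval representations have equal pointwise dimensions, hence equal supports. *)
- move=> iso; apply: KL; apply/funext => x; apply/propext.
  have d : \dim {:itv_rep k Q K x} = \dim {:itv_rep k Q L x}.
    by rewrite (isomorphic_dim x iso) (lbij_dim (bt x)).
  move: d; rewrite (dim_row k (x%:E \in K)) (dim_row k (x%:E \in L)) !suppP.
  by case: (_ \in K); case: (_ \in L).
- exists x0; apply: contra hx0 => /eqP e; apply/eqP.
  have -> : h x0 = (t x0 \o ((t x0)^-1 \o h x0))%VF by rewrite comp_lfunA (bt x0).2 comp_lfun1l.
  by move: e => /= ->; rewrite comp_lfun0r.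
exists h' => x; rewrite -[LHS]comp_lfunA -e /=.
by rewrite comp_lfunA (bt x).2 comp_lfun1l.
Qed.

End GoodEnds.

Theorem theorem3p2p1 (k : fieldType) (R : realType) (Q : quiver R)
    (U V W : rep k Q) (f : rep_hom U V) (g : rep_hom V W)
    (hAR : AR_sequence f g) :
  exists I J1 J2 L : interval (\bar R),
    ar_type Q I J1 J2 L /\ iso_to_itv_seq f g I J1 J2 L.
Proof.
have [[_ rV rW] [[[_ eg _] _ _] [_ iW _ _]]] := hAR.
have [L0 [t0 [bt0 [z Lz]]]] := indecomposable_interval rW iW.
have [c [N cV]] := colouring_exists rV; have [mc bc _ _ _] := cV.
have [n0 [n1 [hn0 hn1 bW]]] := in_rep_support rW.
have bL0 x : supp L0 x -> (pt Q n0 <= x%:E <= pt Q n1)%E.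
  move=> L0x; apply: bW; rewrite (lbij_dim (bt0 x)) (dim_row k (x%:E \in L0)).
  by move/suppP: L0x => ->.
have eL0 := convex_closures (@supp_convex R L0).
set A := up_closure (supp L0) in eL0; set B := down_closure (supp L0) in eL0.
have Az : A z by exists z.
have Bz : B z by exists z.
have fA : left_fam Q A.
  split; first exact: up_closure_upset.
  by exists n0 => // x [y /bL0/andP[ny _] yx]; apply: le_trans ny _; rewrite lee_fin.
have fB : right_fam Q B.
  split; first exact: down_closure_downset.
  by exists n1 => // x [y /bL0/andP[_ yn] xy]; apply: le_trans yn; rewrite lee_fin.
have interval_of A2 B2 : left_fam Q A2 -> right_fam Q B2 ->
    exists K, supp K = A2 `&` B2 /\ in_rep (itv_rep k Q K).
  move=> [uA [m hm bm]] [dB [n hn bn]].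
  have [K eK] := convex_supp (rays_convex uA dB); exists K; split=> //.
  apply: in_rep_bounded; rewrite eK.
    by exists m => // x [/bm].
  by exists n => // x [_ /bn].
have nr := ar_not_retraction hAR bt0; have lift := ar_lifting hAR bt0.
have [bad|[lI [lL [l [hl eA]]]]] := left_end_cases mc bc fA Az.
  exfalso; apply: (bad_end_absurd nr lift cV eL0 (bad B fB.1 Bz)) => A2 fA2.
  exact: interval_of.
have [bad|[rI [rL [r [hr eB]]]]] := right_end_cases mc bc fB Bz.
  exfalso; apply: (bad_end_absurd nr lift cV _ (bad A fA.1 Az)); first by rewrite setIC.
  by move=> B2 fB2; rewrite setIC; apply: interval_of.
case: (boolP (l < r)%E) => [lr|/negP nlr]; last first.
  exfalso; have [||p hp] := ends_projective (z := z) hl hr _ _ nlr.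
  - by rewrite -eA.
  - by rewrite -eB.
  apply: (@projective_absurd k R Q V L0 (comp_hom t0 g) nr p).
    by rewrite eL0 eA eB; apply/funext => x; apply/propext; apply: hp.
  by move=> x; rewrite /= limg_comp eg; apply: lbij_limg.
(* Different intervals of extended reals can have the same real support, for instance with an
   infinite end, so [t0] is composed with the canonical isomorphism. *)
have eL : supp L0 = supp (Interval lL rL) by rewrite suppE -eA -eB.
have ok : hom_ok Q (supp L0) (supp (Interval lL rL)) by rewrite eL; apply: hom_ok_refl.
have [i [_ bi _]] := canonical_hom k ok.
have [t bt] : exists t : rep_hom W (itv_rep k Q (Interval lL rL)), forall x, lbij (t x).
  exists (comp_hom i t0) => x; apply: lbij_comp (bt0 x); apply: bi.
  by have := congr1 (@^~ x) eL; rewrite /supp /= => e; apply/idP/idP; rewrite e.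
exists (Interval lI rI), (Interval lI rL), (Interval lL rI), (Interval lL rL); split.
  exact: ends_ar_type hl hr lr.
apply: (itv_seq_of_ends hAR hl hr lr bt (gt := comp_hom t g)) => //.
- exact (ar_not_retraction hAR bt).
- exact (ar_lifting hAR bt).
Qed.
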